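(* Let $n\ge 2$, $1<p<\infty$, $n<q\le\infty$, and let $\Omega\subset\mathbb{R}^n$ be a bounded Lipschitz domain, $U\Subset\Omega$ a Lipschitz subdomain, and $f\in C^\infty(\Omega)$. Let $\{E^\epsilon\}_{0<\epsilon\le1}\subset C^\infty(\mathbb{R}^n)$ be a family of strictly convex functions for which there are constants $0<C_1\le C_2<\infty$, independent of $\epsilon$, such that $$C_1(\epsilon^2+|z_0|^2)^{p/2-1}|\zeta|^2\le\langle\nabla_z^2E^\epsilon(z_0)\zeta\mid\zeta\rangle,\qquad |\langle\nabla_z^2E^\epsilon(z_0)\zeta\mid\omega\rangle|\le C_2(\epsilon^2+|z_0|^2)^{p/2-1}|\zeta||\omega|$$ for all $0<\epsilon\le 1$ and all $z_0,\zeta,\omega\in\mathbb{R}^n$ with $|z_0|\ge1$. Then there exist a constant $g=g(n,p,q)\ge n/p$ and a constant $C=C(n,p,q,C_1,C_2)$, depending only on the indicated quantities, such that for every $0<\epsilon\le 1$ and every classical solution $u^\epsilon\in C^\infty(U)$ to $$-\mathrm{div}\,\nabla_zE^\epsilon(\nabla u^\epsilon)=f\quad\text{in }U,$$ we have $$\sup_{B_{\theta R}}|\nabla u^\epsilon|\le\frac{C}{[(1-\theta)R]^{g}}\left(R^{n/p}\left[1+\|f\|_{L^q(B_R)}^{1/(p-1)}\right]+\|\nabla u^\epsilon\|_{L^p(B_R)}\right)$$ for any closed ball $B_R\subset U$ with $0<R\le1$ and any $0<\theta<1$.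
   Context: $\langle\cdot\mid\cdot\rangle$ is the canonical inner product on $\mathbb{R}^n$; $\nabla_z^2E^\epsilon$ is the Hessian matrix of $E^\epsilon$; $B_{\theta R}$ is the closed ball of radius $\theta R$ with the same center as $B_R$. *)

(* Defs.v *)
From HB Require Import structures.
From mathcomp Require Import all_boot all_order all_algebra.
From mathcomp Require Import all_classical all_reals all_analysis.

Set Implicit Arguments.
Unset Strict Implicit.
Unset Printing Implicit Defensive.

Import Order.TTheory GRing.Theory Num.Theory.
Import numFieldNormedType.Exports.

Local Open Scope classical_set_scope.
Local Open Scope ring_scope.

(* R^n is 'rV[R]_n. The library norm `|x| on it is the sup norm, which induces
   the usual topology, differentiability and notion of Lipschitz map; every
   metric quantity below uses the Euclidean norm [enorm] instead. *)

Section Euclidean.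
Context {R : realType} {n : nat}.
Implicit Types (x y e : 'rV[R]_n) (A : set 'rV[R]_n).

Definition dot x y : R := \sum_(i < n) x 0 i * y 0 i.

Definition enorm x : R := Num.sqrt (dot x x).

Definition eball x (r : R) : set 'rV[R]_n := [set y | enorm (y - x) <= r].

(* Near each boundary point, after choosing the unit vector e as vertical axis,
   A is the part of a ball lying strictly above the graph of a Lipschitz
   function gamma on the hyperplane orthogonal to e (a copy of R^(n-1));
   y - <y|e> e and <y|e> are the horizontal and vertical coordinates of y. *)
Definition lipschitz_boundary A : Prop :=
  forall x, (closure A `\` A°) x ->
  exists (e : 'rV[R]_n) (r : R) (gamma : 'rV[R]_n -> R),
  [/\ enorm e = 1, 0 < r,
      exists k : R, k.-lipschitz_[set y | dot y e = 0] gamma &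
      forall y, enorm (y - x) < r ->
        A y <-> gamma (y - dot y e *: e) < dot y e].

Definition lipschitz_domain A : Prop :=
  [/\ open A, connected A, A !=set0 & lipschitz_boundary A].

Definition compactly_contained A B : Prop :=
  compact (closure A) /\ closure A `<=` B.

End Euclidean.

Section Calculus.
Context {R : realType} {n : nat}.
Implicit Types (f : 'rV[R]_n -> R) (F : 'rV[R]_n -> 'rV[R]_n).

Definition partial (i : 'I_n) f : 'rV[R]_n -> R :=
  'D_(delta_mx 0 i) (f : 'rV[R]_n -> R^o).

Definition iter_partial (s : seq 'I_n) f : 'rV[R]_n -> R := foldr partial f s.

(* f is a total function, but on an open set A its partial derivatives of all
   orders only depend on the values of f on A. *)
Definition smooth_on (A : set 'rV[R]_n) f : Prop :=
  forall (s : seq 'I_n) x, A x ->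
    {for x, continuous (iter_partial s f)} /\
    forall i, derivable (iter_partial s f : 'rV[R]_n -> R^o) x (delta_mx 0 i).

Definition gradient f : 'rV[R]_n -> 'rV[R]_n :=
  fun x => \row_i partial i f x.

Definition divergence F : 'rV[R]_n -> R :=
  fun x => \sum_(i < n) partial i (fun y => F y 0 i) x.

(* Acts on row vectors from the right: (v *m hessian f x) 0 j is the sum over i
   of v_i d_i d_j f, the j-th coordinate of the Hessian applied to v. *)
Definition hessian f (x : 'rV[R]_n) : 'M[R]_n :=
  \matrix_(i, j) partial i (partial j f) x.

Definition strictly_convex f : Prop :=
  forall x y (t : R), x != y -> 0 < t < 1 ->
    f (t *: x + (1 - t) *: y) < t * f x + (1 - t) * f y.

End Calculus.

(* Lebesgue measure on R^n. The library provides the product sigma-algebra on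
   tuples; the measure is the n-fold product of the one-dimensional Lebesgue
   measure, see [lebesgue_Rn_box]. *)
Section LebesgueMeasure.
Context (R : realType).
Local Open Scope ereal_scope.

Definition tcons n (z : n.-tuple (measurableTypeR R) * measurableTypeR R) :
    n.+1.-tuple (measurableTypeR R) := [tuple of z.2 :: z.1].

Lemma measurable_tcons n : measurable_fun setT (@tcons n).
Proof. exact: measurable_cons. Qed.

HB.instance Definition _ n :=
  isMeasurableFun.Build _ _ _ _ (@tcons n) (@measurable_tcons n).

Section step.
Context n (mu : {measure set (n.-tuple (measurableTypeR R)) -> \bar R}).

Definition lebesgue_step : set (n.+1.-tuple (measurableTypeR R)) -> \bar R :=
  pushforward (mu \x @lebesgue_measure R) (@tcons n).

Let step0 : lebesgue_step set0 = 0. Proof. exact: measure0. Qed.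

Let step_ge0 A : 0 <= lebesgue_step A. Proof. exact: measure_ge0. Qed.

Let step_sigma_additive : semi_sigma_additive lebesgue_step.
Proof. exact: measure_semi_sigma_additive. Qed.

HB.instance Definition _ := isMeasure.Build _ _ _ lebesgue_step
  step0 step_ge0 step_sigma_additive.
End step.

Fixpoint lebesgue_Rn n :
    {measure set (n.-tuple (measurableTypeR R)) -> \bar R} :=
  match n with
  | 0 => dirac [tuple]
  | m.+1 => lebesgue_step (lebesgue_Rn m)
  end.

Lemma lebesgue_Rn_box n (A : 'I_n -> set (measurableTypeR R)) :
  (forall i, measurable (A i)) ->
  lebesgue_Rn n [set t | forall i, A i (tnth t i)] =
  \prod_(i < n) lebesgue_measure (A i).
Proof.
elim: n A => [|n IH] A mA.
  rewrite big_ord0 /= diracE mem_set//.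
  by case.
rewrite big_ord_recl /= /lebesgue_step /pushforward.
set B := (X in product_measure1 _ _ X).
have mB : measurable [set t : n.-tuple (measurableTypeR R) |
    forall i, A (lift ord0 i) (tnth t i)].
  rewrite (_ : [set _ | _] = \bigcap_(i in [set: 'I_n])
    ((fun t => tnth t i) @^-1` A (lift ord0 i))); last first.
    by apply/seteqP; split=> t /= h i; [move=> _|]; exact: h.
  apply: fin_bigcap_measurable => // i _; rewrite -[X in measurable X]setTI.
  exact: measurable_tnth.
have -> : B = [set t | forall i, A (lift ord0 i) (tnth t i)] `*` A ord0.
  apply/seteqP; split=> -[t x] /=.
    by move=> h; split=> [i|]; [have := h (lift ord0 i); rewrite tnthS|exact: (h ord0)].
  by move=> [h h0] i; case: (unliftP ord0 i) => [j|] -> //; rewrite tnthS.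
by rewrite product_measure1E// muleC; congr (_ * _); exact: IH.
Qed.

End LebesgueMeasure.

(* The L^q norm over B of a function h given on B, i.e. of its extension by 0;
   q = +oo gives the essential supremum. *)
Definition Lnorm_on {R : realType} {n : nat} (q : \bar R)
    (B : set 'rV[R]_n) (h : 'rV[R]_n -> R) : \bar R :=
  Lnorm (lebesgue_Rn R n) q
    (fun t => ((h \_ B) (\row_(i < n) tnth t i))%:E).

(* Main.v *)
Require Import Defs.
From HB Require Import structures.
From mathcomp Require Import all_boot all_order all_algebra.
From mathcomp Require Import all_classical all_reals all_analysis.
From mathcomp Require Import measurable_realfun ess_sup_inf.
From mathcomp Require Import ring lra.

(** The proof is a De Giorgi iteration for s = |grad u|^2. For y in the ball of
    radius theta R the ball of radius rho = (1 - theta) R around y lies in B_R, so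
    it suffices to bound s at the centre of a ball by norms over that ball.

    Differentiating the equation, each derivative d_k u solves a linear equation
    with coefficients A, the Hessian of E^eps at grad u, and where s >= 1 these
    are comparable to s^(p/2-1). Test the k-th equation with
    eta^2 d_k u s^-b (1 - kap/s)_+^3, where eta is a cutoff, kap >= 1,
    g = min (p - 1) (p / 2) and b = p/2 - g, and sum over k. The test functions
    vanish where s <= kap, so that ellipticity is used only where |grad u| >= 1.
    Because 2 b < 1, the terms that come from differentiating s^-b do not destroy
    coercivity ([elliptic_pointwise]), and the result controls s^(g-2) |grad s|^2
    by s^g and f^2 s^(g+1-p), see [weighted_hessian].

    In place of Sobolev's inequality serves an elementary inequality in L^1
    ([faber_krahn]): if G vanishes off a set of measure at most ell^n / 2, its
    integral is at most 2 ell times that of the sum of the |d_i G|, as one sees by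
    comparing G with its translates by vectors of a cube of side ell. Applied to
    G = eta^2 s^g (1 - kap/s)_+^4 it yields [energy_estimate]: the integral of G is
    at most a constant times ell^2 times the integral of s^g + f^2 s^(g+1-p) over
    the part of the ball where s > kap.

    Between two consecutive levels ([degiorgi_step]) the factor ell^2 gains the
    power 2/n of the measure of the level set, and f in L^q loses only the power
    2/q. As q > n, the exponent aa = 2/n - 2/q is positive, the masses satisfy
    beta_(j+1) <= D (4^5)^j beta_j^(1+aa), and they tend to 0 when the first one is
    small ([degiorgi_iteration]). This gives s y <= 2 K ([degiorgi_center]) as soon
    as K = M^2 Lambda, where M = 1 + |f|_q^(1/(p-1)) + |grad u|_p and Lambda is a
    power of rho^-1: g + 1 - p <= 0 lets K absorb the source, and the L^p norm of
    the gradient starts the iteration ([interior_gradient_bound]). Hence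
    |grad u y| <= C M rho^(-4/(aa p)), and the theorem holds with the exponent
    4/(aa p) + n/p. *)

Set Implicit Arguments.
Unset Strict Implicit.
Unset Printing Implicit Defensive.

Import Order.TTheory GRing.Theory Num.Theory.
Import numFieldNormedType.Exports.

Local Open Scope classical_set_scope.
Local Open Scope ring_scope.

(** * Lebesgue measure on row vectors *)

Section Leb.
Context (R : realType).
Local Notation T n := (n.-tuple (measurableTypeR R)).

(** [lebesgue_Rn] under a name to which sigma-finiteness can be attached, as
    Fubini's theorem requires. *)
Definition leb n : set (T n) -> \bar R := lebesgue_Rn R n.
HB.instance Definition _ n := Measure.on (@leb n).

Definition vect n (t : T n) : 'rV[R]_n := \row_i tnth t i.

Lemma measurable_tuple_box n (A : 'I_n -> set (measurableTypeR R)) :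
  (forall i, measurable (A i)) ->
  measurable [set t : T n | forall i, A i (tnth t i)].
Proof.
move=> mA.
rewrite (_ : [set _ | _] = \bigcap_(i in [set: 'I_n])
    ((fun t => tnth t i) @^-1` A i)); last first.
  by apply/seteqP; split=> t /= h i; [move=> _|]; exact: h.
apply: fin_bigcap_measurable => // i _; rewrite -[X in measurable X]setTI.
exact: measurable_tnth.
Qed.

Definition cube n (a : 'I_n -> R) (l : R) : set (T n) :=
  [set t | forall i, `[a i, a i + l]%classic (tnth t i : R)].

Lemma measurable_cube n a l : measurable (@cube n a l).
Proof. by apply: (@measurable_tuple_box _ (fun i => `[a i, a i + l]%classic)) => i; exact: measurable_itv. Qed.

Lemma leb_cube n a l : 0 < l -> leb (@cube n a l) = (l ^+ n)%:E.
Proof.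
move=> l0; rewrite /leb /cube.
rewrite (@lebesgue_Rn_box R n (fun i => `[a i, a i + l]%classic)); last first.
  by move=> i; exact: measurable_itv.
under eq_bigr do rewrite lebesgue_measure_itv/= lte_fin ltrDl l0 -EFinD addrAC subrr add0r.
by rewrite prodEFin prodr_const card_ord.
Qed.

Lemma leb_sigma_finite n : sigma_finite setT (@leb n).
Proof.
exists (fun k : nat => @cube n (fun=> - k.+1%:R) (k.+1%:R + k.+1%:R)).
  apply/seteqP; split => // t _.
  exists (\sum_(i < n) Num.bound `|tnth t i : R|)%N => // i /=.
  rewrite in_itv/= addKr -ler_norml.
  rewrite (le_trans (ltW (archi_boundP (normr_ge0 _))))//.
  by rewrite ler_nat (bigD1 i)//= ltnW// ltnS leq_addr.
move=> k; split; first exact: measurable_cube.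
by rewrite leb_cube ?addr_gt0// ltry.
Qed.

HB.instance Definition _ n :=
  Measure_isSigmaFinite.Build _ _ _ (@leb n) (@leb_sigma_finite n).

(** The sigma-algebra on tuples is the product one, so an open set has to be
    exhausted by countably many boxes: those with rational centre and radius
    1/(k+1) that it contains. *)
Lemma open_vect_measurable n (O : set 'rV[R]_n) : open O ->
  measurable (@vect n @^-1` O).
Proof.
move=> oO.
pose box (c : 'rV[rat]_n * nat) : set (T n) := [set t | forall i : 'I_n,
  ball (ratr (c.1 0 i) : R) (c.2.+1%:R^-1) (tnth t i : R)].
pose I := [set c | forall t, box c t -> O (vect t)].
have -> : @vect n @^-1` O = \bigcup_c (if c \in I then box c else set0).
  apply/seteqP; split => [t /= Ot|t [c _]]; last first.
    by case: ifPn => // /set_mem; apply.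
  have /nbhs_ballP[e /= e0 eO] : nbhs (vect t) O by exact: open_nbhs_nbhs.
  have [k ke] : exists k : nat, k.+1%:R^-1 + k.+1%:R^-1 <= e.
    exists (Num.bound (2 / e)); set y : R := _^-1.
    rewrite (_ : y + y = 2 * y); last by ring.
    rewrite ler_pdivrMr// -ler_pdivrMl//.
    by rewrite mulrC (le_trans (ltW (archi_boundP _))) ?ler_nat// divr_ge0// ltW.
  have k0 : 0 < k.+1%:R^-1 :> R by rewrite invr_gt0.
  have hc i : exists q : rat, ball (ratr q : R) (k.+1%:R^-1) (tnth t i : R).
    have xy : (tnth t i : R) - k.+1%:R^-1 < (tnth t i : R) + k.+1%:R^-1.
      by rewrite ltrD2l gtrN.
    have [q] := rat_in_itvoo xy.
    rewrite in_itv/= => /andP[q1 q2]; exists q.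
    by rewrite /ball/= ltr_distl ltrBlDr q2 -ltrBlDr q1.
  pose c : 'rV[rat]_n := \row_i sval (cid (hc i)).
  exists (c, k) => //; rewrite mem_set => [i|s bs].
    by rewrite /= mxE; exact: (svalP (cid (hc i))).
  apply: eO; split=> // i j; rewrite (ord1 i) !mxE.
  apply: (le_ball ke); have := bs j; rewrite mxE; apply: ball_triangle.
  exact: ball_sym (svalP (cid (hc j))).
apply: countable_bigcupT_measurable => [|c]; first exact: countableP.
case: ifP => _ //.
apply: (@measurable_tuple_box _ (fun i => ball (ratr (c.1 0 i) : R) (c.2.+1%:R^-1))) => i.
exact: measurable_ball.
Qed.

Definition cont_on n (U : set 'rV[R]_n) (f : 'rV[R]_n -> R) :=
  forall x, U x -> {for x, continuous f}.

Lemma cont_on_measurable n (U : set 'rV[R]_n) (f : 'rV[R]_n -> R) :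
  open U -> cont_on U f -> measurable_fun (@vect n @^-1` U) (fun t => f (vect t)).
Proof.
move=> oU cf; apply: (measurability _ (RGenOpens.measurableE R)).
move=> _ [_ [a [b ->] <-]].
rewrite [X in measurable X](_ : _ = @vect n @^-1` (U `&` f @^-1` `]a, b[%classic)); last first.
  by [].
apply: open_vect_measurable.
rewrite openE => x [Ux fx]; apply: filterI; first exact: open_nbhs_nbhs.
apply: (cf x Ux); exact: open_nbhs_nbhs.
Qed.

Definition transl n (h : T n) (t : T n) : T n := [tuple tnth t i + tnth h i | i < n].

Lemma vect_transl n (h t : T n) : vect (transl h t) = vect t + vect h.
Proof. by apply/rowP => i; rewrite !mxE tnth_mktuple. Qed.

Lemma measurable_transl n (h : T n) : measurable_fun setT (transl h).
Proof.
apply/measurable_fun_tnthP => i.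
rewrite (_ : _ \o _ = fun t => (tnth t i : R) + tnth h i); last first.
  by apply/funext => t /=; rewrite tnth_mktuple.
apply: (@measurable_funD _ _ _ _ (fun t : T n => (tnth t i : R)) (cst (tnth h i))).
  exact: measurable_tnth.
exact: measurable_cst.
Qed.
HB.instance Definition _ n h := isMeasurableFun.Build _ _ _ _ (@transl n h) (measurable_transl h).

Definition shift1 (h x : measurableTypeR R) : measurableTypeR R := (x : R) + h.
Lemma measurable_shift1 h : measurable_fun setT (shift1 h).
Proof.
by apply: (@measurable_funD _ _ _ _ (@idfun R) (cst h)); [exact: measurable_id | exact: measurable_cst].
Qed.
HB.instance Definition _ h := isMeasurableFun.Build _ _ _ _ (shift1 h) (measurable_shift1 h).

Lemma lebesgue_measure_shift1 h A : measurable A ->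
  pushforward (@lebesgue_measure R) (shift1 h) A = lebesgue_measure A.
Proof.
move=> mA; apply/esym/lebesgue_measure_unique => //= _ [[a b]] _ <-.
rewrite /pushforward.
have -> : shift1 h @^-1` `]a, b] = `]a - h, b - h]%classic.
  by apply/seteqP; split => x /=; rewrite !in_itv/= /shift1 ltrBlDr lerBrDr.
by rewrite /= !lebesgue_measure_itv/= !lte_fin ltrD2r -!EFinD; case: ifP => // _; congr (_%:E); ring.
Qed.

(** By induction on n: a product measure is determined by its values on
    measurable rectangles, and both factors are translation invariant. *)
Lemma leb_transl n (h : T n) A : measurable A ->
  pushforward (@leb n) (transl h) A = leb A.
Proof.
elim: n h A => [|n IH] h A mA.
  rewrite /pushforward; congr (leb _); apply/seteqP.
  by split => t /=; rewrite (tuple0 t) (tuple0 (transl _ _)).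
pose h' : T n := [tuple of behead h].
pose g (z : T n * measurableTypeR R) := (transl h' z.1, shift1 (thead h) z.2).
have mg : measurable_fun setT g.
  apply/measurable_fun_pairP; split => /=.
    exact: measurableT_comp (measurable_transl h') measurable_fst.
  exact: measurableT_comp (measurable_shift1 (thead h)) measurable_snd.
pose g' : {mfun _ >-> _} := HB.pack g (isMeasurableFun.Build _ _ _ _ g mg).
have gE : transl h \o @tcons R n = @tcons R n \o g.
  apply/funext => -[t x]; apply/eq_from_tnth => i /=.
  rewrite tnth_mktuple.
  case: (unliftP ord0 i) => [j|] ->.
    rewrite !tnthS tnth_mktuple [in RHS]tnth_behead.
    by congr (_ + tnth _ _); apply/val_inj; rewrite /= /bump /= add1n inordK// ltnS; exact: (ltn_ord j).
  by [].
rewrite /pushforward /leb /=  /lebesgue_step /pushforward -[X in product_measure1 _ _ X]comp_preimage gE comp_preimage.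
have mB : measurable (@tcons R n @^-1` A).
  by rewrite -[X in measurable X]setTI; exact: measurable_tcons.
have key : (@leb n \x @lebesgue_measure R)%E (@tcons R n @^-1` A) =
    pushforward (@leb n \x @lebesgue_measure R)%E g' (@tcons R n @^-1` A).
  apply: product_measure_unique => //.
  move=> B C mB' mC.
  rewrite /= /pushforward.
  rewrite (_ : g @^-1` _ = (transl h' @^-1` B) `*` (shift1 (thead h) @^-1` C)) //.
  rewrite product_measure1E.
  - by congr (_ * _)%E; [exact: IH | exact: lebesgue_measure_shift1].
  - by rewrite -[X in measurable X]setTI; exact: measurable_transl.
  - by rewrite -[X in measurable X]setTI; exact: measurable_shift1.
exact: esym key.
Qed.
End Leb.

(** * Integrals over R^n, translations and derivatives *)

Section Integrals.
Context (R : realType) (n : nat).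
Local Notation T := (n.-tuple (measurableTypeR R)).
Local Notation X := 'rV[R]_n.
Implicit Types (h g : X -> R) (v : X).

(** The measure lives on tuples, the differential calculus on row vectors;
    [vect] pulls functions on the latter back to the former. *)
Definition Rn_measurable h := measurable_fun setT (fun t : T => h (vect t)).
Definition Rn_integral h : \bar R := (\int[@leb R n]_t (h (vect t))%:E)%E.

Lemma vectK v : exists t : T, vect t = v.
Proof.
exists [tuple v 0 i | i < n]; apply/rowP => i.
by rewrite mxE tnth_mktuple.
Qed.

Lemma Rn_measurable_joint d (S : measurableType d) (k : S -> 'I_n -> R) h :
  (forall i, measurable_fun setT (fun s => k s i)) -> Rn_measurable h ->
  measurable_fun setT (fun s => h (\row_i k s i)).
Proof.
move=> mk mh.
pose f (s : S) : T := [tuple k s i | i < n].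
rewrite [X in measurable_fun _ X](_ : _ = (fun t => h (vect t)) \o f); last first.
  apply/funext => s /=; congr h; apply/rowP => i.
  by rewrite !mxE tnth_mktuple.
apply: measurableT_comp => //.
apply/measurable_fun_tnthP => i.
rewrite (_ : _ \o _ = fun s => k s i); first exact: mk.
by apply/funext => s /=; rewrite tnth_mktuple.
Qed.

Lemma measurable_coord i : measurable_fun setT (fun t : T => (tnth t i : R)).
Proof. exact: measurable_tnth. Qed.

Lemma Rn_measurable_add h : Rn_measurable h ->
  measurable_fun setT (fun z : T * T => h (vect z.1 + vect z.2)).
Proof.
move=> mh.
rewrite [X in measurable_fun _ X](_ : _ = (fun z : T * T => h (\row_i ((tnth z.1 i : R) + tnth z.2 i)))); last first.
  by apply: funext => z /=; congr h; apply/rowP => i; rewrite !mxE.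
refine (@Rn_measurable_joint _ _ (fun (z : T * T) i => (tnth z.1 i : R) + tnth z.2 i) h _ mh) => i; apply: measurable_funD.
  exact: measurableT_comp (measurable_coord i) measurable_fst.
exact: measurableT_comp (measurable_coord i) measurable_snd.
Qed.

Lemma Rn_measurable_ray h v : Rn_measurable h ->
  measurable_fun setT (fun z : T * measurableTypeR R => h (vect z.1 + (z.2 : R) *: v)).
Proof.
move=> mh.
rewrite [X in measurable_fun _ X](_ : _ = (fun z : T * measurableTypeR R => h (\row_i ((tnth z.1 i : R) + (z.2 : R) * v 0 i)))); last first.
  by apply: funext => z /=; congr h; apply/rowP => i; rewrite !mxE.
refine (@Rn_measurable_joint _ _ (fun (z : T * measurableTypeR R) i => (tnth z.1 i : R) + (z.2 : R) * v 0 i) h _ mh) => i; apply: measurable_funD.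
  exact: measurableT_comp (measurable_coord i) measurable_fst.
apply: measurable_funM => //; exact: measurable_snd.
Qed.

Lemma Rn_measurable_shift h v : Rn_measurable h -> Rn_measurable (fun x => h (x + v)).
Proof.
move=> mh; have [t <-] := vectK v; rewrite /Rn_measurable.
under eq_fun do rewrite -vect_transl.
apply: (measurableT_comp mh); exact: measurable_transl.
Qed.

Lemma Rn_integral_shift h v : Rn_measurable h -> (forall x, 0 <= h x) ->
  Rn_integral (fun x => h (x + v)) = Rn_integral h.
Proof.
move=> mh h0; have [t <-] := vectK v; rewrite /Rn_integral.
under eq_integral do rewrite -vect_transl.
transitivity (\int[pushforward (@leb R n) (transl t)]_x (h (vect x))%:E)%E.
  rewrite [RHS]ge0_integral_pushforward//; first by apply/measurable_EFinP.
  by move=> y _; rewrite lee_fin.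
apply: eq_measure_integral => A mA _; exact: leb_transl.
Qed.

Definition Rn_integrable h := (@leb R n).-integrable setT (fun t => (h (vect t))%:E).

Lemma Rn_integrable_shift h v : Rn_integrable h -> Rn_integrable (fun x => h (x + v)).
Proof.
move=> ih; have mh : Rn_measurable h by apply/measurable_EFinP; exact: measurable_int ih.
apply/integrableP; split; first by apply/measurable_EFinP; exact: Rn_measurable_shift.
have /integrableP[_] := ih; apply: le_lt_trans.
rewrite (_ : (\int[_]_x _)%E = Rn_integral (fun x => `|h (x + v)|)) // (Rn_integral_shift (h := fun x => `|h x|)) //.
exact: measurableT_comp.
Qed.

Lemma Rn_integral_shift_integrable h v : Rn_integrable h -> Rn_integral (fun x => h (x + v)) = Rn_integral h.
Proof.
move=> ih; have mh : Rn_measurable h by apply/measurable_EFinP; exact: measurable_int ih.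
have [t tv] := vectK v; have := Rn_integrable_shift v ih; rewrite -tv /Rn_integrable => ish.
rewrite /Rn_integral.
under eq_integral do rewrite -vect_transl.
transitivity (\int[pushforward (@leb R n) (transl t)]_x (h (vect x))%:E)%E.
  rewrite [RHS]integral_pushforward//; first by apply/measurable_EFinP.
  rewrite preimage_setT (_ : _ \o _ = (fun s => (h (vect s + vect t))%:E))//.
  by apply: funext => s /=; rewrite vect_transl.
apply: eq_measure_integral => A mA _; exact: leb_transl.
Qed.

Lemma continuous_Rn_measurable h : continuous h -> Rn_measurable h.
Proof.
by move=> ch; exact: (cont_on_measurable openT (fun x _ => ch x)).
Qed.

Lemma is_derive_line (f : X -> R) x v (r : R) : derivable (f : X -> R^o) (x + r *: v) v ->
  is_derive r (1 : R) (fun s => f (x + s *: v) : R^o) ('D_v (f : X -> R^o) (x + r *: v)).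
Proof.
have E : (fun h : R => h^-1 *: (((fun s => f (x + s *: v) : R^o) \o shift r) (h *: (1 : R)) - (f (x + r *: v) : R^o)))
  = (fun h : R => h^-1 *: (((f : X -> R^o) \o shift (x + r *: v)) (h *: v) - f (x + r *: v))).
  apply/funext => h /=; congr (_ *: (f _ - _)).
  by rewrite [h%:A]mulr1 scalerDl addrCA addrA addrC addrA addrAC.
move=> D; apply: DeriveDef.
  by rewrite /derivable E.
by rewrite /derive E.
Qed.

Section dir.
Variables (phi : X -> R) (v : X).
Hypothesis dphi : forall x, derivable (phi : X -> R^o) x v.
Hypothesis cphi : continuous phi.
Hypothesis cdphi : continuous ('D_v (phi : X -> R^o)).

Lemma cont_line (g : X -> R) x : continuous g -> continuous (fun r : R => g (x + r *: v)).
Proof.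
move=> cg r; apply: (@continuous_comp _ _ _ (fun r : R => x + r *: v) g); last exact: cg.
apply: continuousD; first exact: cst_continuous.
exact: scalel_continuous.
Qed.

Lemma ftc_line x t : 0 < t ->
  (\int[lebesgue_measure]_(r in `[0%R, t]) ('D_v (phi : X -> R^o) (x + r *: v))%:E
   = (phi (x + t *: v) - phi x)%:E)%E.
Proof.
move=> t0.
have D r := is_derive_line (@dphi (x + r *: v)).
rewrite (@continuous_FTC2 _ _ (fun r => phi (x + r *: v) : R^o) 0 t t0).
- by rewrite scale0r addr0 -EFinB.
- by apply: (@continuous_subspaceT _ _ `[0%R, t]%classic (fun r : R => 'D_v (phi : X -> R^o) (x + r *: v))); exact: (@cont_line _ x (@cdphi)).
- split => [r _||].
  + exact: (@ex_derive _ _ _ _ _ _ _ (D r)).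
  + by apply: cvg_at_right_filter; exact: (@cont_line _ x (@cphi)).
  + by apply: cvg_at_left_filter; exact: (@cont_line _ x (@cphi)).
- by move=> r _; rewrite derive1E (@derive_val _ _ _ _ _ _ _ (D r)).
Qed.

Let mdphi : Rn_measurable ('D_v (phi : X -> R^o)). Proof. exact: continuous_Rn_measurable (@cdphi). Qed.

Let slab (t : R) (z : T * measurableTypeR R) : R := 'D_v (phi : X -> R^o) (vect z.1 + (z.2 : R) *: v) * \1_(`[0%R, t]%classic) (z.2 : R).

Let mslab t : measurable_fun setT (slab t).
Proof.
apply: measurable_funM; first exact: (Rn_measurable_ray v mdphi).
have mi : measurable_fun setT (\1_(`[0%R, t]%classic) : measurableTypeR R -> R).
  by apply: measurable_indic; exact: measurable_itv.
exact: (measurableT_comp mi measurable_snd).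
Qed.

(** The increment is the integral of the derivative along a segment of length t;
    once the integrals are exchanged, all translates of the derivative have the
    same integral. *)
Lemma Rn_integral_modulus t : 0 < t ->
  (Rn_integral (fun x => `|phi (x + t *: v) - phi x|%R)
   <= t%:E * Rn_integral (fun x => `|'D_v (phi : X -> R^o) x|%R))%E.
Proof.
move=> t0.
have mphi := continuous_Rn_measurable (@cphi).
pose f z := (`|slab t z|%R)%:E.
have mf : measurable_fun setT f by apply/measurable_EFinP; exact: measurableT_comp (mslab t).
have f0 z : (0 <= f z)%E by rewrite lee_fin.
apply: (@le_trans _ _ (\int[@leb R n]_x \int[@lebesgue_measure R]_r f (x, r))%E).
  apply: ge0_le_integral => //.
  - apply/measurable_EFinP; apply: measurableT_comp => //.
    apply: measurable_funB => //; exact: (Rn_measurable_shift _ mphi).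
  - exact: measurable_fun_fubini_tonelli_F.
  move=> x _.
  have ml : measurable_fun setT (fun r : R => 'D_v (phi : X -> R^o) (vect x + r *: v)).
    by apply: continuous_measurable_fun; exact: (@cont_line _ (vect x) (@cdphi)).
  rewrite -abse_EFin -(ftc_line _ t0).
  apply: (le_trans (le_abse_integral _ _ _)) => //.
    by apply/measurable_EFinP; exact: measurable_funTS ml.
  rewrite integral_mkcond le_eqVlt; apply/orP; left; apply/eqP.
  apply: eq_integral => r _.
  rewrite patchE /f /slab /= indicE; case: ifP => _; first by rewrite mulr1.
  by rewrite mulr0 normr0.
rewrite (fubini_tonelli f)//.
rewrite [leLHS](_ : _ = \int[@lebesgue_measure R]_r ((\1_(`[0%R, t]%classic) (r : R))%:E * Rn_integral (fun x => `|'D_v (phi : X -> R^o) x|%R)))%E.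
  rewrite ge0_integralZr//.
  - by rewrite integral_indic// setIT /= lebesgue_measure_itv/= lte_fin t0 oppr0 adde0.
  - apply/measurable_EFinP; apply: measurable_indic; exact: measurable_itv.
  - by apply: integral_ge0 => x _; rewrite lee_fin.
apply: eq_integral => r _; rewrite /f /slab /= indicE; case: (_ \in _) => /=.
  rewrite mul1e -(Rn_integral_shift (r *: v)) //; first by apply: eq_integral => x _; rewrite mulr1.
  exact: measurableT_comp mdphi.
rewrite mul0e; apply: integral0_eq => x _; by rewrite mulr0 normr0.
Qed.

(** The integral of phi (x + v) - phi x vanishes by translation invariance, and
    by Fubini it equals the integral of the derivative of phi along v. *)
Lemma Rn_integral_derive_eq0 : Rn_integrable phi -> Rn_integrable ('D_v (phi : X -> R^o)) ->
  Rn_integral ('D_v (phi : X -> R^o)) = 0%E.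
Proof.
move=> iphi idphi.
pose f z := (slab 1 z)%:E.
have mf : measurable_fun setT f by apply/measurable_EFinP; exact: mslab.
have inner r : (\int[@leb R n]_x f (x, r) = (\1_(`[0%R, 1%R]%classic) (r : R))%:E * Rn_integral ('D_v (phi : X -> R^o)))%E.
  rewrite /f /slab /= indicE; case: (_ \in _) => /=.
    rewrite mul1e -(Rn_integral_shift_integrable (r *: v)) //; by apply: eq_integral => x _; rewrite mulr1.
  rewrite mul0e; apply: integral0_eq => x _; by rewrite mulr0.
have If : (@leb R n \x @lebesgue_measure R)%E.-integrable setT f.
  apply/integrable21ltyP => //.
  pose I1 := Rn_integral (fun x => `|'D_v (phi : X -> R^o) x|%R).
  rewrite (_ : (\int[_]_y _)%E = \int[@lebesgue_measure R]_r ((\1_(`[0%R, 1%R]%classic) (r : R))%:E * I1))%E.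
    rewrite ge0_integralZr//.
    - rewrite integral_indic// setIT /= lebesgue_measure_itv/= lte_fin ltr01 oppr0 adde0 mul1e.
      by have /integrableP[] := idphi.
    - apply/measurable_EFinP; apply: measurable_indic; exact: measurable_itv.
    - by apply: integral_ge0 => x _; rewrite lee_fin.
  apply: eq_integral => r _; rewrite /f /slab /= indicE; case: (_ \in _) => /=.
    rewrite mul1e /I1 -(Rn_integral_shift (r *: v)) //; first by apply: eq_integral => x _; rewrite mulr1.
    exact: measurableT_comp mdphi.
  rewrite mul0e; apply: integral0_eq => x _; by rewrite mulr0 normr0.
have := Fubini If.
under [RHS]eq_integral do rewrite inner.
have /fineK Ifin := integrable_fin_num measurableT idphi.
rewrite {1}/Rn_integral -Ifin integralZr//; last first.
  exact: (@integrable_indic_itv R 0 1 true false).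
rewrite Ifin.
rewrite integral_indic// setIT /= lebesgue_measure_itv/= lte_fin ltr01 oppr0 adde0 mul1e /Rn_integral => <-.
transitivity (\int[@leb R n]_x ((phi (vect x + v))%:E - (phi (vect x))%:E))%E.
  apply: eq_integral => x _.
  rewrite -EFinB -[in RHS](scale1r v) -(ftc_line _ ltr01).
  rewrite [RHS]integral_mkcond; apply: eq_integral => r _.
  rewrite patchE /f /slab /= indicE; case: ifP => _; first by rewrite mulr1.
  by rewrite mulr0.
rewrite integralB//; last exact: Rn_integrable_shift.
have := Rn_integral_shift_integrable v iphi; rewrite /Rn_integral => ->.
by rewrite subee// integrable_fin_num.
Qed.
End dir.
End Integrals.

(** * A Faber-Krahn inequality in L^1 *)

Section FaberKrahn.
Context (R : realType) (n : nat).
Local Notation T := (n.-tuple (measurableTypeR R)).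
Local Notation X := 'rV[R]_n.
Local Notation e_ i := (delta_mx 0 i : X).

Lemma le_Rn_integral_ge0 (h g : X -> R) : Rn_measurable h -> Rn_measurable g -> (forall x, 0 <= h x) ->
  (forall x, h x <= g x) -> (Rn_integral h <= Rn_integral g)%E.
Proof.
move=> mh mg h0 hg; apply: ge0_le_integral => //; last by move=> x _; rewrite lee_fin.
- by move=> x _; rewrite lee_fin.
- exact/measurable_EFinP.
- exact/measurable_EFinP.
Qed.

Lemma Rn_integral_ge0 (h : X -> R) : (forall x, 0 <= h x) -> (0 <= Rn_integral h)%E.
Proof. by move=> h0; apply: integral_ge0 => x _; rewrite lee_fin. Qed.

Lemma Rn_integralD_ge0 (h g : X -> R) : Rn_measurable h -> Rn_measurable g -> (forall x, 0 <= h x) ->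
  (forall x, 0 <= g x) -> Rn_integral (fun x => h x + g x) = (Rn_integral h + Rn_integral g)%E.
Proof.
move=> mh mg h0 g0; rewrite /Rn_integral -ge0_integralD//.
- by move=> x _; rewrite lee_fin.
- exact/measurable_EFinP.
- by move=> x _; rewrite lee_fin.
- exact/measurable_EFinP.
Qed.

Lemma Rn_integralZ_ge0 (h : X -> R) (c : R) : Rn_measurable h -> (forall x, 0 <= h x) -> 0 <= c ->
  Rn_integral (fun x => c * h x) = (c%:E * Rn_integral h)%E.
Proof.
move=> mh h0 c0; rewrite /Rn_integral -ge0_integralZl//.
- exact/measurable_EFinP.
- by move=> x _; rewrite lee_fin.
Qed.

Lemma Rn_measurable_set (A : set X) : measurable (@vect R n @^-1` A) -> Rn_measurable (\1_A : X -> R).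
Proof. by move=> mA; exact: (@measurable_indic _ T R setT (@vect R n @^-1` A) mA). Qed.

Lemma Rn_integral_set (A : set X) : measurable (@vect R n @^-1` A) ->
  Rn_integral (\1_A : X -> R) = leb (@vect R n @^-1` A).
Proof. by move=> mA; rewrite /Rn_integral (integral_indic (@leb R n) measurableT mA) setIT. Qed.

Lemma Rn_measurable_abs (h : X -> R) : Rn_measurable h -> Rn_measurable (fun x => `|h x|).
Proof. by move=> mh; exact: measurableT_comp mh. Qed.

Section FK.
Variable G : X -> R.
Hypothesis cG : continuous G.
Hypothesis dG : forall i x, derivable (G : X -> R^o) x (e_ i).
Hypothesis cdG : forall i, continuous (partial i G).

Let mG : Rn_measurable G. Proof. exact: continuous_Rn_measurable (@cG). Qed.

(** The displacement is performed one coordinate at a time; the part already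
    performed is a translation and does not change the integral of the next
    increment. *)
Lemma Rn_integral_translate (c : 'I_n -> R) (l : R) (s : seq 'I_n) : 
  (forall i, 0 <= c i <= l) ->
  (Rn_integral (fun x => `|G (x + \sum_(i <- s) c i *: e_ i) - G x|%R) <=
    \sum_(i <- s) l%:E * Rn_integral (fun x => `|partial i G x|%R))%E.
Proof.
move=> hc; elim: s => [|i s IH].
  rewrite !big_nil [leLHS](_ : _ = 0)%E// /Rn_integral; apply: integral0_eq => x _.
  by rewrite addr0 subrr normr0.
rewrite !big_cons; set p := (\sum_(j <- s) _) in IH *.
have mp : Rn_measurable (fun x => `|G (x + p) - G x|).
  by apply: Rn_measurable_abs; apply: measurable_funB => //; exact: (Rn_measurable_shift _ mG).
have mi : Rn_measurable (fun x => `|G (x + c i *: e_ i) - G x|).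
  by apply: Rn_measurable_abs; apply: measurable_funB => //; exact: (Rn_measurable_shift _ mG).
apply: (@le_trans _ _ (Rn_integral (fun x => `|G (x + p + c i *: e_ i) - G (x + p)|%R) +
   Rn_integral (fun x => `|G (x + p) - G x|%R))%E).
  rewrite -Rn_integralD_ge0//; last exact: (Rn_measurable_shift p mi).
  apply: le_Rn_integral_ge0 => //.
  - by apply: Rn_measurable_abs; apply: measurable_funB => //; exact: (Rn_measurable_shift _ mG).
  - by apply: measurable_funD => //; exact: (Rn_measurable_shift p mi).
  - move=> x; rewrite (addrC (c i *: _)) addrA.
    by rewrite (le_trans _ (ler_normD _ _))// addrA subrK.
apply: leeD => //.
rewrite (Rn_integral_shift p mi)//.
have [ci0 cil] := andP (hc i).
have [->|ci] := eqVneq (c i) 0.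
  rewrite [leLHS](_ : _ = 0)%E.
    apply: mule_ge0; last exact: Rn_integral_ge0.
    by rewrite lee_fin (le_trans ci0).
  by apply: integral0_eq => x _; rewrite scale0r addr0 subrr normr0.
apply: (le_trans (Rn_integral_modulus (@dG i) (@cG) (@cdG i) _)).
  by rewrite lt_neqAle eq_sym ci.
by apply: lee_wpmul2r; [exact: Rn_integral_ge0|rewrite lee_fin].
Qed.

Variables (A : set X) (a l : R).
Hypotheses (G0 : forall x, 0 <= G x) (iG : Rn_integrable G).
Hypotheses (mA : measurable (@vect R n @^-1` A)) (GA : forall x, ~ A x -> G x = 0).
Hypotheses (Aa : (leb (@vect R n @^-1` A) <= a%:E)%E) (l0 : 0 < l) (al : 2 * a <= l ^+ n).

(** Average G x <= |G (x + h) - G x| + 1_A x * G (x + h) over h in the cube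
    [0, l]^n. The first term costs at most l times the gradient. By Fubini the
    second one averages to at most leb A * l^-n times the integral of G, hence
    to at most half of it, and can be absorbed. *)
Lemma faber_krahn :
  (Rn_integral G <= (2 * l)%:E * \sum_(i < n) Rn_integral (fun x => `|partial i G x|%R))%E.
Proof.
set S := (\sum_(i < n) _)%E.
have S0 : (0 <= S)%E by apply: sume_ge0 => i _; exact: Rn_integral_ge0.
pose Q : set T := @cube R n (fun=> 0) l.
have mQ : measurable Q by exact: measurable_cube.
pose H (z : T * T) : \bar R := (\1_A (vect z.1) * G (vect z.1 + vect z.2))%:E.
have mA1 := Rn_measurable_set mA.
have mH : measurable_fun setT H.
  apply/measurable_EFinP; apply: measurable_funM; last exact: Rn_measurable_add.
  exact: (measurableT_comp mA1 measurable_fst).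
have H0 z : (0 <= H z)%E by rewrite lee_fin mulr_ge0// indicE.
have step1 h : Q h -> (Rn_integral G <= l%:E * S + \int[@leb R n]_x H (x, h))%E.
  move=> Qh.
  have mm : Rn_measurable (fun x => `|G (x + vect h) - G x|).
    by apply: Rn_measurable_abs; apply: measurable_funB => //; exact: (Rn_measurable_shift _ mG).
  have mm2 : Rn_measurable (fun x => \1_A x * G (x + vect h)).
    by apply: measurable_funM => //; exact: (Rn_measurable_shift _ mG).
  apply: (@le_trans _ _ (Rn_integral (fun x => `|G (x + vect h) - G x|%R) +
      Rn_integral (fun x => (\1_A x : R) * G (x + vect h))%R)%E).
    rewrite -Rn_integralD_ge0//; last by move=> x; rewrite mulr_ge0// indicE.
    apply: le_Rn_integral_ge0 => //; first exact: measurable_funD.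
    move=> x; rewrite indicE; have [Ax|nAx] := pselect (A x).
      rewrite mem_set// mul1r distrC -lerBlDr; exact: ler_norm.
    by rewrite GA// addr_ge0// mulr_ge0// ler0n.
  apply: leeD => //.
  have := @Rn_integral_translate (fun i => tnth h i) l (index_enum 'I_n).
  rewrite -ge0_sume_distrr/=; last by move=> i _; exact: Rn_integral_ge0.
  rewrite (_ : \sum_(i <- _) _ = vect h); first by apply=> i; have := Qh i; rewrite /= in_itv/= add0r.
  rewrite [RHS]row_sum_delta; apply: eq_bigr => i _; by rewrite mxE.
have step2 : (\int[@leb R n]_(h in Q) Rn_integral G <= \int[@leb R n]_(h in Q) (l%:E * S + \int[@leb R n]_x H (x, h)))%E.
  apply: ge0_le_integral => //.
  - by move=> h _; exact: Rn_integral_ge0.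
  - apply: measurable_funTS; apply: emeasurable_funD => //.
    exact: (measurable_fun_fubini_tonelli_G H).
have IQ (k : \bar R) : (\int[@leb R n]_(h in Q) k = k * (l ^+ n)%:E)%E.
  by transitivity (k * leb Q)%E; [exact: integral_cst|rewrite leb_cube].
move: step2; rewrite IQ ge0_integralD//; last 3 first.
  - by move=> h _; apply: mule_ge0 => //; rewrite lee_fin ltW.
  - by move=> h _; exact: integral_ge0.
  - by apply: measurable_funTS; exact: (measurable_fun_fubini_tonelli_G H).
rewrite IQ => step3.
have step4 : (\int[@leb R n]_(h in Q) \int[@leb R n]_x H (x, h) <= a%:E * Rn_integral G)%E.
  apply: (@le_trans _ _ (\int[@leb R n]_h \int[@leb R n]_x H (x, h))%E).
    apply: ge0_subset_integral => //.
    - exact: (measurable_fun_fubini_tonelli_G H).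
    - by move=> h _; exact: integral_ge0.
  rewrite -(fubini_tonelli H)// /H /=.
  rewrite (_ : (\int[_]_x _)%E = (\int[@leb R n]_x ((\1_(@vect R n @^-1` A) x)%:E * Rn_integral G)))%E.
    rewrite ge0_integralZr//.
    - rewrite integral_indic// setIT; apply: lee_wpmul2r => //; exact: Rn_integral_ge0.
    - exact/measurable_EFinP.
    - exact: Rn_integral_ge0.
  apply: eq_integral => x _.
  rewrite -(Rn_integral_shift (vect x) mG)// /Rn_integral -ge0_integralZl//.
  - by apply: eq_integral => y _; rewrite EFinM addrC.
  - apply/measurable_EFinP; exact: (Rn_measurable_shift _ mG).
  - by move=> y _; rewrite lee_fin.
have Ifin : Rn_integral G \is a fin_num by exact: integrable_fin_num iG.
have [I Ie] : exists I : R, Rn_integral G = I%:E by exists (fine (Rn_integral G)); rewrite fineK.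
have I0 : 0 <= I by rewrite -lee_fin -Ie; exact: Rn_integral_ge0.
have ln0 : 0 < l ^+ n by rewrite exprn_gt0.
move: step3; rewrite Ie; clear step1; case: S S0 => [S| |] S0 step3; last first.
- by [].
- by rewrite gt0_muley ?leey// lte_fin mulr_gt0.
have {}step4 := le_trans step3 (leeD2l _ step4).
move: step4; rewrite Ie -!EFinM -EFinD !lee_fin => step4.
rewrite lee_fin in S0.
have aI : 2 * a * I <= l ^+ n * I by rewrite ler_wpM2r.
rewrite -(ler_pM2r ln0); nra.
Qed.
End FK.
End FaberKrahn.

(** * C^1 functions of several variables *)

Section Calculus.
Context (R : realType) (n : nat).
Local Notation X := 'rV[R]_n.
Local Notation e_ i := (delta_mx 0 i : X).
Implicit Types (f g : X -> R) (U : set X).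

Lemma MVT_line f (x v : X) (h : R) :
  (forall t, `|t| <= `|h| -> derivable (f : X -> R^o) (x + t *: v) v) ->
  exists2 t : R, `|t| <= `|h| & f (x + h *: v) - f x = h * 'D_v (f : X -> R^o) (x + t *: v).
Proof.
pose F := fun t : R => (f (x + t *: v) : R^o).
pose dF := fun t : R => ('D_v (f : X -> R^o) (x + t *: v) : R).
move=> df.
have D (t : R) : `|t| <= `|h| -> is_derive t (1 : R) F (dF t).
  by move=> th; apply: is_derive_line; exact: df.
have C (a b : R) : (forall t, a <= t <= b -> `|t| <= `|h|) -> {within `[a, b], continuous F}.
  move=> H; apply: derivable_within_continuous => t; rewrite in_itv/= => tab.
  exact: (@ex_derive _ _ _ _ _ _ _ (D t (H t tab))).
have [h0|h0] := leP 0 h.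
- have H t : 0 <= t <= h -> `|t| <= `|h|.
    by move=> /andP[t0 th]; rewrite !ger0_norm.
  have [||c] := @MVT_segment R F dF 0 h h0.
  + by move=> t; rewrite in_itv/= => /andP[t0 th]; apply: D; rewrite H// !ltW.
  + exact: C.
  rewrite in_itv/= => cab; rewrite /F /dF scale0r addr0 subr0 => E.
  by exists c; [exact: H | rewrite E mulrC].
- have H t : h <= t <= 0 -> `|t| <= `|h|.
    by move=> /andP[t0 th]; rewrite !ler0_norm ?lerN2// ltW.
  have [||c] := @MVT_segment R F dF h 0 (ltW h0).
  + by move=> t; rewrite in_itv/= => /andP[t0 th]; apply: D; rewrite H// !ltW.
  + exact: C.
  rewrite in_itv/= => cab; rewrite /F /dF scale0r addr0 sub0r => E.
  by exists c; [exact: H | rewrite -opprB E mulrN opprK mulrC].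
Qed.

(** Stated through coordinate partial derivatives, as [smooth_on] is; the chain
    rule for an inner vector field then has to be derived from them. *)
Definition C1 U f := forall x, U x ->
  {for x, continuous f} /\
  forall i, derivable (f : X -> R^o) x (e_ i) /\ {for x, continuous (partial i f)}.

Lemma C1_cont U f x : C1 U f -> U x -> {for x, continuous f}.
Proof. by move=> h Ux; exact: (h x Ux).1. Qed.

Lemma C1_partial_cont U f i x : C1 U f -> U x -> {for x, continuous (partial i f)}.
Proof. by move=> h Ux; exact: ((h x Ux).2 i).2. Qed.

Lemma C1_is_derive U f i x : C1 U f -> U x ->
  is_derive x (e_ i) (f : X -> R^o) (partial i f x).
Proof. by move=> h Ux; apply/derivableP; exact: ((h x Ux).2 i).1. Qed.
Arguments C1_cont {U f x} _ _.
Arguments C1_partial_cont {U f} i {x} _ _.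
Arguments C1_is_derive {U f} i {x} _ _.

Lemma C1_subset U V f : V `<=` U -> C1 U f -> C1 V f.
Proof. by move=> VU h x Vx; exact: h (VU _ Vx). Qed.

Lemma smooth_C1 U f s : smooth_on U f -> C1 U (iter_partial s f).
Proof.
move=> h x Ux; have [c d] := h s x Ux; split => // i; split => //.
exact: (h (i :: s) x Ux).1.
Qed.

Lemma partialE f x i (d : R) : is_derive x (e_ i) (f : X -> R^o) d -> partial i f x = d.
Proof. by move=> h; rewrite /partial derive_val. Qed.

Lemma C1_intro U f (df : 'I_n -> X -> R) : open U -> cont_on U f ->
  (forall i x, U x -> is_derive x (e_ i) (f : X -> R^o) (df i x)) ->
  (forall i, cont_on U (df i)) -> C1 U f.
Proof.
move=> oU cf D cd x Ux; split; first exact: cf.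
move=> i; split; first exact: (@ex_derive _ _ _ _ _ _ _ (D i x Ux)).
have E : \forall y \near x, df i y = partial i f y.
  near=> y; apply/esym/partialE/D; near: y.
  by apply: open_nbhs_nbhs.
rewrite /continuous_at /prop_for /= in cd *.
rewrite -(nbhs_singleton E).
apply: cvg_trans (cd i x Ux); exact: (near_eq_cvg E).
Unshelve. all: by end_near. Qed.

Lemma C1_cst U c : open U -> C1 U (fun=> c).
Proof.
move=> oU; apply: (C1_intro (df := fun _ _ => 0)) => //.
- by move=> x _; exact: cst_continuous.
- by move=> i x _; exact: cst_continuous.
Qed.

Lemma C1D U f g : open U -> C1 U f -> C1 U g -> C1 U (fun x => f x + g x).
Proof.
move=> oU cf cg; apply: (C1_intro (df := fun i x => partial i f x + partial i g x)) => //.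
- by move=> x Ux; apply: continuousD;  [exact (C1_cont cf Ux)|exact: (C1_cont cg Ux)].
- by move=> i x Ux; apply: is_deriveD; [exact: (C1_is_derive _ cf Ux)|exact: (C1_is_derive _ cg Ux)].
- by move=> i x Ux; apply: continuousD; [exact: (C1_partial_cont _ cf Ux)|exact: (C1_partial_cont _ cg Ux)].
Qed.

Lemma is_derive_mul f g x i (a b : R) : is_derive x (e_ i) (f : X -> R^o) a ->
  is_derive x (e_ i) (g : X -> R^o) b ->
  is_derive x (e_ i) (fun y => f y * g y : R^o) (f x * b + g x * a).
Proof. by move=> df dg; exact: (is_deriveM df dg). Qed.

Lemma C1M U f g : open U -> C1 U f -> C1 U g -> C1 U (fun x => f x * g x).
Proof.
move=> oU cf cg; apply: (C1_intro (df := fun i x => f x * partial i g x + g x * partial i f x)) => //.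
- by move=> x Ux; apply: continuousM; [exact: (C1_cont cf Ux)|exact: (C1_cont cg Ux)].
- by move=> i x Ux; apply: is_derive_mul; [exact: (C1_is_derive _ cf Ux)|exact: (C1_is_derive _ cg Ux)].
- move=> i x Ux; apply: continuousD; apply: continuousM; [exact: (C1_cont cf Ux)|exact: (C1_partial_cont _ cg Ux)
  | exact: (C1_cont cg Ux)|exact: (C1_partial_cont _ cf Ux)].
Qed.

Lemma C1N U f : open U -> C1 U f -> C1 U (fun x => - f x).
Proof.
move=> oU cf; rewrite (_ : (fun x => - f x) = (fun x => (-1) * f x)); last first.
  by apply/funext => x; rewrite mulN1r.
by apply: (C1M oU _ cf); exact: C1_cst.
Qed.

Lemma C1_sum U (I : Type) (s : seq I) (F : I -> X -> R) : open U ->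
  (forall k, C1 U (F k)) -> C1 U (fun x => \sum_(k <- s) F k x).
Proof.
move=> oU cF; elim: s => [|k s IH].
  by under eq_fun do rewrite big_nil; exact: C1_cst.
under eq_fun do rewrite big_cons; exact: (C1D oU (cF k) IH).
Qed.

Lemma is_derive_sum_seq (I : Type) (s : seq I) (F : I -> X -> R) (d : I -> R) x i :
  (forall k, is_derive x (e_ i) (F k : X -> R^o) (d k)) ->
  is_derive x (e_ i) ((fun y => \sum_(k <- s) F k y) : X -> R^o) (\sum_(k <- s) d k).
Proof.
move=> cF; elim: s => [|k s IH].
  by under eq_fun do rewrite big_nil; rewrite big_nil; exact: is_derive_cst.
by under eq_fun do rewrite big_cons; rewrite big_cons; exact: is_deriveD.
Qed.

(** Reduced to one variable along the line x + s e_i. *)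
Lemma is_derive_comp1 (h : R -> R) f x i (a b : R) :
  is_derive (f x) (1 : R) (h : R -> R^o) b -> is_derive x (e_ i) (f : X -> R^o) a ->
  is_derive x (e_ i) (fun y => h (f y) : R^o) (b * a).
Proof.
move=> dh df.
have E y (g : X -> R) (d : R) : is_derive (0 : R) (1 : R) (fun s => g (y + s *: e_ i) : R^o) d ->
    is_derive y (e_ i) (g : X -> R^o) d.
  have E' : (fun s : R => s^-1 *: (((fun s => g (y + s *: e_ i) : R^o) \o shift 0) (s *: (1 : R)) - (g (y + 0 *: e_ i) : R^o)))
    = (fun s : R => s^-1 *: (((g : X -> R^o) \o shift y) (s *: e_ i) - g y)).
    apply/funext => s /=; congr (_ *: (g _ - g _)).
      by rewrite [s%:A]mulr1 addr0 addrC.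
    by rewrite scale0r addr0.
  by move=> [D V]; apply: DeriveDef; [rewrite /derivable -E'|rewrite /derive -E'].
apply: E.
have df0 : is_derive (0 : R) (1 : R) (fun s => f (x + s *: e_ i) : R^o) a.
  have [D <-] := df.
  by have := @is_derive_line R n f x (e_ i) 0; rewrite scale0r addr0 => /(_ D).
apply: (@is_derive1_comp R h (fun s => f (x + s *: e_ i)) 0 b a).
by rewrite scale0r addr0.
Qed.

Lemma C1_comp1 U (h h' : R -> R) f : open U ->
  (forall s, is_derive s (1 : R) (h : R -> R^o) (h' s)) -> continuous h' -> C1 U f ->
  C1 U (fun x => h (f x)).
Proof.
move=> oU dh ch' cf.
have ch : continuous h.
  move=> s; apply: differentiable_continuous; apply/derivable1_diffP.
  exact: (@ex_derive _ _ _ _ _ _ _ (dh s)).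
apply: (C1_intro (df := fun i x => h' (f x) * partial i f x)) => //.
- by move=> x Ux; apply: continuous_comp; [exact: (C1_cont cf Ux)|exact: ch].
- by move=> i x Ux; apply: is_derive_comp1 => //; exact: (C1_is_derive _ cf Ux).
- move=> i x Ux; apply: continuousM; last exact: (C1_partial_cont _ cf Ux).
  by apply: continuous_comp; [exact: (C1_cont cf Ux)|exact: ch'].
Qed.

End Calculus.
Arguments C1_cont {R n U f x} _ _.
Arguments C1_partial_cont {R n U f} i {x} _ _.
Arguments C1_is_derive {R n U f} i {x} _ _.

Section Chain.
Context (R : realType) (n : nat).
Local Notation X := 'rV[R]_n.
Local Notation e_ i := (delta_mx 0 i : X).
Implicit Types (f g : X -> R) (U : set X).

Lemma norm_e_le (c : R) i : `|c *: e_ i| <= `|c|.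
Proof.
rewrite normrZ ler_piMr// [leLHS]/Num.Def.normr/= mx_normrE.
apply: bigmax_le => // -[a b] _ /=; rewrite mxE; case: (_ && _) => /=; rewrite ?normr1 ?normr0 ?ler01//.
Qed.

(** Going from x to the target one coordinate at a time, the mean value theorem
    on each leg leaves only the oscillation of the partial derivatives. *)
Lemma taylor1 (G : X -> R) (x : X) (eps d m : R) (c : 'I_n -> R) (s : seq 'I_n) :
  (forall i y, derivable (G : X -> R^o) y (e_ i)) ->
  (forall i y, `|y - x| <= d -> `|partial i G y - partial i G x| <= eps) ->
  (forall i, `|c i| <= m) -> (size s)%:R * m <= d ->
  `|\sum_(i <- s) c i *: e_ i| <= (size s)%:R * m /\
  `|G (x + \sum_(i <- s) c i *: e_ i) - G x - \sum_(i <- s) c i * partial i G x|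
    <= (size s)%:R * m * eps.
Proof.
move=> dG H hc; elim: s => [|i s IH] /=.
  by move=> _; rewrite !big_nil addr0 !subrr normr0 !mul0r normr0.
rewrite !big_cons -natr1 mulrDl mul1r => hd.
have m0 : 0 <= m by apply: le_trans (hc i).
have /IH[I1 I2] : (size s)%:R * m <= d by rewrite (le_trans _ hd)// lerDl.
set p := (\sum_(j <- s) _) in I1 I2 *; set q := (\sum_(j <- s) _) in I2 *.
split.
  rewrite addrC (le_trans (ler_normD _ _))// lerD//.
  by rewrite (le_trans (norm_e_le _ _)).
have [t ht E] := @MVT_line R n G (x + p) (e_ i) (c i) (fun t _ => dG i _).
rewrite (addrC (c i *: _)) addrA.
have -> : G (x + p + c i *: e_ i) - G x - (c i * partial i G x + q) =
  c i * (partial i G (x + p + t *: e_ i) - partial i G x) + (G (x + p) - G x - q).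
  by move: E => /eqP; rewrite subr_eq => /eqP ->; rewrite /partial; ring.
rewrite (le_trans (ler_normD _ _))// addrC mulrDl lerD// normrM ler_pM//.
apply: H; rewrite addrC !addrA addNr add0r.
by rewrite (le_trans (ler_normD _ _))// (le_trans _ hd)// lerD// (le_trans (norm_e_le _ _))// (le_trans ht).
Qed.

Lemma row_sum_e (w : 'I_n -> R) : \row_j w j = \sum_i w i *: e_ i.
Proof. by rewrite [LHS]row_sum_delta; apply: eq_bigr => i _; rewrite mxE. Qed.

(** Continuity of the partial derivatives of G makes G differentiable, in the
    quantitative form of [taylor1], applied to the increments of the v_j. *)
Lemma is_derive_chain (G : X -> R) (v : 'I_n -> X -> R) x k (a : 'I_n -> R) :
  C1 setT G -> (forall j, is_derive x (e_ k) (v j : X -> R^o) (a j)) ->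
  is_derive x (e_ k) ((fun y => G (\row_j v j y)) : X -> R^o)
    (\sum_j a j * partial j G (\row_j v j x)).
Proof.
move=> cG dv.
set w0 := \row_j v j x; set D := \sum_j _.
pose quo (f : X -> R) (t : R) := t^-1 *: (f (t *: e_ k + x) - f x : R^o).
have qv j : quo (v j) t @[t --> 0^'] --> a j.
  have [dj <-] := dv j; rewrite /derivable in dj.
  exact: dj.
pose lin (t : R) := \sum_j quo (v j) t * partial j G w0.
have lin_cvg : lin t @[t --> 0^'] --> D.
  rewrite /lin /D; elim: (index_enum _) => [|j s IH].
    by under eq_fun do rewrite big_nil; rewrite big_nil; exact: cvg_cst.
  under eq_fun do rewrite big_cons; rewrite big_cons.
  by apply: cvgD => //; apply: cvgM; [exact: qv|exact: cvg_cst].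
have key : quo (fun y => G (\row_j v j y)) t @[t --> 0^'] --> D.
  pose K := 1 + \sum_j `|a j|.
  have K0 : 0 < K by rewrite ltr_pwDl// sumr_ge0.
  have aK j : `|a j| < K.
    by rewrite /K (bigD1 j)//= addrCA ltrDl ltr_pwDl// sumr_ge0.
  apply/cvgrPdist_le => /= e e0.
  pose eps := e / 2 / ((n%:R + 1) * K).
  have n1 : 0 < n%:R + 1 :> R by rewrite ltr_wpDl// ler0n.
  have eps0 : 0 < eps by rewrite !divr_gt0// mulr_gt0.
  have [d /= d0 Hd] : exists2 d : R, 0 < d & forall i y, `|y - w0| <= d ->
      `|partial i G y - partial i G w0| <= eps.
    have : \forall y \near w0, forall i, `|partial i G y - partial i G w0| <= eps.
      apply: (@filter_forall X 'I_n (fun i y => `|partial i G y - partial i G w0| <= eps) (nbhs w0)) => i.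
      have /cvgrPdist_le/(_ _ eps0) := C1_partial_cont i cG (I : [set: X] w0).
      by apply: filterS => y; rewrite distrC.
    move=> /nbhs_ballP[d /= d0 hd]; exists (d / 2); first by rewrite divr_gt0.
    move=> i y yd; apply: hd; rewrite -ball_normE /= distrC.
    by rewrite (le_lt_trans yd)// ltr_pdivrMr// ltr_pMr// ltr1n.
  have H1 : \forall t \near 0^', forall j, `|quo (v j) t| <= K.
    apply: filter_forall => j.
    have /cvgrPdist_lt/(_ (K - `|a j|)) := qv j.
    rewrite subr_gt0 => /(_ (aK j)); apply: filterS => t ht.
    rewrite -[quo _ _](subrK (a j)) (le_trans (ler_normD _ _))// -lerBrDr distrC ltW//.
  have H2 : \forall t \near 0^', `|D - lin t| <= e / 2.
    by have /cvgrPdist_le/(_ (e / 2)) := lin_cvg; apply; rewrite divr_gt0.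
  have dn : 0 < d / ((n%:R + 1) * K) by rewrite divr_gt0// mulr_gt0.
  near=> t.
  have t0 : t != 0 by near: t; exact: nbhs_dnbhs_neq.
  have td : `|t| < d / ((n%:R + 1) * K) by near: t; exact: dnbhs0_lt.
  have h1 : forall j, `|quo (v j) t| <= K by near: t.
  have h2 : `|D - lin t| <= e / 2 by near: t.
  pose c j := v j (t *: e_ k + x) - v j x.
  have cE j : c j = t * quo (v j) t by rewrite /quo /= mulrA mulfV// mul1r.
  have cm j : `|c j| <= `|t| * K by rewrite cE normrM ler_wpM2l.
  have [] := @taylor1 G w0 eps d (`|t| * K) c (index_enum 'I_n) (fun i y => ((cG y I).2 i).1) Hd cm.
    have -> : size (index_enum 'I_n) = n by rewrite /index_enum -enumT size_enum_ord.
    move: td; rewrite ltr_pdivlMr ?mulr_gt0// => td.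
    rewrite ltW// (le_lt_trans _ td)//.
    have := mulr_ge0 (normr_ge0 t) (ltW K0); lra.
  have -> : size (index_enum 'I_n) = n by rewrite /index_enum -enumT size_enum_ord.
  move=> _.
  rewrite -row_sum_e (_ : w0 + _ = \row_j v j (t *: e_ k + x)); last first.
    by apply/rowP => j; rewrite !mxE addrC subrK.
  have -> : \sum_i c i * partial i G w0 = t * lin t.
    rewrite /lin mulr_sumr; apply: eq_bigr => j _; rewrite (cE j). by rewrite -mulrA.
  move=> h3.
  have h4 : `|quo (fun y => G (\row_j v j y)) t - lin t| <= e / 2.
    rewrite -(ler_pM2l (_ : 0 < `|t|)) ?normr_gt0// -normrM mulrBr /quo /= mulrA mulfV// mul1r.
    apply: (le_trans h3).
    have epsE : eps * ((n%:R + 1) * K) = e / 2.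
      by rewrite /eps divfK// gt_eqF// mulr_gt0.
    rewrite -epsE.
    have := mulr_ge0 (mulr_ge0 (normr_ge0 t) (ltW K0)) (ltW eps0); lra.
  rewrite -(subrK (lin t) D) -addrA (le_trans (ler_normD _ _))// (splitr e) lerD// distrC//.
by apply: DeriveDef; [apply/cvg_ex; exists D; exact: key|exact/cvg_lim].
Unshelve. all: by end_near. Qed.

Lemma cont_row (v : 'I_n -> X -> R) x : (forall j, {for x, continuous (v j)}) ->
  {for x, continuous (fun y => \row_j v j y)}.
Proof.
move=> cv; rewrite /prop_for /continuous_at.
apply/(@cvgrPdist_le _ _ _ (nbhs x) (nbhs_filter x)) => e e0.
have : \forall y \near nbhs x, forall j, `|v j x - v j y| <= e.
  apply: (@filter_forall X 'I_n (fun j y => `|v j x - v j y| <= e) (nbhs x)) => j.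
  by have /cvgrPdist_le/(_ _ e0) := cv j.
apply: filterS => y H.
rewrite [leLHS]/Num.Def.normr/= mx_normrE.
by apply: bigmax_le => [|[a j] _ /=]; [exact: ltW|rewrite !mxE].
Qed.

Lemma cont_sum (I : Type) (s : seq I) (F : I -> X -> R) x :
  (forall j, {for x, continuous (F j)}) ->
  {for x, continuous (fun y => \sum_(j <- s) F j y)}.
Proof.
move=> cF; elim: s => [|j s IH].
  have -> : (fun y => \sum_(j <- [::]) F j y) = cst 0 by apply/funext => y; rewrite big_nil.
  exact: cst_continuous.
have -> : (fun y => \sum_(i <- j :: s) F i y) = (fun y => F j y + \sum_(i <- s) F i y).
  by apply/funext => y; rewrite big_cons.
exact: continuousD.
Qed.

Lemma C1_chain U (G : X -> R) (v : 'I_n -> X -> R) : open U -> C1 setT G ->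
  (forall j, C1 U (v j)) -> C1 U (fun x => G (\row_j v j x)).
Proof.
move=> oU cG cv.
have cr x : U x -> {for x, continuous (fun y => \row_j v j y)}.
  by move=> Ux; apply: cont_row => j; exact: (C1_cont (cv j) Ux).
apply: (C1_intro (df := fun k x => \sum_j partial k (v j) x * partial j G (\row_j v j x))) => //.
- by move=> x Ux; apply: (continuous_comp (cr x Ux)); exact: (C1_cont cG).
- by move=> k x Ux; apply: is_derive_chain => // j; exact: (C1_is_derive k (cv j) Ux).
- move=> k x Ux; apply: cont_sum => j; apply: continuousM; first exact: (C1_partial_cont k (cv j) Ux).
  by apply: (continuous_comp (cr x Ux)); exact: (C1_partial_cont j cG).
Qed.

Lemma partial_chain U (G : X -> R) (v : 'I_n -> X -> R) k x : C1 setT G ->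
  (forall j, C1 U (v j)) -> U x ->
  partial k (fun x => G (\row_j v j x)) x =
  \sum_j partial k (v j) x * partial j G (\row_j v j x).
Proof.
move=> cG cv Ux; apply: partialE; apply: is_derive_chain => // j.
exact: (C1_is_derive k (cv j) Ux).
Qed.

Lemma close2 (p q r s e : R) : r = s -> `|p - r| <= e / 2 -> `|q - s| <= e / 2 ->
  `|p - q| <= e.
Proof.
move=> -> H1 H2; apply: (le_trans (ler_distD s _ _)).
by rewrite [leRHS]splitr lerD// distrC.
Qed.

(** The mean value theorem twice: in direction e_i for the function
    f (y + h e_k) - f y, then in direction e_k for the i-th derivative. *)
Lemma second_difference U f x i k (h : R) : C1 U f -> C1 U (partial i f) -> 0 < h ->
  (forall y, `|y - x| <= h + h -> U y) ->
  exists2 y, `|y - x| <= h + h &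
    f (x + h *: e_ i + h *: e_ k) - f (x + h *: e_ i) - f (x + h *: e_ k) + f x
    = h * h * partial k (partial i f) y.
Proof.
move=> cf cdf h0 HU.
have hU s t : `|s| <= `|h| -> `|t| <= `|h| -> `|x + s *: e_ i + t *: e_ k - x| <= h + h.
  move=> sh th; rewrite addrAC [x + _ - x]addrAC subrr add0r.
  rewrite (le_trans (ler_normD _ _))// lerD// (le_trans (norm_e_le _ _))//.
    by rewrite (le_trans sh)// ger0_norm// ltW.
  by rewrite (le_trans th)// ger0_norm// ltW.
have z : `|0 : R| <= `|h| by rewrite normr0.
have hh : `|h| <= `|h| by [].
pose g y := f (y + h *: e_ k) - f y.
have dgl t : `|t| <= `|h| -> is_derive (x + t *: e_ i) (e_ i) (g : X -> R^o)
    (partial i f (x + t *: e_ i + h *: e_ k) - partial i f (x + t *: e_ i)).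
  move=> th; apply: is_deriveB.
    have U1 : U (x + t *: e_ i + h *: e_ k) by apply: HU; exact: hU.
    have [D V] := C1_is_derive i cf U1.
    have E : (fun s : R => s^-1 *: ((((fun y => f (y + h *: e_ k)) : X -> R^o) \o shift (x + t *: e_ i)) (s *: e_ i) - (f (x + t *: e_ i + h *: e_ k) : R^o)))
      = (fun s : R => s^-1 *: (((f : X -> R^o) \o shift (x + t *: e_ i + h *: e_ k)) (s *: e_ i) - f (x + t *: e_ i + h *: e_ k))).
      by apply/funext => s /=; rewrite !addrA.
    by apply: DeriveDef; [rewrite /derivable E|rewrite /derive E].
  apply: (C1_is_derive i cf); apply: HU.
  by have := hU t 0 th z; rewrite scale0r addr0.
have [t th E1] := @MVT_line R n g x (e_ i) h (fun t th => @ex_derive _ _ _ _ _ _ _ (dgl t th)).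
have [s sh E2] := @MVT_line R n (partial i f) (x + t *: e_ i) (e_ k) h
  (fun s sh => @ex_derive _ _ _ _ _ _ _ (C1_is_derive k cdf (HU _ (hU t s th sh)))).
exists (x + t *: e_ i + s *: e_ k); first exact: hU.
move: E1; rewrite (@derive_val _ _ _ _ _ _ _ (dgl t th)) E2 /g /partial => E1.
by rewrite -mulrA -E1; ring.
Qed.

(** The second difference is symmetric in i and k; by [second_difference] it is,
    up to the factor h^2, a value of each mixed derivative near x. *)
Lemma schwarz U f x i k : open U -> C1 U f -> C1 U (partial i f) -> C1 U (partial k f) -> U x ->
  partial k (partial i f) x = partial i (partial k f) x.
Proof.
move=> oU cf ci ck Ux; apply/eqP; rewrite -subr_eq0 -normr_le0.
apply/ler_addgt0Pl => e e0; rewrite addr0.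
have e2 : 0 < e / 2 by rewrite divr_gt0.
pose A := [set y | `|partial k (partial i f) x - partial k (partial i f) y| <= e / 2].
pose B := [set y | `|partial i (partial k f) x - partial i (partial k f) y| <= e / 2].
have nA : nbhs x A.
  by have /(@cvgrPdist_le _ _ _ (nbhs x) (nbhs_filter x))/(_ _ e2) := C1_partial_cont k ci Ux.
have nB : nbhs x B.
  by have /(@cvgrPdist_le _ _ _ (nbhs x) (nbhs_filter x))/(_ _ e2) := C1_partial_cont i ck Ux.
have /nbhs_ballP[d /= d0 Hd] : nbhs x (U `&` (A `&` B)).
  by apply: filterI; [exact: open_nbhs_nbhs|exact: filterI].
pose h := d / 4.
have h0 : 0 < h by rewrite divr_gt0.
have hd y : `|y - x| <= h + h -> ball x d y.
  rewrite -ball_normE /= distrC => H; apply: (le_lt_trans H); rewrite /h; lra.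
have HU y : `|y - x| <= h + h -> U y by move=> /hd/Hd[].
have [y yh Ey] := second_difference k cf ci h0 HU.
have [z zh Ez] := second_difference i cf ck h0 HU.
have E : partial k (partial i f) y = partial i (partial k f) z.
  apply: (@mulfI _ (h * h)); first by rewrite mulf_neq0// gt_eqF.
  apply: (etrans (esym Ey)); apply: (etrans _ Ez).
  have aux (p q b c : R) : p = q -> p - b - c + f x = q - c - b + f x by move=> ->; ring.
  exact: aux (congr1 f (addrAC _ _ _)).
have [_ [Ay _]] := Hd _ (hd _ yh); have [_ [_ Bz]] := Hd _ (hd _ zh).
exact: close2 E Ay Bz.
Qed.

End Chain.

(** * Truncated powers of one real variable *)

Section Truncation.
Context (R : realType).
Implicit Types (s k al : R).

Definition pos_part s : R := Num.max 0 s.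

Lemma pos_part_ge0 s : 0 <= pos_part s. Proof. by rewrite /pos_part le_max lexx. Qed.
Lemma pos_part_le0 s : s <= 0 -> pos_part s = 0. Proof. by move=> s0; rewrite /pos_part max_l. Qed.
Lemma pos_part_id s : 0 <= s -> pos_part s = s. Proof. by move=> s0; rewrite /pos_part max_r. Qed.

Lemma near_lt0 s : s < 0 -> \forall y \near s, y < 0.
Proof. exact: lt_nbhsl. Qed.

(** Squaring already removes the corner: at 0 the difference quotient is bounded
    by |h|. The higher powers are obtained from this one by products, and all
    truncations below are C^1, so that classical calculus suffices. *)
Lemma is_derive_pos_part2 s : is_derive s (1 : R) ((fun s => pos_part s ^+ 2) : R -> R^o) (2 * pos_part s).
Proof.
have [s0|s0|->] := ltrgtP s 0.
- rewrite (pos_part_le0 (ltW s0)) mulr0.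
  have N : \forall y \near s, (cst 0 : R -> R^o) y = pos_part y ^+ 2.
    near=> y; rewrite /= pos_part_le0 ?expr0n//; apply: ltW; near: y; exact: near_lt0.
  exact: (near_eq_is_derive N (is_derive_cst _ _ _)).
- rewrite (pos_part_id (ltW s0)).
  have N : \forall y \near s, ((fun y => y ^+ 2) : R -> R^o) y = pos_part y ^+ 2.
    near=> y; rewrite /= pos_part_id//; apply: ltW; near: y; exact: lt_nbhsr.
  apply: (near_eq_is_derive N).
  by have := @is_deriveX R R id 2 s 1 1 (is_derive_id _ _); rewrite /= expr1 [_ *: _]mulr1.
- rewrite pos_part_le0// mulr0.
  have H : (h^-1 *: ((((fun s => pos_part s ^+ 2) : R -> R^o) \o shift (0 : R)) (h *: (1 : R)) - (pos_part 0 ^+ 2 : R^o))) @[h --> 0^'] --> (0 : R^o).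
    apply/cvgrPdist_le => /= e e0.
    near=> h.
    have h0 : h != 0 by near: h; exact: nbhs_dnbhs_neq.
    rewrite sub0r normrN (pos_part_le0 (lexx 0)) expr0n/= subr0 addr0 [h%:A]mulr1.
    rewrite [_ *: _]mulrC normrM normfV ler_pdivrMr ?normr_gt0// normrX.
    have ph : `|pos_part h| <= `|h|.
      rewrite ger0_norm ?pos_part_ge0// /pos_part; have [hh|hh] := leP 0 h; first by rewrite ger0_norm.
      exact: normr_ge0.
    rewrite (@le_trans _ _ (`|h| * `|h|))//; first by rewrite expr2 ler_pM.
    rewrite ler_wpM2r// ltW//; near: h; exact: dnbhs0_lt.
  by apply: DeriveDef; [apply/cvg_ex; exists 0; exact: H|exact/cvg_lim].
Unshelve. all: by end_near. Qed.

Lemma is_derive1_mul (f g : R -> R) s (a b : R) : is_derive s (1 : R) (f : R -> R^o) a ->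
  is_derive s (1 : R) (g : R -> R^o) b ->
  is_derive s (1 : R) (fun y => f y * g y : R^o) (f s * b + g s * a).
Proof. by move=> df dg; exact: (is_deriveM df dg). Qed.

Lemma pos_part2M s : pos_part s ^+ 2 * s = pos_part s ^+ 3.
Proof.
have [s0|s0] := leP s 0; first by rewrite pos_part_le0// !expr0n /= mul0r.
by rewrite (pos_part_id (ltW s0)) -exprSr.
Qed.

Lemma is_derive_pos_part3 s : is_derive s (1 : R) ((fun s => pos_part s ^+ 3) : R -> R^o) (3 * pos_part s ^+ 2).
Proof.
have := is_derive1_mul (is_derive_pos_part2 s) (is_derive_id s 1).
rewrite (_ : (fun y => _) = (fun s => pos_part s ^+ 3) :> (R -> R^o)); last first.
  by apply/funext => y; exact: pos_part2M.
move=> D; apply: (is_derive_eq D).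
have [s0|s0] := leP s 0; first by rewrite pos_part_le0// !expr0n /=; ring.
by rewrite (pos_part_id (ltW s0)); ring.
Qed.

Lemma is_derive_pos_part4 s : is_derive s (1 : R) ((fun s => pos_part s ^+ 4) : R -> R^o) (4 * pos_part s ^+ 3).
Proof.
have := is_derive1_mul (is_derive_pos_part2 s) (is_derive_pos_part2 s).
rewrite (_ : (fun y => _) = (fun s => pos_part s ^+ 4) :> (R -> R^o)); last first.
  by apply/funext => y; ring.
move=> D; apply: (is_derive_eq D); ring.
Qed.

Lemma is_derive1_cont (f : R -> R) s (a : R) : is_derive s (1 : R) (f : R -> R^o) a ->
  {for s, continuous f}.
Proof.
move=> D; apply: differentiable_continuous; apply/derivable1_diffP.
exact: (@ex_derive _ _ _ _ _ _ _ D).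
Qed.

Lemma continuous_pos_part : continuous pos_part.
Proof.
move=> s; apply: (@continuous_max _ _ (cst 0) id); [exact: cst_continuous|exact: cvg_id].
Qed.

(** A factor that vanishes below a positive level k hides the singularity of
    s^al at the origin. *)
Lemma is_derive_cutpow (g g' : R -> R) k al s : 0 < k ->
  (forall s, is_derive s (1 : R) (g : R -> R^o) (g' s)) ->
  (forall s, s <= k -> g s = 0) -> (forall s, s <= k -> g' s = 0) ->
  is_derive s (1 : R) ((fun s => g s * s `^ al) : R -> R^o)
    (g' s * s `^ al + al * (g s * s `^ (al - 1))).
Proof.
move=> k0 dg gk g'k; have [sk|sk] := ltP s k.
- rewrite gk ?g'k ?ltW// !mul0r mulr0 addr0.
  have N : \forall y \near s, (cst 0 : R -> R^o) y = g y * y `^ al.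
    near=> y; rewrite /= gk ?mul0r// ltW//; near: y; exact: lt_nbhsl.
  exact: (near_eq_is_derive N (is_derive_cst _ _ _)).
- have s0 : 0 < s by exact: lt_le_trans sk.
  have D := is_derive1_mul (dg s) (is_derive1_powR al s0).
  by apply: (is_derive_eq D); ring.
Unshelve. all: by end_near. Qed.

Lemma continuous_cutpow (g : R -> R) k al : 0 < k -> continuous g ->
  (forall s, s <= k -> g s = 0) -> continuous (fun s => g s * s `^ al).
Proof.
move=> k0 cg gk s; have [sk|sk] := ltP s k.
- have N : \forall y \near s, 0 = g y * y `^ al.
    near=> y; rewrite /= gk ?mul0r// ltW//; near: y; exact: lt_nbhsl.
  rewrite /continuous_at gk ?mul0r ?ltW//.
  apply: (cvg_trans (near_eq_cvg N)); exact: cvg_cst.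
- have s0 : 0 < s by exact: lt_le_trans sk.
  apply: (@continuousM R R g (fun s => s `^ al)); first exact: cg.
  exact: is_derive1_cont (is_derive1_powR al s0).
Unshelve. all: by end_near. Qed.

Lemma is_derive_shift1 (g : R -> R) (g' : R) k s :
  is_derive (s - k) (1 : R) (g : R -> R^o) g' ->
  is_derive s (1 : R) ((fun s => g (s - k)) : R -> R^o) g'.
Proof.
move=> D.
have := @is_derive1_comp R g (fun s => s - k) s _ 1 D _; rewrite mulr1; apply.
by have := is_deriveD (is_derive_id s (1 : R)) (is_derive_cst (- k) s (1 : R)); rewrite addr0.
Qed.

Lemma continuous_addf (f g : R -> R) : continuous f -> continuous g ->
  continuous (fun s => f s + g s).
Proof. by move=> cf cg s; apply: cvgD; [exact: cf|exact: cg]. Qed.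

Lemma continuous_scalef (f : R -> R) (c : R) : continuous f ->
  continuous (fun s => c * f s).
Proof. by move=> cf s; apply: cvgM; [exact: cvg_cst|exact: cf]. Qed.

(** With tau = (1 - k/s)_+, [trunc3 k (-3 - b)] is s^-b tau^3, the weight of the
    test functions, and [trunc4 k (g - 4)] is s^g tau^4, the quantity that the
    iteration controls. *)
Definition trunc3 k al s : R := pos_part (s - k) ^+ 3 * s `^ al.
Definition dtrunc3 k al s : R :=
  3 * pos_part (s - k) ^+ 2 * s `^ al + al * (pos_part (s - k) ^+ 3 * s `^ (al - 1)).
Definition trunc4 k al s : R := pos_part (s - k) ^+ 4 * s `^ al.
Definition dtrunc4 k al s : R :=
  4 * pos_part (s - k) ^+ 3 * s `^ al + al * (pos_part (s - k) ^+ 4 * s `^ (al - 1)).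

Let posk m k s : s <= k -> pos_part (s - k) ^+ m.+1 = 0.
Proof. by move=> sk; rewrite pos_part_le0 ?subr_le0// expr0n. Qed.

Let cposk m k : continuous (fun s => pos_part (s - k) ^+ m).
Proof.
move=> s; apply: (@continuous_comp _ _ _ (fun s => pos_part (s - k)) (fun y => y ^+ m)); last exact: exprn_continuous.
apply: (@continuous_comp _ _ _ (fun s => s - k) pos_part); last exact: continuous_pos_part.
by apply: continuousB; [exact: cvg_id|exact: cst_continuous].
Qed.

Lemma trunc4_ge0 k al s : 0 <= trunc4 k al s.
Proof. by rewrite mulr_ge0 ?powR_ge0// exprn_ge0// pos_part_ge0. Qed.

Lemma is_derive_trunc3 k al s : 0 < k ->
  is_derive s (1 : R) (trunc3 k al : R -> R^o) (dtrunc3 k al s).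
Proof.
move=> k0; apply: (@is_derive_cutpow (fun s => pos_part (s - k) ^+ 3) (fun s => 3 * pos_part (s - k) ^+ 2) k) => //.
- by move=> y; exact: (@is_derive_shift1 (fun s => pos_part s ^+ 3) _ k y (is_derive_pos_part3 _)).
- by move=> y; exact: posk.
- by move=> y yk; rewrite posk// mulr0.
Qed.

Lemma is_derive_trunc4 k al s : 0 < k ->
  is_derive s (1 : R) (trunc4 k al : R -> R^o) (dtrunc4 k al s).
Proof.
move=> k0; apply: (@is_derive_cutpow (fun s => pos_part (s - k) ^+ 4) (fun s => 4 * pos_part (s - k) ^+ 3) k) => //.
- by move=> y; exact: (@is_derive_shift1 (fun s => pos_part s ^+ 4) _ k y (is_derive_pos_part4 _)).
- by move=> y; exact: posk.
- by move=> y yk; rewrite posk// mulr0.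
Qed.

Lemma continuous_dtrunc3 k al : 0 < k -> continuous (dtrunc3 k al).
Proof.
move=> k0; apply: continuous_addf.
  apply: (@continuous_cutpow (fun s => 3 * pos_part (s - k) ^+ 2) k) => //.
    exact/continuous_scalef/cposk.
  by move=> y yk; rewrite posk// mulr0.
apply: continuous_scalef.
apply: (@continuous_cutpow (fun s => pos_part (s - k) ^+ 3) k) => //.
by move=> y; exact: posk.
Qed.

Lemma continuous_dtrunc4 k al : 0 < k -> continuous (dtrunc4 k al).
Proof.
move=> k0; apply: continuous_addf.
  apply: (@continuous_cutpow (fun s => 4 * pos_part (s - k) ^+ 3) k) => //.
    exact/continuous_scalef/cposk.
  by move=> y yk; rewrite posk// mulr0.
apply: continuous_scalef.
apply: (@continuous_cutpow (fun s => pos_part (s - k) ^+ 4) k) => //.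
by move=> y; exact: posk.
Qed.

Definition tau k s : R := pos_part (s - k) / s.

Lemma tau_ge0 k s : 0 <= s -> 0 <= tau k s.
Proof. by move=> s0; rewrite divr_ge0// pos_part_ge0. Qed.

Lemma tau_le1 k s : 0 <= k -> 0 < s -> tau k s <= 1.
Proof.
move=> k0 s0; rewrite ler_pdivrMr// mul1r /pos_part; have [_|_] := leP 0 (s - k).
  by rewrite gerBl.
exact: ltW.
Qed.

Lemma trunc3E k b s : 0 < s -> trunc3 k (- 3 - b) s = s `^ (- b) * tau k s ^+ 3.
Proof.
move=> s0; have sn0 : s != 0 by rewrite gt_eqF.
rewrite /trunc3 /tau powRD ?sn0 ?implybT// (powR_invn 3) ?ltW// expr_div_n; ring.
Qed.

Lemma dtrunc3E k b s : 0 < s ->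
  dtrunc3 k (- 3 - b) s = s `^ (- b) / s * (3 * tau k s ^+ 2 * (1 - tau k s) - b * tau k s ^+ 3).
Proof.
move=> s0; rewrite /dtrunc3 /tau.
have sn0 : s != 0 by rewrite gt_eqF.
have -> : s `^ (-3 - b) = s `^ (- b) / s ^+ 3.
  by rewrite addrC powRD ?sn0 ?implybT// (powR_invn 3) ?ltW.
have -> : s `^ (-3 - b - 1) = s `^ (- b) / s ^+ 4.
  rewrite (_ : -3 - b - 1 = - b + - 4%:R); last by ring.
  by rewrite powRD ?sn0 ?implybT// (powR_invn 4) ?ltW.
by field.
Qed.

Lemma trunc4E k g s : 0 < s -> trunc4 k (g - 4) s = s `^ g * tau k s ^+ 4.
Proof.
move=> s0; have sn0 : s != 0 by rewrite gt_eqF.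
rewrite /trunc4 /tau powRD ?sn0 ?implybT// (powR_invn 4) ?ltW// expr_div_n; ring.
Qed.

Lemma dtrunc4E k g s : 0 < s ->
  dtrunc4 k (g - 4) s = s `^ g / s * (4 * tau k s ^+ 3 * (1 - tau k s) + g * tau k s ^+ 4).
Proof.
move=> s0; rewrite /dtrunc4 /tau.
have sn0 : s != 0 by rewrite gt_eqF.
have -> : s `^ (g - 4) = s `^ g / s ^+ 4.
  by rewrite powRD ?sn0 ?implybT// (powR_invn 4) ?ltW.
have -> : s `^ (g - 4 - 1) = s `^ g / s ^+ 5.
  rewrite (_ : g - 4 - 1 = g + - 5%:R); last by ring.
  by rewrite powRD ?sn0 ?implybT// (powR_invn 5) ?ltW.
by field.
Qed.

End Truncation.

(** * The pointwise ellipticity inequality *)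

Section Scalar.
Context (R : realFieldType).

Lemma young (k a b : R) : 0 < k -> a * b <= k * a ^+ 2 + b ^+ 2 / (4 * k).
Proof.
move=> k0; rewrite -subr_ge0.
have -> : k * a ^+ 2 + b ^+ 2 / (4 * k) - a * b = (2 * k * a - b) ^+ 2 / (4 * k).
  by field; rewrite gt_eqF.
by rewrite divr_ge0 ?sqr_ge0// mulr_ge0// ltW.
Qed.

(** The numerical core of [elliptic_pointwise], where t is the sum of the form A
    over the rows of the Hessian of u, h the Frobenius norm of that Hessian, sg
    and d the lengths of Ds and of e, A0 and B the form A at (Ds, Ds) and (Ds, e),
    and T1, T2, T3 the trace of the Hessian and the products of z with Ds and e.
    Since A0 <= 4 s t, the negative part - b tau^3 of P' costs at most the
    fraction 2 b of the good term P t, which explains c0; all other terms are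
    absorbed by Young's inequality. *)
Lemma elliptic_scalar_bound (N b c1 c2 eta tau w m s r h sg d f t A0 B T1 T2 T3 : R) :
  0 <= b -> b * 2 < 1 -> 0 < c1 -> 0 <= N ->
  0 <= eta -> 0 <= tau <= 1 -> 0 <= w -> 0 < m -> 0 < r -> s = r ^+ 2 ->
  0 <= h -> 0 <= sg -> 0 <= d -> 0 <= c2 ->
  c1 * m * h ^+ 2 <= t -> c1 * m * sg ^+ 2 <= A0 -> A0 <= 4 * s * t ->
  `|B| <= c2 * m * sg * d -> sg <= 2 * r * h ->
  `|T1| <= N * h -> `|T2| <= r * sg -> `|T3| <= r * d ->
  forall c0 P P', c0 = (1 - 2 * b) * c1 -> P = w * tau ^+ 3 ->
  P' = w / s * (3 * tau ^+ 2 * (1 - tau) - b * tau ^+ 3) ->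
  w * m * eta ^+ 2 * s^-1 * tau ^+ 2 * sg ^+ 2 <=
  8 / c0 * (f * (2 * eta * P * T3 + eta ^+ 2 * P * T1 + eta ^+ 2 * P' * T2)
    + eta * P * B + eta ^+ 2 * P * t + eta ^+ 2 * P' * A0 / 2)
  + 8 / c0 * (4 * c2 ^+ 2 / c0 + 2 * N ^+ 2 / c0 + 2 / c0 + 3 / c1 + 2)
    * (w * m * s * d ^+ 2 + w / m * f ^+ 2 * eta ^+ 2).
Proof.
move=> b0 b1 c10 N0 e0 /andP[t0 t1] w0 m0 r0 sE.
move=> h0 sg0 d0 c20 Ht HA0 HA1 HB Hsg H1 H2 H3.
move=> c0 P P' c0E PE P'E.
have c00 : 0 < c0 by rewrite c0E mulr_gt0//; lra.
have s0 : 0 < s by rewrite sE exprn_gt0.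
pose y := sg / r.
have y0 : 0 <= y by rewrite /y divr_ge0// ltW.
have sgE : sg = y * r by rewrite /y divfK// gt_eqF.
have yh : y <= 2 * h by rewrite /y ler_pdivrMr// mulrAC.
pose x := 1 - tau.
have x0 : 0 <= x by rewrite /x subr_ge0.
pose a := `|f|.
have a0 : 0 <= a by exact: normr_ge0.
have aE : a ^+ 2 = f ^+ 2 by rewrite /a real_normK// num_real.
have i1 : s^-1 = r^-1 ^+ 2 by rewrite sE exprVn.
have rr : r * r^-1 = 1 by rewrite mulfV// gt_eqF.
have T2b : `|T2| / s <= y.
  rewrite ler_pdivrMr// (le_trans H2)// sgE sE; by rewrite le_eqVlt; apply/orP; left; apply/eqP; ring.
have fm0 : 0 <= f ^+ 2 / m by rewrite divr_ge0 ?sqr_ge0// ltW.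
have I1 : eta ^+ 2 * tau ^+ 3 * c0 * m * h ^+ 2 + 3 / 2 * eta ^+ 2 * tau ^+ 2 * x * c1 * m * y ^+ 2
   <= eta ^+ 2 * tau ^+ 3 * t + eta ^+ 2 / s * (3 * tau ^+ 2 * x - b * tau ^+ 3) * A0 / 2.
  have A1 : A0 / s <= 4 * t by rewrite ler_pdivrMr// mulrAC.
  have A2 : c1 * m * y ^+ 2 <= A0 / s.
    rewrite ler_pdivlMr//.
    have -> : c1 * m * y ^+ 2 * s = c1 * m * sg ^+ 2 by rewrite sgE sE; ring.
    exact: HA0.
  set z := A0 / s in A1 A2.
  have -> : eta ^+ 2 / s * (3 * tau ^+ 2 * x - b * tau ^+ 3) * A0 / 2 =
    3 / 2 * eta ^+ 2 * tau ^+ 2 * x * z - eta ^+ 2 * tau ^+ 3 * b * z / 2 by rewrite /z; ring.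
  have B1 : 3 / 2 * eta ^+ 2 * tau ^+ 2 * x * (c1 * m * y ^+ 2) <= 3 / 2 * eta ^+ 2 * tau ^+ 2 * x * z.
    by rewrite ler_wpM2l// !mulr_ge0// ?sqr_ge0// divr_ge0.
  have B2 : eta ^+ 2 * tau ^+ 3 * b * z / 2 <= eta ^+ 2 * tau ^+ 3 * (2 * b * t).
    have -> : eta ^+ 2 * tau ^+ 3 * b * z / 2 = eta ^+ 2 * tau ^+ 3 * b / 2 * z by ring.
    have -> : eta ^+ 2 * tau ^+ 3 * (2 * b * t) = eta ^+ 2 * tau ^+ 3 * b / 2 * (4 * t) by field.
    by rewrite ler_wpM2l// !mulr_ge0// ?sqr_ge0// exprn_ge0.
  have B3 : eta ^+ 2 * tau ^+ 3 * ((1 - 2 * b) * (c1 * m * h ^+ 2)) <= eta ^+ 2 * tau ^+ 3 * ((1 - 2 * b) * t).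
    by rewrite ler_wpM2l ?mulr_ge0// ?sqr_ge0 ?exprn_ge0// ler_wpM2l// subr_ge0 mulrC ltW.
  rewrite c0E; lra.
have I2 : eta * tau ^+ 3 * `|B| <= tau ^+ 3 * m * (c0 / 4 * eta ^+ 2 * h ^+ 2 + 4 * c2 ^+ 2 / c0 * s * d ^+ 2).
  have B1 : `|B| <= m * (h * (2 * c2 * r * d)).
    rewrite (le_trans HB)//.
    have -> : m * (h * (2 * c2 * r * d)) = c2 * m * (2 * r * h) * d by ring.
    by rewrite ler_wpM2r// ler_wpM2l// mulr_ge0// ltW.
  have := @young (c0 / 4) (eta * h) (2 * c2 * r * d) (divr_gt0 c00 (ltr0n R 4)).
  have -> : (2 * c2 * r * d) ^+ 2 / (4 * (c0 / 4)) = 4 * c2 ^+ 2 / c0 * s * d ^+ 2.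
    by rewrite sE; field; rewrite gt_eqF.
  rewrite exprMn => Y.
  have -> : eta * tau ^+ 3 * `|B| = tau ^+ 3 * (eta * `|B|) by ring.
  rewrite -[leRHS]mulrA ler_wpM2l ?exprn_ge0//.
  apply: (le_trans (ler_wpM2l e0 B1)).
  have -> : eta * (m * (h * (2 * c2 * r * d))) = m * (eta * h * (2 * c2 * r * d)) by ring.
  have -> : c0 / 4 * eta ^+ 2 * h ^+ 2 = c0 / 4 * (eta ^+ 2 * h ^+ 2) by ring.
  by rewrite ler_wpM2l// ltW.
have Yf k c : 0 <= c -> 0 < k -> a * c * h <= k * m * h ^+ 2 + c ^+ 2 / (4 * k) * (f ^+ 2 / m).
  move=> cc k0; have := @young (k * m) h (a * c) (mulr_gt0 k0 m0).
  rewrite exprMn aE => Y; rewrite mulrC (le_trans Y)// lerD2l le_eqVlt; apply/orP; left; apply/eqP.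
  by field; rewrite !gt_eqF.
have I3 : a * eta ^+ 2 * tau ^+ 3 * `|T1| <= tau ^+ 3 * eta ^+ 2 * (c0 / 8 * m * h ^+ 2 + 2 * N ^+ 2 / c0 * (f ^+ 2 / m)).
  have := Yf (c0 / 8) N N0 (divr_gt0 c00 (ltr0n R 8)).
  have -> : N ^+ 2 / (4 * (c0 / 8)) = 2 * N ^+ 2 / c0 by field; rewrite gt_eqF.
  move=> Y.
  have -> : a * eta ^+ 2 * tau ^+ 3 * `|T1| = tau ^+ 3 * eta ^+ 2 * (a * `|T1|) by ring.
  rewrite ler_wpM2l ?mulr_ge0 ?sqr_ge0 ?exprn_ge0//.
  by rewrite (le_trans _ Y)// -mulrA ler_wpM2l.
have I4 : a * eta ^+ 2 * b * tau ^+ 3 * (`|T2| / s) <= tau ^+ 3 * eta ^+ 2 * (c0 / 8 * m * h ^+ 2 + 2 / c0 * (f ^+ 2 / m)).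
  have := Yf (c0 / 8) 1 ler01 (divr_gt0 c00 (ltr0n R 8)).
  have -> : 1 ^+ 2 / (4 * (c0 / 8)) = 2 / c0 by field; rewrite gt_eqF.
  move=> Y.
  have -> : a * eta ^+ 2 * b * tau ^+ 3 * (`|T2| / s) = tau ^+ 3 * eta ^+ 2 * (a * (b * (`|T2| / s))) by ring.
  rewrite ler_wpM2l ?mulr_ge0 ?sqr_ge0 ?exprn_ge0//.
  rewrite (le_trans _ Y)// mulr1 ler_wpM2l//.
  apply: (@le_trans _ _ (b * (2 * h))); first by rewrite ler_wpM2l// (le_trans T2b).
  have := ler_wpM2r h0 (ltW b1); lra.
have I5 : a * eta ^+ 2 * 3 * tau ^+ 2 * x * (`|T2| / s) <= 3 * eta ^+ 2 * tau ^+ 2 * x * (c1 / 4 * m * y ^+ 2 + 1 / c1 * (f ^+ 2 / m)).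
  have -> : a * eta ^+ 2 * 3 * tau ^+ 2 * x * (`|T2| / s) = 3 * eta ^+ 2 * tau ^+ 2 * x * (a * (`|T2| / s)) by ring.
  rewrite ler_wpM2l ?mulr_ge0 ?sqr_ge0 ?exprn_ge0//.
  apply: (le_trans (ler_wpM2l a0 T2b)).
  have := @young (c1 / 4 * m) y a (mulr_gt0 (divr_gt0 c10 (ltr0n R 4)) m0).
  rewrite aE mulrC => Y; rewrite (le_trans Y)// lerD2l le_eqVlt; apply/orP; left; apply/eqP.
  by field; rewrite !gt_eqF.
have I6 : 2 * a * eta * tau ^+ 3 * `|T3| <= tau ^+ 3 * (f ^+ 2 / m * eta ^+ 2 + m * s * d ^+ 2).
  have -> : 2 * a * eta * tau ^+ 3 * `|T3| = tau ^+ 3 * (2 * a * eta * `|T3|) by ring.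
  rewrite ler_wpM2l ?exprn_ge0//.
  apply: (@le_trans _ _ (2 * a * eta * (r * d))); first by rewrite ler_wpM2l// !mulr_ge0.
  have := @young m (r * d) (2 * a * eta) m0.
  rewrite exprMn -sE => Y; rewrite mulrC (le_trans Y)// addrC mulrA lerD2r.
  rewrite !exprMn aE le_eqVlt; apply/orP; left; apply/eqP.
  by field; rewrite !gt_eqF.
pose K := 4 * c2 ^+ 2 / c0 + 2 * N ^+ 2 / c0 + 2 / c0 + 3 / c1 + 2.
pose q := f * (2 * eta * tau ^+ 3 * T3 + eta ^+ 2 * tau ^+ 3 * T1 +
     eta ^+ 2 / s * (3 * tau ^+ 2 * x - b * tau ^+ 3) * T2) + eta * tau ^+ 3 * B
   + eta ^+ 2 * tau ^+ 3 * t + eta ^+ 2 / s * (3 * tau ^+ 2 * x - b * tau ^+ 3) * A0 / 2.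
have key : c0 / 8 * (m * eta ^+ 2 * y ^+ 2 * tau ^+ 2) <= q + K * (m * s * d ^+ 2 + f ^+ 2 / m * eta ^+ 2).
  have lowb X T : 0 <= X -> - (X * (a * `|T|)) <= X * (f * T).
    move=> X0; by rewrite -mulrN ler_wpM2l// /a -normrM lerNl (le_trans (ler_norm _))// normrN.
  have e20 : 0 <= eta ^+ 2 by exact: sqr_ge0.
  have t30 : 0 <= tau ^+ 3 by exact: exprn_ge0.
  have t2x : 0 <= tau ^+ 2 * x by rewrite mulr_ge0// sqr_ge0.
  have t31 : tau ^+ 3 <= 1 by rewrite exprn_ile1.
  have x1 : x <= 1 by rewrite /x gerBl.
  have t2x1 : tau ^+ 2 * x <= 1 by rewrite mulr_ile1// ?sqr_ge0// exprn_ile1.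
  have L1 := lowb (2 * eta * tau ^+ 3) T3 (mulr_ge0 (mulr_ge0 (ler0n R 2) e0) t30).
  have L2 := lowb (eta ^+ 2 * tau ^+ 3) T1 (mulr_ge0 e20 t30).
  have L3 := lowb (eta ^+ 2 * (3 * (tau ^+ 2 * x)) / s) T2 (divr_ge0 (mulr_ge0 e20 (mulr_ge0 (ler0n R 3) t2x)) (ltW s0)).
  have L4 : eta ^+ 2 * (b * tau ^+ 3) / s * (f * T2) <= eta ^+ 2 * (b * tau ^+ 3) / s * (a * `|T2|).
    have X0 : 0 <= eta ^+ 2 * (b * tau ^+ 3) / s.
      exact: (divr_ge0 (mulr_ge0 e20 (mulr_ge0 b0 t30)) (ltW s0)).
    by rewrite ler_wpM2l// /a -normrM ler_norm.
  have L5 : - (eta * tau ^+ 3 * `|B|) <= eta * tau ^+ 3 * B.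
    by rewrite -mulrN ler_wpM2l ?mulr_ge0// lerNl (le_trans (ler_norm _))// normrN.
  pose D := m * s * d ^+ 2.
  have D0 : 0 <= D by rewrite /D !mulr_ge0 ?sqr_ge0// ltW.
  pose F := f ^+ 2 / m * eta ^+ 2.
  have F0 : 0 <= F by rewrite /F mulr_ge0.
  have W1 k Z : 0 <= k -> 0 <= Z -> tau ^+ 3 * (k * Z) <= k * Z.
    by move=> k0 Z0; rewrite ler_piMl// mulr_ge0.
  have W2 k Z : 0 <= k -> 0 <= Z -> tau ^+ 2 * x * (k * Z) <= k * Z.
    by move=> k0 Z0; rewrite ler_piMl// mulr_ge0.
  have k1 : 0 <= 4 * c2 ^+ 2 / c0 by rewrite divr_ge0 ?mulr_ge0 ?sqr_ge0// ltW.
  have k2 : 0 <= 2 * N ^+ 2 / c0 by rewrite divr_ge0 ?mulr_ge0 ?sqr_ge0// ltW.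
  have k3 : 0 <= 2 / c0 by rewrite divr_ge0// ltW.
  have k4 : 0 <= 3 / c1 by rewrite divr_ge0// ltW.
  have V1 := W1 _ _ k1 D0. have V2 := W1 _ _ ler01 D0.
  have V3 := W1 _ _ k2 F0. have V4 := W1 _ _ k3 F0. have V5 := W1 _ _ ler01 F0.
  have V6 := W2 _ _ k4 F0.
  have V7 := mulr_ge0 k1 F0. have V8 := mulr_ge0 k2 D0. have V9 := mulr_ge0 k3 D0. have V10 := mulr_ge0 k4 D0.
  have yh2 : y ^+ 2 <= 4 * h ^+ 2.
    have -> : 4 * h ^+ 2 = (2 * h) ^+ 2 by ring.
    by rewrite ler_sqr ?nnegrE// mulr_ge0.
  have G1 : tau ^+ 3 * eta ^+ 2 * m * c0 / 8 * y ^+ 2 <= tau ^+ 3 * eta ^+ 2 * m * c0 / 8 * (4 * h ^+ 2).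
    by rewrite ler_wpM2l// !mulr_ge0// ?ltW.
  have c01 : c0 <= c1 by rewrite c0E ler_piMl ?(ltW c10)// gerBl mulr_ge0.
  have G2 : tau ^+ 2 * x * eta ^+ 2 * m * y ^+ 2 * (c0 / 8) <= tau ^+ 2 * x * eta ^+ 2 * m * y ^+ 2 * (3 / 4 * c1).
    have X0 : 0 <= tau ^+ 2 * x * eta ^+ 2 * m * y ^+ 2.
      exact: (mulr_ge0 (mulr_ge0 (mulr_ge0 t2x e20) (ltW m0)) (sqr_ge0 y)).
    have X1 : c0 / 8 <= 3 / 4 * c1 by clear - c01 c10; lra.
    by rewrite ler_wpM2l.
  have -> : c0 / 8 * (m * eta ^+ 2 * y ^+ 2 * tau ^+ 2) =
    tau ^+ 3 * eta ^+ 2 * m * c0 / 8 * y ^+ 2 + tau ^+ 2 * x * eta ^+ 2 * m * y ^+ 2 * (c0 / 8).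
    by rewrite /x; ring.
  have KE : K * (m * s * d ^+ 2 + f ^+ 2 / m * eta ^+ 2) = K * D + K * F by rewrite /D /F; ring.
  rewrite KE /q /K.
  clear - I1 I2 I3 I4 I5 I6 L1 L2 L3 L4 L5 V1 V2 V3 V4 V5 V6 V7 V8 V9 V10 D0 F0 G1 G2.
  rewrite /D /F in V1 V2 V3 V4 V5 V6 V7 V8 V9 V10 D0 F0 *.
  move: (s^-1) (m^-1) (c0^-1) (c1^-1) I1 I2 I3 I4 I5 I6 L1 L2 L3 L4 L5 V1 V2 V3 V4 V5 V6 V7 V8 V9 V10 D0 F0 G1 G2.
  move: (`|T1|) (`|T2|) (`|T3|) (`|B|) => AT1 AT2 AT3 AB si mi c0i c1i.
  lra.
have -> : w * m * eta ^+ 2 / s * tau ^+ 2 * sg ^+ 2 = w * (8 / c0 * (c0 / 8 * (m * eta ^+ 2 * y ^+ 2 * tau ^+ 2))).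
  by rewrite sgE sE; field; rewrite !gt_eqF.
have -> : 8 / c0 * (f * (2 * eta * P * T3 + eta ^+ 2 * P * T1 + eta ^+ 2 * P' * T2)
    + eta * P * B + eta ^+ 2 * P * t + eta ^+ 2 * P' * A0 / 2) + 8 / c0 * K *
   (w * m * s * d ^+ 2 + w / m * f ^+ 2 * eta ^+ 2) =
   w * (8 / c0 * (q + K * (m * s * d ^+ 2 + f ^+ 2 / m * eta ^+ 2))).
  by rewrite /q PE P'E /x; ring.
by rewrite ler_wpM2l// ler_wpM2l// divr_ge0// ltW.
Qed.
End Scalar.

Section Vectors.
Context (R : realType) (n : nat).
Local Notation X := 'rV[R]_n.
Implicit Types (x y z : X) (A H : 'M[R]_n).

Lemma dotC x y : dot x y = dot y x.
Proof. by apply: eq_bigr => i _; rewrite mulrC. Qed.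

Lemma dotDl x y z : dot (x + y) z = dot x z + dot y z.
Proof. by rewrite /dot -big_split; apply: eq_bigr => i _; rewrite mxE mulrDl. Qed.

Lemma dotZl c x y : dot (c *: x) y = c * dot x y.
Proof. by rewrite /dot mulr_sumr; apply: eq_bigr => i _; rewrite mxE mulrA. Qed.

Lemma dotDr x y z : dot z (x + y) = dot z x + dot z y.
Proof. by rewrite dotC dotDl !(dotC z). Qed.

Lemma dotZr c x y : dot x (c *: y) = c * dot x y.
Proof. by rewrite dotC dotZl dotC. Qed.

Lemma dotBl x y z : dot (x - y) z = dot x z - dot y z.
Proof. by rewrite dotDl -scaleN1r dotZl mulN1r. Qed.

Lemma dotBr x y z : dot z (x - y) = dot z x - dot z y.
Proof. by rewrite dotC dotBl !(dotC z). Qed.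

Lemma dot_suml (I : Type) (s : seq I) (F : I -> X) y :
  dot (\sum_(i <- s) F i) y = \sum_(i <- s) dot (F i) y.
Proof.
elim: s => [|i s IH]; last by rewrite !big_cons dotDl IH.
by rewrite !big_nil /dot big1// => i _; rewrite mxE mul0r.
Qed.

Lemma dot_ge0 x : 0 <= dot x x.
Proof. by apply: sumr_ge0 => i _; rewrite -expr2 sqr_ge0. Qed.

Lemma dot0 y : dot 0 y = 0.
Proof. by apply: big1 => i _; rewrite mxE mul0r. Qed.

Lemma enorm_ge0 x : 0 <= enorm x. Proof. exact: sqrtr_ge0. Qed.

Lemma enorm2 x : enorm x ^+ 2 = dot x x.
Proof. by rewrite sqr_sqrtr// dot_ge0. Qed.

Lemma dot_eq0 x : dot x x = 0 -> x = 0.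
Proof.
move=> x0; apply/rowP => i; rewrite mxE; apply/eqP; rewrite -sqrf_eq0 -normr_le0.
rewrite ger0_norm ?sqr_ge0// -x0 /dot (bigD1 i)//= -expr2 lerDl.
by apply: sumr_ge0 => j _; rewrite -expr2 sqr_ge0.
Qed.

Lemma cauchy_schwarz x y : `|dot x y| <= enorm x * enorm y.
Proof.
rewrite -(ler_pXn2r (n := 2)) ?nnegrE ?mulr_ge0 ?enorm_ge0// real_normK ?num_real//.
rewrite exprMn !enorm2.
have [x0|x0] := eqVneq (dot x x) 0.
  rewrite (dot_eq0 x0) dot0 expr0n /=.
  by rewrite mulr_ge0 ?dot_ge0.
have xp : 0 < dot x x by rewrite lt_neqAle eq_sym x0 dot_ge0.
have := dot_ge0 (dot x x *: y - dot x y *: x).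
rewrite !(dotBl, dotBr, dotZl, dotZr) (dotC y x) => H.
rewrite -subr_ge0 -(pmulr_rge0 _ xp); nra.
Qed.

Definition frob H := Num.sqrt (\sum_k dot (row k H) (row k H)).

Lemma frob2 H : frob H ^+ 2 = \sum_k dot (row k H) (row k H).
Proof. by rewrite sqr_sqrtr// sumr_ge0// => k _; exact: dot_ge0. Qed.

(** Sum over k the nonnegative values of the form A at the vectors
    s row_k H - z_k (z H), with s = |z|^2. *)
Lemma quad_sum A H z : (forall x, 0 <= dot (x *m A) x) ->
  dot (z *m H *m A) (z *m H) <= dot z z * \sum_k dot (row k H *m A) (row k H).
Proof.
move=> A0; set S := z *m H; set s := dot z z.
have SE : S = \sum_k z 0 k *: row k H by exact: mulmx_sum_row.
have [s0|s0] := eqVneq s 0.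
  have S0 : S = 0 by rewrite /S (dot_eq0 s0) mul0mx.
  by rewrite s0 mul0r S0 mul0mx dot0.
have sp : 0 < s by rewrite lt_neqAle eq_sym s0 dot_ge0.
pose t := \sum_k dot (row k H *m A) (row k H).
have : 0 <= \sum_k dot ((s *: row k H - z 0 k *: S) *m A) (s *: row k H - z 0 k *: S).
  by apply: sumr_ge0 => k _; exact: A0.
have -> : \sum_k dot ((s *: row k H - z 0 k *: S) *m A) (s *: row k H - z 0 k *: S)
   = \sum_k (s ^+ 2 * dot (row k H *m A) (row k H) - s * dot ((z 0 k *: row k H) *m A) S
      - s * dot (z 0 k *: row k H) (S *m A) + z 0 k * z 0 k * dot (S *m A) S).
  apply: eq_bigr => k _.
  rewrite !(mulmxBl, dotBl, dotBr) -!scalemxAl !(dotZl, dotZr) (dotC (S *m A) (row k H)); ring.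
rewrite !big_split/= !sumrN -!mulr_sumr -mulr_suml.
rewrite -(dot_suml _ (fun k => z 0 k *: row k H)) -SE.
have -> : \sum_k dot ((z 0 k *: row k H) *m A) S = dot (S *m A) S.
  by rewrite -(dot_suml _ (fun k => (z 0 k *: row k H) *m A)) -mulmx_suml -SE.
rewrite -/t -[\sum_k z 0 k * z 0 k]/s (dotC S) => H1.
rewrite -subr_ge0 -(pmulr_rge0 _ sp); move: H1; set q := dot _ S.
have -> : s * (s * t - q) = s ^+ 2 * t - s * q - s * q + s * q by ring.
by [].
Qed.

Lemma frob_mul H z : enorm (z *m H) <= enorm z * frob H.
Proof.
rewrite -(ler_pXn2r (n := 2)) ?nnegrE ?mulr_ge0 ?enorm_ge0 ?sqrtr_ge0//.
rewrite exprMn frob2 !enorm2.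
have := @quad_sum 1%:M H z; rewrite mulmx1 => Q.
apply: (le_trans (Q _)); first by move=> x; rewrite mulmx1 dot_ge0.
by rewrite le_eqVlt; apply/orP; left; apply/eqP; congr (_ * _); apply: eq_bigr => k _; rewrite mulmx1.
Qed.

Lemma frob_tr H : `|\tr H| <= n%:R * frob H.
Proof.
rewrite /mxtrace (le_trans (ler_norm_sum _ _ _))//.
rewrite (@le_trans _ _ (\sum_(i < n) frob H))//; last by rewrite sumr_const card_ord mulr_natl.
apply: ler_sum => i _.
rewrite -(ler_pXn2r (n := 2)) ?nnegrE ?sqrtr_ge0// frob2 real_normK ?num_real//.
rewrite (bigD1 i)//= {1}/dot (bigD1 i)//= !mxE -expr2 -addrA lerDl addr_ge0//.
  by apply: sumr_ge0 => j _; rewrite -expr2 sqr_ge0.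
by apply: sumr_ge0 => j _; rewrite dot_ge0.
Qed.

(** For z the gradient of u, H its Hessian, e the gradient of the cutoff eta and
    A the Hessian of the energy density at z, the matrix DP is the derivative of
    the test field eta^2 P(s) z. The second line is thus the differentiated
    equation tested with this field, the third one the admissible error. *)
Lemma elliptic_pointwise (b c1 c2 eta tau w m f : R) (A H : 'M[R]_n) (z e : X) :
  0 <= b -> b * 2 < 1 -> 0 < c1 -> 0 <= c2 -> 0 <= eta -> 0 <= tau <= 1 -> 0 <= w -> 0 < m ->
  0 < dot z z ->
  (forall x, c1 * m * enorm x ^+ 2 <= dot (x *m A) x) ->
  (forall x y, `|dot (x *m A) y| <= c2 * m * enorm x * enorm y) ->
  let s := dot z z in
  let Ds := 2 *: (z *m H) in
  forall c0 P P' (DP : 'M[R]_n), c0 = (1 - 2 * b) * c1 -> P = w * tau ^+ 3 ->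
  P' = w / s * (3 * tau ^+ 2 * (1 - tau) - b * tau ^+ 3) ->
  (forall k, row k DP = (2 * eta * P * z 0 k) *: e + (eta ^+ 2 * P) *: row k H
     + (eta ^+ 2 * P' * z 0 k) *: Ds) ->
  w * m * eta ^+ 2 * s^-1 * tau ^+ 2 * enorm Ds ^+ 2 <=
  8 / c0 * (f * \tr DP + \sum_k dot (row k H *m A) (row k DP))
  + 8 / c0 * (4 * c2 ^+ 2 / c0 + 2 * n%:R ^+ 2 / c0 + 2 / c0 + 3 / c1 + 2)
    * (w * m * s * enorm e ^+ 2 + w / m * f ^+ 2 * eta ^+ 2).
Proof.
move=> b0 b1 c10 c20 e0 t01 w0 m0 zz0 EA EB s Ds c0 P P' DP c0E PE P'E DPE.
have A0 x : 0 <= dot (x *m A) x.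
  exact: (le_trans (mulr_ge0 (mulr_ge0 (ltW c10) (ltW m0)) (sqr_ge0 _)) (EA x)).
pose t := \sum_k dot (row k H *m A) (row k H).
have SE : z *m H = \sum_k z 0 k *: row k H by exact: mulmx_sum_row.
have sumE : \sum_k dot (row k H *m A) (row k DP) =
  eta * P * dot (Ds *m A) e + eta ^+ 2 * P * t + eta ^+ 2 * P' * dot (Ds *m A) Ds / 2.
  under eq_bigr do rewrite DPE !dotDr (dotZr _ _ e) (dotZr _ _ (row _ H)) (dotZr _ _ Ds).
  rewrite !big_split/= -mulr_sumr -/t.
  have aux (y : X) (c : R) : \sum_k c * z 0 k * dot (row k H *m A) y = c / 2 * dot (Ds *m A) y.
    have -> : \sum_k c * z 0 k * dot (row k H *m A) y = c * \sum_k dot ((z 0 k *: row k H) *m A) y.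
      by rewrite mulr_sumr; apply: eq_bigr => k _; rewrite -scalemxAl dotZl mulrA.
    rewrite -(dot_suml _ (fun k => (z 0 k *: row k H) *m A)) -mulmx_suml -SE /Ds -scalemxAl dotZl.
    by field.
  by rewrite !aux; field.
have trE : \tr DP = 2 * eta * P * dot z e + eta ^+ 2 * P * \tr H + eta ^+ 2 * P' * dot z Ds.
  rewrite /mxtrace /dot !mulr_sumr -!big_split/=; apply: eq_bigr => k _.
  have := congr1 (fun M : X => M 0 k) (DPE k); rewrite !mxE => ->; ring.
have s0 : 0 < s by [].
have r0 : 0 < enorm z by rewrite sqrtr_gt0.
have := @elliptic_scalar_bound R n%:R b c1 c2 eta tau w m s (enorm z) (frob H) (enorm Ds) (enorm e) f t
  (dot (Ds *m A) Ds) (dot (Ds *m A) e) (\tr H) (dot z Ds) (dot z e) b0 b1 c10 (ler0n _ _) e0 t01 w0 m0 r0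
  (esym (enorm2 z)) (sqrtr_ge0 _) (enorm_ge0 _) (enorm_ge0 _) c20 _ (EA Ds) _ (EB Ds e) _ (frob_tr H)
  (cauchy_schwarz _ _) (cauchy_schwarz _ _) c0 P P' c0E PE P'E.
rewrite trE sumE !addrA => -> //.
- rewrite frob2 /t mulr_sumr; apply: ler_sum => k _; rewrite -enorm2; exact: EA.
- have := @quad_sum A H z A0; rewrite -/s -/t /Ds -!scalemxAl dotZl dotZr => Q; lra.
- rewrite /Ds /enorm dotZl dotZr mulrA -expr2 sqrtrM ?sqr_ge0// sqrtr_sqr ger0_norm//.
  by rewrite -mulrA ler_wpM2l//; exact: frob_mul.
Qed.

End Vectors.

(** * Compactly supported C^1 functions *)

Section Cutoff.
Context (R : realType) (n : nat).
Local Notation X := 'rV[R]_n.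
Local Notation e_ i := (delta_mx 0 i : X).
Implicit Types (f g : X -> R) (U V : set X).

Lemma Rn_integrable_le f g : Rn_measurable f -> Rn_integrable g -> (forall x, `|f x| <= g x) -> Rn_integrable f.
Proof.
move=> mf ig fg; apply: le_integrable ig => //; first exact/measurable_EFinP.
by move=> t _; rewrite /= lee_fin (le_trans (fg _))// ler_norm.
Qed.

Lemma Rn_integrable_ge0 f : Rn_measurable f -> (forall x, 0 <= f x) -> (Rn_integral f < +oo)%E -> Rn_integrable f.
Proof.
move=> mf f0 fi; apply/integrableP; split; first exact/measurable_EFinP.
under eq_integral do rewrite gee0_abs ?lee_fin//.
exact: fi.
Qed.

Lemma Rn_integrableD f g : Rn_integrable f -> Rn_integrable g -> Rn_integrable (fun x => f x + g x).
Proof. by move=> i j; have := integrableD measurableT i j. Qed.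

Lemma Rn_integrableZ (c : R) f : Rn_integrable f -> Rn_integrable (fun x => c * f x).
Proof. by move=> i; have := integrableZl measurableT c i. Qed.

Lemma Rn_integralD f g : Rn_integrable f -> Rn_integrable g ->
  Rn_integral (fun x => f x + g x) = (Rn_integral f + Rn_integral g)%E.
Proof. by move=> i j; rewrite /Rn_integral -integralD. Qed.

Lemma Rn_integralZ (c : R) f : Rn_integrable f -> Rn_integral (fun x => c * f x) = (c%:E * Rn_integral f)%E.
Proof. by move=> i; rewrite /Rn_integral -integralZl. Qed.

Lemma le_Rn_integral f g : Rn_integrable f -> Rn_integrable g -> (forall x, f x <= g x) -> (Rn_integral f <= Rn_integral g)%E.
Proof. by move=> i j fg; apply: le_integral => // t _; rewrite lee_fin. Qed.

Lemma Rn_integrable_sum (I : Type) (s : seq I) (F : I -> X -> R) :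
  (forall k, Rn_integrable (F k)) -> Rn_integrable (fun x => \sum_(k <- s) F k x) /\
  Rn_integral (fun x => \sum_(k <- s) F k x) = (\sum_(k <- s) Rn_integral (F k))%E.
Proof.
move=> iF; elim: s => [|k s [IH1 IH2]].
  have -> : (fun x : X => \sum_(k <- [::]) F k x) = (fun x => 0).
    by apply/funext => x; rewrite big_nil.
  rewrite big_nil /Rn_integrable /Rn_integral; split; first exact: integrable0.
  by rewrite integral0.
have -> : (fun x : X => \sum_(k <- k :: s) F k x) = (fun x => F k x + \sum_(k <- s) F k x).
  by apply/funext => x; rewrite big_cons.
by rewrite big_cons -IH2; split; [exact: Rn_integrableD|exact: Rn_integralD].
Qed.

Lemma Rn_measurable_indic (A V : set X) f : open V -> cont_on V f -> A `<=` V ->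
  measurable (@vect R n @^-1` A) -> Rn_measurable (fun x => \1_A x * f x).
Proof.
move=> oV cf AV mA.
have mf := measurable_funS (open_vect_measurable oV) (fun t => AV (vect t)) (cont_on_measurable oV cf).
have := (measurable_restrictT _ mA).1 mf.
rewrite /Rn_measurable; congr (measurable_fun _ _); apply/funext => t.
rewrite patchE indicE; have [At|At] := pselect (A (vect t)).
  by rewrite !mem_set// mul1r.
by rewrite !memNset// mul0r.
Qed.

(** A closed ball of the sup norm: it is compact, and it pulls back to a cube of
    known measure. *)
Definition box (x0 : X) (r : R) : set X :=
  [set x | forall i, `[x0 0 i - r, x0 0 i + r]%classic (x 0 i)].

Lemma compact_box x0 r : compact (box x0 r).
Proof.
apply: (@rV_compact R n (fun i => `[x0 0 i - r, x0 0 i + r]%classic)) => i.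
exact: segment_compact.
Qed.

Lemma box_cube x0 r : @vect R n @^-1` (box x0 r) = cube (fun i => x0 0 i - r) (r + r).
Proof.
apply/seteqP; split => t H i; have := H i; rewrite /= !in_itv/= !mxE.
  by rewrite [x0 0 i - r + _]addrA subrK.
by rewrite [x0 0 i - r + _]addrA subrK.
Qed.

Lemma Rn_measurable_indic_powR (A : set X) f (s : R) : 0 < s -> Rn_measurable (fun x => \1_A x * f x) ->
  Rn_measurable (fun x => \1_A x * f x `^ s).
Proof.
move=> s0 mAf; have := measurableT_comp (measurable_powR s) mAf.
apply: eq_measurable_fun => t _ /=; rewrite indicE; case: (_ \in _).
  by rewrite !mul1r.
by rewrite !mul0r powR0// gt_eqF.
Qed.

Lemma Rn_integrable_indic (A : set X) : measurable (@vect R n @^-1` A) ->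
  (leb (@vect R n @^-1` A) < +oo)%E -> Rn_integrable (\1_A : X -> R).
Proof.
move=> mA Afin; apply: Rn_integrable_ge0.
- exact: Rn_measurable_set.
- by move=> x; rewrite indicE.
- by rewrite Rn_integral_set.
Qed.

Lemma Rn_integrable_cont f x0 r : 0 < r -> continuous f -> (forall x, ~ box x0 r x -> f x = 0) -> Rn_integrable f.
Proof.
move=> r0 cf f0.
have [M HM] : exists M, forall x, box x0 r x -> `|f x| <= M.
  have K0 : box x0 r !=set0.
    exists x0 => i; rewrite /= in_itv/=; apply/andP; split; lra.
  have [c cK Hc] := compact_EVT_max K0 (@compact_box x0 r)
    (continuous_subspaceT (fun x => continuous_comp (cf x) (@norm_continuous _ R^o (f x)))).
  by exists (`|f c|) => x Kx; apply: Hc; rewrite inE.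
have mK : measurable (@vect R n @^-1` (box x0 r)) by rewrite box_cube; exact: measurable_cube.
have iK : Rn_integrable (\1_(box x0 r) : X -> R).
  by apply: Rn_integrable_indic => //; rewrite box_cube leb_cube ?addr_gt0// ltry.
apply: (Rn_integrable_le _ (Rn_integrableZ `|M| iK)); first exact: continuous_Rn_measurable.
move=> x; rewrite indicE; have [Kx|Kx] := pselect (box x0 r x).
  by rewrite mem_set// mulr1 (le_trans (HM x Kx))// ler_norm.
by rewrite f0// normr0 mulr_ge0// ler0n.
Qed.

Lemma Rn_integral_partial_eq0 i f : (forall x, derivable (f : X -> R^o) x (e_ i)) -> continuous f ->
  continuous (partial i f) -> Rn_integrable f -> Rn_integrable (partial i f) -> Rn_integral (partial i f) = 0%E.
Proof. by move=> d c cd i1 i2; exact: Rn_integral_derive_eq0. Qed.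

(** With [C1_cover], this extends by zero a C^1 function on U that vanishes
    outside of a ball contained in U. *)
Lemma C1_zero V f : open V -> (forall x, V x -> f x = 0) -> C1 V f /\
  forall i x, V x -> partial i f x = 0.
Proof.
move=> oV f0.
have D i x : V x -> is_derive x (e_ i) (f : X -> R^o) 0.
  move=> Vx; have N : \forall y \near x, (cst 0 : X -> R^o) y = f y.
    near=> y; rewrite /= f0//; near: y; exact: open_nbhs_nbhs.
  exact: (near_eq_is_derive N (is_derive_cst _ _ _)).
split; last by move=> i x Vx; apply: partialE; exact: D.
apply: (C1_intro (df := fun _ _ => 0)) => // [x Vx|i x Vx]; last exact: cst_continuous.
have N : \forall y \near x, 0 = f y.
  near=> y; rewrite /= f0//; near: y; exact: open_nbhs_nbhs.
rewrite /prop_for /continuous_at (f0 x Vx).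
apply: (cvg_trans (near_eq_cvg N)); exact: cvg_cst.
Unshelve. all: by end_near. Qed.

Lemma C1_cover U V f : C1 U f -> C1 V f -> (forall x, U x \/ V x) -> C1 setT f.
Proof. by move=> cU cV UV x _; case: (UV x) => [/cU|/cV]. Qed.

Lemma partial_eq_on U f g i x : open U -> (forall y, U y -> f y = g y) -> U x ->
  partial i f x = partial i g x.
Proof.
move=> oU fg Ux; apply: near_eq_derive; near=> y; apply: fg.
near: y; exact: open_nbhs_nbhs.
Unshelve. all: by end_near. Qed.

Lemma C1_eq_on U f g : open U -> (forall y, U y -> f y = g y) -> C1 U f -> C1 U g.
Proof.
move=> oU fg cf.
apply: (C1_intro (df := fun i => partial i f)) => //.
- move=> x Ux; have N : \forall y \near x, f y = g y.
    near=> y; apply: fg; near: y; exact: open_nbhs_nbhs.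
  rewrite /prop_for /continuous_at -fg//.
  apply: (cvg_trans (near_eq_cvg N)); exact: (C1_cont cf Ux).
- move=> i x Ux; have N : \forall y \near x, (f : X -> R^o) y = g y.
    near=> y; apply: fg; near: y; exact: open_nbhs_nbhs.
  exact: (near_eq_is_derive N (C1_is_derive i cf Ux)).
- by move=> i x Ux; exact: (C1_partial_cont i cf Ux).
Unshelve. all: by end_near. Qed.

Lemma is_derive_coord x i j (c : R) :
  is_derive x (e_ i) ((fun y => y 0 j - c) : X -> R^o) ((i == j)%:R).
Proof.
have H : (h^-1 *: ((((fun y => y 0 j - c) : X -> R^o) \o shift x) (h *: e_ i) - ((fun y => y 0 j - c) x : R^o))) @[h --> 0^'] --> ((i == j)%:R : R^o).
  apply: cvg_near_cst; near=> h.
  have h0 : h != 0 by near: h; exact: nbhs_dnbhs_neq.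
  rewrite /= !mxE eqxx /= (eq_sym j i) (_ : _ - c - _ = h * (i == j)%:R); last by ring.
  by rewrite [_ *: _]mulrA mulVf// mul1r.
by apply: DeriveDef; [apply/cvg_ex; exists ((i == j)%:R); exact: H|exact/cvg_lim].
Unshelve. all: by end_near. Qed.

Lemma C1_coord j (c : R) : C1 setT (fun x : X => x 0 j - c).
Proof.
apply: (C1_intro (df := fun i _ => (i == j)%:R)); first exact: openT.
- move=> x _; apply: continuousB; last exact: cst_continuous.
  exact: coord_continuous.
- by move=> i x _; exact: is_derive_coord.
- by move=> i x _; exact: cst_continuous.
Qed.

Definition dist2 (x0 x : X) : R := dot (x - x0) (x - x0).

Lemma dist2E x0 x : dist2 x0 x = \sum_j (x 0 j - x0 0 j) * (x 0 j - x0 0 j).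
Proof. by apply: eq_bigr => j _; rewrite !mxE. Qed.

Lemma C1_dist2 x0 : C1 setT (dist2 x0).
Proof.
rewrite (_ : dist2 x0 = fun x => \sum_j (x 0 j - x0 0 j) * (x 0 j - x0 0 j)); last first.
  by apply/funext => x; exact: dist2E.
apply: C1_sum => [|j]; first exact: openT.
by apply: C1M; [exact: openT|exact: C1_coord|exact: C1_coord].
Qed.

Lemma is_derive_dist2 x0 x i :
  is_derive x (e_ i) (dist2 x0 : X -> R^o) (2 * (x 0 i - x0 0 i)).
Proof.
rewrite (_ : dist2 x0 = fun x => \sum_j (x 0 j - x0 0 j) * (x 0 j - x0 0 j)); last first.
  by apply/funext => y; exact: dist2E.
have := @is_derive_sum_seq R n _ (index_enum 'I_n) (fun j y => (y 0 j - x0 0 j) * (y 0 j - x0 0 j)) _ x i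
  (fun j => is_derive_mul (is_derive_coord x i j (x0 0 j)) (is_derive_coord x i j (x0 0 j))).
move=> D; apply: (is_derive_eq D).
rewrite (bigD1 i)//= eqxx /= big1 ?addr0; first by ring.
by move=> j /negbTE ji; rewrite eq_sym ji /=; ring.
Qed.

Lemma dist2_box x0 r x : 0 <= r -> dist2 x0 x <= r ^+ 2 -> box x0 r x.
Proof.
move=> r0 H i; rewrite /= in_itv/= -ler_distl.
rewrite -(ler_pXn2r (n := 2)) ?nnegrE// real_normK ?num_real// (le_trans _ H)// dist2E.
rewrite (bigD1 i)//= -expr2 lerDl; apply: sumr_ge0 => j _.
by rewrite -expr2 sqr_ge0.
Qed.

(** Only the square of this function is used as a cutoff: it is C^1, and the
    positive part of a quadratic polynomial has an explicit gradient. *)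
Definition cutoff (x0 : X) (r : R) (x : X) : R := pos_part (r ^+ 2 - dist2 x0 x).

Lemma is_derive_cutoff2 x0 r x i :
  is_derive x (e_ i) ((fun x => cutoff x0 r x ^+ 2) : X -> R^o)
    (2 * cutoff x0 r x * (-2 * (x 0 i - x0 0 i))).
Proof.
have D : is_derive x (e_ i) ((fun y => r ^+ 2 - dist2 x0 y) : X -> R^o) (-2 * (x 0 i - x0 0 i)).
  have D := is_deriveB (is_derive_cst (r ^+ 2 : R^o) x (e_ i)) (is_derive_dist2 x0 x i).
  by apply: (is_derive_eq D); rewrite sub0r mulNr.
exact: (is_derive_comp1 (h := fun s => pos_part s ^+ 2) (is_derive_pos_part2 _) D).
Qed.

Lemma C1_cutoff2 x0 r : C1 setT (fun x => cutoff x0 r x ^+ 2).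
Proof.
apply: (@C1_comp1 R n setT (fun s => pos_part s ^+ 2) (fun s => 2 * pos_part s) (fun x => r ^+ 2 - dist2 x0 x)).
- exact: openT.
- exact: is_derive_pos_part2.
- by apply: continuous_scalef; exact: continuous_pos_part.
- apply: (@C1D R n setT (fun=> r ^+ 2) (fun x => - dist2 x0 x)); first exact: openT.
  + by apply: C1_cst; exact: openT.
  + by apply: C1N; [exact: openT|exact: C1_dist2].
Qed.

Lemma cutoff_ge0 x0 r x : 0 <= cutoff x0 r x. Proof. exact: pos_part_ge0. Qed.

Lemma cutoff_le x0 r x : cutoff x0 r x <= r ^+ 2.
Proof.
rewrite /cutoff; have [H|H] := leP (r ^+ 2 - dist2 x0 x) 0.
  by rewrite pos_part_le0 // sqr_ge0.
by rewrite (pos_part_id (ltW H)) gerBl dot_ge0.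
Qed.

Lemma open_far x0 (c : R) : open [set x | c < dist2 x0 x].
Proof.
rewrite openE => x /= cx.
have : {for x, continuous (dist2 x0)} by exact: (C1_cont (@C1_dist2 x0) (I : setT x)).
move=> /(_ [set y | c < y]); apply; exact: lt_nbhsr.
Qed.

Lemma measurable_dist2_ball x0 (c : R) : measurable (@vect R n @^-1` [set x | dist2 x0 x <= c]).
Proof.
rewrite (_ : [set x | dist2 x0 x <= c] = ~` [set x | c < dist2 x0 x]); last first.
  by apply/seteqP; split => x /=; rewrite leNgt => /negP.
rewrite preimage_setC; apply: measurableC; exact: (open_vect_measurable (@open_far x0 c)).
Qed.

Lemma cutoff_far x0 r x : r ^+ 2 <= dist2 x0 x -> cutoff x0 r x = 0.
Proof. by move=> H; rewrite /cutoff pos_part_le0// subr_le0. Qed.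

End Cutoff.

(** * The energy estimate *)

Local Opaque partial.

(** The terms p_i g_i cancel against the p_k N_ik. Here g is the gradient of f
    and N contains the second derivatives of the flux, so that testing the
    differentiated equation leaves only first derivatives of the flux. *)
Lemma sum_rearrange (R : realType) (n : nat) (f0 : R) (a : 'I_n -> R) (M D : 'I_n -> 'I_n -> R)
    (p g : 'I_n -> R) (N : 'I_n -> 'I_n -> R) : (forall k, g k = - \sum_i N i k) ->
  \sum_i ((f0 * a i + p i * g i) + \sum_k (M k i * D i k + p k * N i k)) =
  f0 * \sum_i a i + \sum_k \sum_i M k i * D i k.
Proof.
move=> gN.
rewrite big_split /= big_split /= -mulr_sumr.
under [X in _ + _ + X]eq_bigr do rewrite big_split /=.
rewrite [X in _ + X]big_split /= [\sum_i \sum_k p k * _]exchange_big /=.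
rewrite [\sum_i \sum_k M k i * D i k]exchange_big /=.
have -> : \sum_k \sum_i p k * N i k = - \sum_k p k * g k.
  by rewrite -sumrN; apply: eq_bigr => k _; rewrite gN mulrN opprK mulr_sumr.
ring.
Qed.

(** Bounds one partial derivative of eta^2 s^g tau^4, with S = s^g, d the
    derivative of s and 2 eta e that of eta^2. Young's inequality with parameter
    lam returns a multiple of the function itself, to be absorbed after
    [faber_krahn] has been applied. *)
Lemma truncated_gradient_bound (R : realFieldType) (lam eta t s S e d g : R) :
  0 < lam -> 0 <= eta -> 0 <= t -> t <= 1 -> 0 < s -> 0 <= S -> e ^+ 2 <= 4 -> 0 <= g ->
  `|eta ^+ 2 * (S / s * (4 * t ^+ 3 * (1 - t) + g * t ^+ 4) * d) + S * t ^+ 4 * (2 * eta * e)|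
  <= lam * (eta ^+ 2 * (S * t ^+ 4))
    + lam^-1 * (8 * S + (4 + g) ^+ 2 / 2 * (S / s ^+ 2 * (eta ^+ 2 * t ^+ 2) * d ^+ 2)).
Proof.
move=> l0 eta0 t0 t1 s0 S0 e4 g0.
pose c := 4 * (1 - t) + g * t.
have ct : 0 <= 1 - t by rewrite subr_ge0.
have c0 : 0 <= c by rewrite addr_ge0// mulr_ge0.
have cg : c <= 4 + g.
  rewrite /c lerD//; first by rewrite ler_piMr// gerBl.
  by rewrite ler_piMr.
have l2 : 0 < lam / 2 by rewrite divr_gt0.
have sn0 : s != 0 by rewrite gt_eqF.
have ln0 : lam != 0 by rewrite gt_eqF.
have X2 : `|S * t ^+ 4 * (2 * eta * e)| <= S * t ^+ 4 * (lam / 2 * eta ^+ 2) + lam^-1 * (8 * S).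
  have St0 : 0 <= S * t ^+ 4 by rewrite mulr_ge0// exprn_ge0.
  have -> : S * t ^+ 4 * (2 * eta * e) = S * t ^+ 4 * (2 * eta) * e by ring.
  rewrite normrM ger0_norm; last by rewrite mulr_ge0// mulr_ge0.
  have -> : S * t ^+ 4 * (2 * eta) * `|e| = S * t ^+ 4 * (eta * (2 * `|e|)) by ring.
  have := ler_wpM2l St0 (young eta (2 * `|e|) l2).
  rewrite mulrDr => Y; apply: (le_trans Y); rewrite lerD2l.
  rewrite exprMn real_normK ?num_real//.
  have -> : S * t ^+ 4 * (2 ^+ 2 * e ^+ 2 / (4 * (lam / 2))) = lam^-1 * (S * (t ^+ 4 * (2 * e ^+ 2))).
    by field.
  rewrite ler_wpM2l ?invr_ge0 ?(ltW l0)// [leRHS]mulrC ler_wpM2l//.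
  apply: (@le_trans _ _ (1 * (2 * e ^+ 2))); last lra.
  by apply: ler_wpM2r; [rewrite mulr_ge0// sqr_ge0|exact: exprn_ile1].
have X1 : `|eta ^+ 2 * (S / s * (4 * t ^+ 3 * (1 - t) + g * t ^+ 4) * d)| <=
    eta ^+ 2 * S * t ^+ 2 * (lam / 2 * t ^+ 2) +
    lam^-1 * ((4 + g) ^+ 2 / 2 * (S / s ^+ 2 * (eta ^+ 2 * t ^+ 2) * d ^+ 2)).
  have -> : eta ^+ 2 * (S / s * (4 * t ^+ 3 * (1 - t) + g * t ^+ 4) * d) =
     eta ^+ 2 * S * t ^+ 2 * (t * (c / s)) * d by rewrite /c; field.
  have W0 : 0 <= eta ^+ 2 * S * t ^+ 2.
    exact: (mulr_ge0 (mulr_ge0 (sqr_ge0 _) S0) (sqr_ge0 _)).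
  have cs0 : 0 <= c / s by rewrite divr_ge0// ltW.
  rewrite normrM ger0_norm; last by rewrite mulr_ge0// mulr_ge0.
  have := ler_wpM2l W0 (young t (c / s * `|d|) l2).
  rewrite mulrDr => Y.
  have -> : eta ^+ 2 * S * t ^+ 2 * (t * (c / s)) * `|d| = eta ^+ 2 * S * t ^+ 2 * (t * (c / s * `|d|)) by ring.
  apply: (le_trans Y); rewrite lerD2l exprMn real_normK ?num_real//.
  have -> : eta ^+ 2 * S * t ^+ 2 * ((c / s) ^+ 2 * d ^+ 2 / (4 * (lam / 2))) =
    lam^-1 * (c ^+ 2 / 2 * (S / s ^+ 2 * (eta ^+ 2 * t ^+ 2) * d ^+ 2)) by field; rewrite sn0 ln0.
  rewrite ler_wpM2l ?invr_ge0 ?(ltW l0)// ler_wpM2r//.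
    apply: mulr_ge0; last exact: sqr_ge0.
    apply: mulr_ge0; last by rewrite mulr_ge0// sqr_ge0.
    by rewrite divr_ge0// sqr_ge0.
  by rewrite ler_wpM2r// lerXn2r// ?nnegrE// addr_ge0.
rewrite (le_trans (ler_normD _ _))// (le_trans (lerD X1 X2))// le_eqVlt; apply/orP; left; apply/eqP.
by field; rewrite ?sn0 ?ln0.
Qed.

Lemma half_absorb (R : realFieldType) (I y : R) : I <= I / 2 + y -> I <= 2 * y.
Proof. by move=> H; lra. Qed.

(** The growth conditions on the Hessian of the energy density, with |z|^2 in
    place of eps^2 + |z|^2: for |z| >= 1 the two are comparable, and homogeneity
    simplifies the choice of weights. *)
Definition elliptic_growth (R : realType) (n : nat) (p c1 c2 : R) (E0 : 'rV[R]_n -> R) : Prop :=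
  forall z : 'rV[R]_n, 1 <= dot z z ->
  (forall x, c1 * (dot z z) `^ (p / 2 - 1) * enorm x ^+ 2 <= dot (x *m hessian E0 z) x) /\
  (forall x y, `|dot (x *m hessian E0 z) y| <=
     c2 * (dot z z) `^ (p / 2 - 1) * enorm x * enorm y).

Section Equation.
Context (R : realType) (n : nat).
Local Notation X := 'rV[R]_n.
Local Notation e_ i := (delta_mx 0 i : X).
Variables (U : set X) (E0 u f : X -> R).
Hypotheses (oU : open U) (sE : smooth_on setT E0) (su : smooth_on U u) (sf : smooth_on U f).
Hypothesis pde : forall x, U x ->
  - divergence (fun y => gradient E0 (gradient u y)) x = f x.

Definition ugrad k : X -> R := partial k u.
Definition flux i : X -> R := fun y => partial i E0 (\row_j ugrad j y).
Definition grad_sq : X -> R := fun x => \sum_k ugrad k x * ugrad k x.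

Let Cv k : C1 U (ugrad k). Proof. exact: (smooth_C1 [:: k] su). Qed.
Let Cdv i k : C1 U (partial i (ugrad k)). Proof. exact: (smooth_C1 [:: i; k] su). Qed.
Let Cu : C1 U u. Proof. exact: (smooth_C1 [::] su). Qed.
Let Cf : C1 U f. Proof. exact: (smooth_C1 [::] sf). Qed.
Let CE2 j i : C1 setT (partial j (partial i E0)). Proof. exact: (smooth_C1 [:: j; i] sE). Qed.
Let CE1 i : C1 setT (partial i E0). Proof. exact: (smooth_C1 [:: i] sE). Qed.

Let CF i : C1 U (flux i).
Proof. exact: (C1_chain oU (CE1 i) Cv). Qed.

Let dflux k i x : U x -> partial k (flux i) x =
  \sum_j partial k (ugrad j) x * partial j (partial i E0) (\row_j ugrad j x).
Proof. by move=> Ux; exact: (partial_chain k (CE1 i) Cv Ux). Qed.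

Let CdF k i : C1 U (partial k (flux i)).
Proof.
apply: (C1_eq_on oU (f := fun x => \sum_j partial k (ugrad j) x * partial j (partial i E0) (\row_j ugrad j x))).
  by move=> y Uy; rewrite dflux.
exact: (C1_sum _ oU (fun j => C1M oU (Cdv k j) (C1_chain oU (CE2 j i) Cv))).
Qed.

Let div_flux x : U x -> f x = - \sum_i partial i (flux i) x.
Proof.
move=> /pde <-; congr (- _); apply: eq_bigr => i _; congr (partial i _ x).
by apply/funext => y; rewrite mxE.
Qed.

Let dsum (I : Type) (s : seq I) (F : I -> X -> R) k x : (forall i, C1 U (F i)) -> U x ->
  partial k (fun y => \sum_(i <- s) F i y) x = \sum_(i <- s) partial k (F i) x.
Proof.
move=> cF Ux; apply: partialE; apply: is_derive_sum_seq => i.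
exact: (C1_is_derive k (cF i) Ux).
Qed.

Let dopp (F : X -> R) k x : C1 U F -> U x ->
  partial k (fun y => - F y) x = - partial k F x.
Proof. by move=> cF Ux; apply: partialE; exact: is_deriveN (C1_is_derive k cF Ux). Qed.

(* The equation differentiated in direction k, with the derivatives exchanged. *)
Let df k x : U x -> partial k f x = - \sum_i partial i (partial k (flux i)) x.
Proof.
move=> Ux; apply: (etrans (partial_eq_on k oU div_flux Ux)).
apply: (etrans (dopp k (C1_sum (index_enum 'I_n) oU (fun i => CdF i i)) Ux)).
apply: (etrans (congr1 -%R (dsum (index_enum 'I_n) k (fun i => CdF i i) Ux))).
apply: (congr1 -%R); apply: eq_bigr => i _.
exact: (schwarz oU (CF i) (CdF i i) (CdF k i) Ux).
Qed.

Let hess_sym i k x : U x -> partial i (ugrad k) x = partial k (ugrad i) x.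
Proof. by move=> Ux; exact: (schwarz oU Cu (Cv k) (Cv i) Ux). Qed.

Lemma C1_grad_sq : C1 U grad_sq.
Proof. exact: (C1_sum _ oU (fun k => C1M oU (Cv k) (Cv k))). Qed.

Lemma open_superlevel c : open [set x | U x /\ c < grad_sq x].
Proof.
rewrite openE => x [Ux ks]; apply: filterI; first exact: open_nbhs_nbhs.
have H := C1_cont C1_grad_sq Ux; apply: (H [set y | c < y]); exact: lt_nbhsr.
Qed.

Let dgrad_sq i x := \sum_k (ugrad k x * partial i (ugrad k) x + ugrad k x * partial i (ugrad k) x).

Let is_derive_grad_sq i x : U x -> is_derive x (e_ i) (grad_sq : X -> R^o) (dgrad_sq i x).
Proof.
move=> Ux; apply: (@is_derive_sum_seq R n _ _ (fun k y => ugrad k y * ugrad k y)) => k.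
by apply: is_derive_mul; exact: (C1_is_derive i (Cv k) Ux).
Qed.

Variables (x0 : X) (r kap b : R).
Hypotheses (r0 : 0 < r) (HU : forall x, dist2 x0 x <= r ^+ 2 -> U x) (kap1 : 1 <= kap).
Let kap0 : 0 < kap. Proof. exact: lt_le_trans kap1. Qed.

(* The test function for the k-th differentiated equation: it vanishes off the
   ball and where |grad u|^2 <= kap. As kap >= 1, ellipticity is used only where
   it is available. *)
Let phi k x := cutoff x0 r x ^+ 2 * (ugrad k x * trunc3 kap (- 3 - b) (grad_sq x)).
Let dphi i k x := cutoff x0 r x ^+ 2 * (ugrad k x * (dtrunc3 kap (-3 - b) (grad_sq x) * dgrad_sq i x)
    + trunc3 kap (-3 - b) (grad_sq x) * partial i (ugrad k) x)
  + ugrad k x * trunc3 kap (-3 - b) (grad_sq x) * (2 * cutoff x0 r x * (-2 * (x 0 i - x0 0 i))).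

Let Ctrunc3 : C1 U (fun x => trunc3 kap (-3 - b) (grad_sq x)).
Proof.
exact: (C1_comp1 oU (fun s => is_derive_trunc3 (-3 - b) s kap0) (continuous_dtrunc3 (al := -3 - b) kap0) C1_grad_sq).
Qed.

Let Ccut : C1 U (fun x => cutoff x0 r x ^+ 2).
Proof. by apply: C1_subset (@C1_cutoff2 R n x0 r). Qed.

Let Cphi k : C1 U (phi k).
Proof. exact: (C1M oU Ccut (C1M oU (Cv k) Ctrunc3)). Qed.

Let is_derive_phi i k x : U x -> is_derive x (e_ i) (phi k : X -> R^o) (dphi i k x).
Proof.
move=> Ux; apply: is_derive_mul; first exact: is_derive_cutoff2.
apply: is_derive_mul; first exact: (C1_is_derive i (Cv k) Ux).
by apply: is_derive_comp1; [exact: is_derive_trunc3|exact: is_derive_grad_sq].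
Qed.

(** Multiplying the k-th differentiated equation by phi_k and summing over k,
    every integration by parts is contained in the single statement that the
    divergence of this compactly supported field has integral zero. *)
Definition test_field i x := f x * phi i x + \sum_k partial k (flux i) x * phi k x.
Definition test_div x := \sum_i partial i (test_field i) x.

Let far := [set x | r ^+ 2 < dist2 x0 x].

Let UorFar x : U x \/ far x.
Proof. by have [/HU|] := leP (dist2 x0 x) (r ^+ 2); [left|right]. Qed.

Let phi_far k x : far x -> phi k x = 0.
Proof. by move=> fx; rewrite /phi cutoff_far ?expr0n ?mul0r// ltW. Qed.

Let J_far i x : far x -> test_field i x = 0.
Proof.
move=> fx; rewrite /test_field phi_far// mulr0 add0r big1// => k _.
by rewrite phi_far// mulr0.
Qed.

Let CJ i : C1 setT (test_field i).
Proof.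
have CU : C1 U (test_field i).
  exact: (C1D oU (C1M oU Cf (Cphi i)) (C1_sum _ oU (fun k => C1M oU (CdF k i) (Cphi k)))).
exact: (C1_cover CU (proj1 (C1_zero (@open_far R n x0 (r ^+ 2)) (@J_far i))) UorFar).
Qed.

Let box_out x : ~ box x0 r x -> far x.
Proof.
by move=> nK; rewrite /far /= ltNge; apply/negP => H; apply: nK; apply: dist2_box => //; exact: ltW.
Qed.

Lemma test_div_integral : Rn_integrable test_div /\ Rn_integral test_div = 0%E.
Proof.
have ciJ i : continuous (test_field i) by move=> x; exact: (C1_cont (CJ i) (I : setT x)).
have cidJ i : continuous (partial i (test_field i)).
  by move=> x; exact: (C1_partial_cont i (CJ i) (I : setT x)).
have iJ i : Rn_integrable (test_field i) by apply: (Rn_integrable_cont r0) => // x /box_out; exact: J_far.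
have idJ i : Rn_integrable (partial i (test_field i)).
  apply: (Rn_integrable_cont r0) => // x /box_out fx.
  by have [_] := C1_zero (@open_far R n x0 (r ^+ 2)) (J_far i); apply.
have [H1 H2] := Rn_integrable_sum (index_enum 'I_n) idJ.
split; first exact: H1.
rewrite /test_div H2 big1// => i _; apply: Rn_integral_partial_eq0 => //.
by move=> x; exact: (((CJ i) x I).2 i).1.
Qed.

Lemma test_div_far x : far x -> test_div x = 0.
Proof.
move=> fx; apply: big1 => i _.
by have [_] := C1_zero (@open_far R n x0 (r ^+ 2)) (J_far i); apply.
Qed.

Lemma test_divE x : U x -> test_div x = f x * (\sum_i dphi i i x) +
  \sum_k \sum_i partial k (flux i) x * dphi i k x.
Proof.
move=> Ux.
have dJ i : partial i (test_field i) x = (f x * dphi i i x + phi i x * partial i f x) +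
   \sum_k (partial k (flux i) x * dphi i k x + phi k x * partial i (partial k (flux i)) x).
  apply: partialE; apply: is_deriveD.
    by apply: is_derive_mul; [exact: (C1_is_derive i Cf Ux)|exact: is_derive_phi].
  apply: (@is_derive_sum_seq R n _ _ (fun k y => partial k (flux i) y * phi k y)) => k.
  by apply: is_derive_mul; [exact: (C1_is_derive i (CdF k i) Ux)|exact: is_derive_phi].
apply: (etrans (eq_bigr _ (fun i _ => dJ i))).
exact: (@sum_rearrange R n (f x) (fun i => dphi i i x) (fun k i => partial k (flux i) x)
  (fun i k => dphi i k x) (fun i => phi i x) (fun k => partial k f x)
  (fun i k => partial i (partial k (flux i)) x) (fun k => df k Ux)).
Qed.

Variables (p c1 c2 g : R).
Hypotheses (bE : b = p / 2 - g) (b_ge0 : 0 <= b) (b_lt : b * 2 < 1) (c1_gt0 : 0 < c1)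
  (c2_ge0 : 0 <= c2) (g0 : 0 <= g) (r1 : r <= 1).
Hypothesis HE : elliptic_growth p c1 c2 E0.

Let posk m s : s <= kap -> pos_part (s - kap) ^+ m.+1 = 0.
Proof. by move=> sk; rewrite pos_part_le0 ?subr_le0// expr0n. Qed.

Lemma test_div_low x : U x -> grad_sq x <= kap -> test_div x = 0.
Proof.
move=> Ux sk; rewrite test_divE//.
have d0 i k : dphi i k x = 0.
  rewrite /dphi /trunc3 /dtrunc3 !posk// !(mul0r, mulr0, addr0).
  by [].
rewrite big1 => [|i _]; last exact: d0.
rewrite mulr0 add0r big1// => k _; rewrite big1// => i _.
by rewrite d0 mulr0.
Qed.

Let c0 := (1 - 2 * b) * c1.
Let KK := 4 * c2 ^+ 2 / c0 + 2 * n%:R ^+ 2 / c0 + 2 / c0 + 3 / c1 + 2.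

(** The pointwise Caccioppoli inequality. The exponent b is chosen such that
    s^-b s^(p/2-1) s = s^g and s^-b / s^(p/2-1) = s^(g+1-p). *)
Lemma weighted_hessian x : U x -> kap < grad_sq x ->
  grad_sq x `^ (g - 2) * (cutoff x0 r x ^+ 2 * tau kap (grad_sq x) ^+ 2) * (\sum_i dgrad_sq i x ^+ 2) <=
  8 / c0 * test_div x + 8 / c0 * KK *
  (grad_sq x `^ g * (4 * dist2 x0 x) + grad_sq x `^ (g + 1 - p) * f x ^+ 2 * cutoff x0 r x ^+ 2).
Proof.
move=> Ux ks.
pose z : X := \row_j ugrad j x.
pose H : 'M[R]_n := \matrix_(k, j) partial j (ugrad k) x.
pose DP : 'M[R]_n := \matrix_(k, i) dphi i k x.
pose e : X := \row_i (-2 * (x 0 i - x0 0 i)).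
have zz : dot z z = grad_sq x by apply: eq_bigr => k _; rewrite mxE.
have s0 : 0 < grad_sq x by apply: lt_trans ks.
have sn0 : grad_sq x != 0 by rewrite gt_eqF.
have z1 : 1 <= dot z z by rewrite zz (le_trans kap1)// ltW.
have [E1 E2] := HE z1.
rewrite zz in E1 E2.
have m0 : 0 < grad_sq x `^ (p / 2 - 1) by rewrite powR_gt0.
have t01 : 0 <= tau kap (grad_sq x) <= 1.
  by apply/andP; split; [exact: tau_ge0 (ltW s0)|exact: tau_le1 (ltW kap0) s0].
have zz0 : 0 < dot z z by rewrite zz.
have DsE i : (2 *: (z *m H)) 0 i = dgrad_sq i x.
  rewrite !mxE /dgrad_sq mulr_sumr; apply: eq_bigr => k _; rewrite !mxE; ring.
have DPE k : row k DP = (2 * cutoff x0 r x * trunc3 kap (-3 - b) (grad_sq x) * z 0 k) *: e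
    + (cutoff x0 r x ^+ 2 * trunc3 kap (-3 - b) (grad_sq x)) *: row k H
    + (cutoff x0 r x ^+ 2 * dtrunc3 kap (-3 - b) (grad_sq x) * z 0 k) *: (2 *: (z *m H)).
  apply/rowP => i.
  have -> (a1 a2 a3 : X) : (a1 + a2 + a3) 0 i = a1 0 i + a2 0 i + a3 0 i by rewrite !mxE.
  have sc (cc : R) (a1 : X) : (cc *: a1) 0 i = cc * a1 0 i by rewrite mxE.
  rewrite (sc _ e) (sc _ (row k H)) (sc _ (2 *: (z *m H))) DsE !mxE /dphi; ring.
have trE : \tr DP = \sum_i dphi i i x by apply: eq_bigr => i _; rewrite mxE.
have sumE : \sum_k dot (row k H *m hessian E0 z) (row k DP) =
    \sum_k \sum_i partial k (flux i) x * dphi i k x.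
  apply: eq_bigr => k _; apply: eq_bigr => i _.
  have DPki : row k DP 0 i = dphi i k x by rewrite !mxE.
  have Hkj j : row k H 0 j = partial k (ugrad j) x by rewrite !mxE (hess_sym j k Ux).
  have Aji j : hessian E0 z j i = partial j (partial i E0) (\row_j ugrad j x) by rewrite mxE.
  have HA : (row k H *m hessian E0 z) 0 i = partial k (flux i) x.
    rewrite (dflux k i Ux) mxE; apply: eq_bigr => j _.
    by rewrite Hkj Aji.
  by rewrite HA DPki.
have eE : enorm e ^+ 2 = 4 * dist2 x0 x.
  rewrite enorm2 dist2E mulr_sumr; apply: eq_bigr => i _; rewrite mxE; ring.
have DsE2 : enorm (2 *: (z *m H)) ^+ 2 = \sum_i dgrad_sq i x ^+ 2.
  by rewrite enorm2; apply: eq_bigr => i _; rewrite DsE expr2.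
have := elliptic_pointwise (f x) b_ge0 b_lt c1_gt0 c2_ge0 (cutoff_ge0 x0 r x) t01
  (powR_ge0 (grad_sq x) (- b)) m0 zz0 E1 E2 (erefl c0) (trunc3E kap b s0) _ DPE.
rewrite zz => /(_ (dtrunc3E kap b s0)).
rewrite trE sumE -(test_divE Ux) eE DsE2 -/KK.
have pD (a d : R) : grad_sq x `^ a * grad_sq x `^ d = grad_sq x `^ (a + d).
  by rewrite powRD// sn0 implybT.
have s1 : grad_sq x = grad_sq x `^ 1 by rewrite powRr1// ltW.
have w1 : grad_sq x `^ (- b) * grad_sq x `^ (p / 2 - 1) * grad_sq x = grad_sq x `^ g.
  rewrite [X in _ * _ * X]s1 !pD; congr (_ `^ _); rewrite bE; ring.
have w2 : grad_sq x `^ (- b) / grad_sq x `^ (p / 2 - 1) = grad_sq x `^ (g + 1 - p).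
  by rewrite -powRN pD; congr (_ `^ _); rewrite bE; field.
have w3 : grad_sq x `^ (- b) * grad_sq x `^ (p / 2 - 1) / grad_sq x = grad_sq x `^ (g - 2).
  rewrite [X in _ * _ / X]s1 -powRN !pD; congr (_ `^ _); rewrite bE; ring.
rewrite w1 w2 => HW.
apply: le_trans HW; rewrite -w3.
by rewrite le_eqVlt; apply/orP; left; apply/eqP; ring.
Qed.

(** The function to which [faber_krahn] is applied is eta^2 s^g (1 - kap/s)_+^4;
    it vanishes off [level_set], and [level_rhs] collects the error terms of
    [weighted_hessian]. *)
Definition level_fun x := cutoff x0 r x ^+ 2 * trunc4 kap (g - 4) (grad_sq x).
Definition level_set : set X := [set x | dist2 x0 x <= r ^+ 2] `&` [set x | U x /\ kap < grad_sq x].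
Definition level_rhs x := \1_level_set x * (grad_sq x `^ g + f x ^+ 2 * grad_sq x `^ (g + 1 - p)).
Definition hess_const := 4 * (4 + g) ^+ 2 / c0.
Definition level_const := 8 * n%:R + 4 * hess_const * KK.

Let dlevel_fun i x := cutoff x0 r x ^+ 2 * (dtrunc4 kap (g - 4) (grad_sq x) * dgrad_sq i x)
  + trunc4 kap (g - 4) (grad_sq x) * (2 * cutoff x0 r x * (-2 * (x 0 i - x0 0 i))).

Let is_derive_level_fun i x : U x -> is_derive x (e_ i) (level_fun : X -> R^o) (dlevel_fun i x).
Proof.
move=> Ux; apply: is_derive_mul; first exact: is_derive_cutoff2.
by apply: is_derive_comp1; [exact: is_derive_trunc4|exact: is_derive_grad_sq].
Qed.

Let c0_gt0 : 0 < c0.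
Proof. by rewrite /c0 mulr_gt0// subr_gt0 mulrC. Qed.

Let KK_ge0 : 0 <= KK.
Proof.
have [c0p c1p] := (ltW c0_gt0, ltW c1_gt0).
by rewrite /KK !addr_ge0// divr_ge0// mulr_ge0// sqr_ge0.
Qed.

Let hess_const_ge0 : 0 <= hess_const.
Proof. by have c0p := ltW c0_gt0; rewrite /hess_const divr_ge0// mulr_ge0// sqr_ge0. Qed.

Let level_setP x : ~ level_set x -> far x \/ (U x /\ grad_sq x <= kap).
Proof.
move=> nA; have [H|H] := leP (dist2 x0 x) (r ^+ 2); last by left.
right; have Ux := HU H; split => //.
by rewrite leNgt; apply/negP => ks; apply: nA.
Qed.

Lemma level_fun_out x : ~ level_set x -> level_fun x = 0.
Proof.
move=> /level_setP[fx|[Ux sk]]; first by rewrite /level_fun cutoff_far ?ltW// expr0n mul0r.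
by rewrite /level_fun /trunc4 posk// mul0r mulr0.
Qed.

Lemma level_fun_ge0 x : 0 <= level_fun x.
Proof. exact: (mulr_ge0 (sqr_ge0 _) (trunc4_ge0 _ _ _)). Qed.

Let level_fun_far x : far x -> level_fun x = 0.
Proof. by move=> fx; rewrite /level_fun cutoff_far ?ltW// expr0n mul0r. Qed.

Lemma level_const_ge0 : 0 <= level_const.
Proof.
have k4 : 0 <= 4 * hess_const by exact: mulr_ge0.
by apply: addr_ge0; apply: mulr_ge0; rewrite ?ler0n.
Qed.

Lemma C1_level_fun : C1 setT level_fun.
Proof.
have CP : C1 U (fun x => trunc4 kap (g - 4) (grad_sq x)).
  exact: (C1_comp1 oU (fun s => is_derive_trunc4 (g - 4) s kap0) (continuous_dtrunc4 (al := g - 4) kap0) C1_grad_sq).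
exact: (C1_cover (C1M oU Ccut CP) (proj1 (C1_zero (@open_far R n x0 (r ^+ 2)) (@level_fun_far))) UorFar).
Qed.

Lemma level_rhs_ge0 x : 0 <= level_rhs x.
Proof.
apply: mulr_ge0; first by rewrite indicE.
exact: (addr_ge0 (powR_ge0 _ _) (mulr_ge0 (sqr_ge0 _) (powR_ge0 _ _))).
Qed.

(** The weighted second derivatives that appear in the gradient are bounded by
    [test_div], which integrates to zero. *)
Lemma sum_grad_level_fun lam x : 0 < lam ->
  \sum_i `|partial i level_fun x| <=
  n%:R * lam * level_fun x + lam^-1 * (level_const * level_rhs x + hess_const * test_div x).
Proof.
move=> l0.
have [Ax|nAx] := pselect (level_set x); last first.
  have Q0 : test_div x = 0 by case: (level_setP nAx) => [/test_div_far|[Ux /(test_div_low Ux)]].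
  have d0 i : partial i level_fun x = 0.
    case: (level_setP nAx) => [fx|[Ux sk]].
      by have [_] := C1_zero (@open_far R n x0 (r ^+ 2)) (@level_fun_far); apply.
    rewrite (partialE (is_derive_level_fun i Ux)) /dlevel_fun /dtrunc4 /trunc4 !posk// !(mul0r, mulr0, addr0).
    by [].
  rewrite Q0 mulr0 addr0 big1 => [|i _]; last by rewrite d0 normr0.
  by rewrite level_fun_out// mulr0 add0r mulr_ge0 ?invr_ge0 ?(ltW l0)// /level_rhs indicE memNset// mul0r mulr0.
have [/= sq [Ux ks]] := Ax.
have s0 : 0 < grad_sq x by exact: lt_trans ks.
have sn0 : grad_sq x != 0 by rewrite gt_eqF.
have level_rhsE : level_rhs x = grad_sq x `^ g + f x ^+ 2 * grad_sq x `^ (g + 1 - p).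
  by rewrite /level_rhs indicE mem_set// mul1r.
have WH := weighted_hessian Ux ks.
have t0 : 0 <= tau kap (grad_sq x) := tau_ge0 kap (ltW s0).
have t1 : tau kap (grad_sq x) <= 1 := tau_le1 (ltW kap0) s0.
have e0 := cutoff_ge0 x0 r x.
have r21 : r ^+ 2 <= 1 by rewrite exprn_ile1// ltW.
have e1 : cutoff x0 r x <= 1 by rewrite (le_trans (cutoff_le _ _ _)).
have level_funE : level_fun x = cutoff x0 r x ^+ 2 * (grad_sq x `^ g * tau kap (grad_sq x) ^+ 4).
  by rewrite /level_fun trunc4E.
have S0 : 0 <= grad_sq x `^ g by exact: powR_ge0.
have w3 : grad_sq x `^ (g - 2) = grad_sq x `^ g / grad_sq x ^+ 2.
  by rewrite powRD ?sn0 ?implybT// (powR_invn 2) ?ltW.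
set s := grad_sq x in s0 sn0 level_rhsE WH t0 t1 level_funE S0 w3 *.
set t := tau kap s in t0 t1 WH level_funE *.
set eta := cutoff x0 r x in e0 e1 WH level_funE *.
have di i : `|partial i level_fun x| <= lam * level_fun x +
    lam^-1 * (8 * s `^ g + (4 + g) ^+ 2 / 2 * (s `^ (g - 2) * (eta ^+ 2 * t ^+ 2) * dgrad_sq i x ^+ 2)).
  have e4 : (-2 * (x 0 i - x0 0 i)) ^+ 2 <= 4.
    have H : (x 0 i - x0 0 i) ^+ 2 <= dist2 x0 x.
      rewrite dist2E (bigD1 i)//= -expr2 lerDl; apply: sumr_ge0 => j _.
      by rewrite -expr2 sqr_ge0.
    have -> : (-2 * (x 0 i - x0 0 i)) ^+ 2 = 4 * (x 0 i - x0 0 i) ^+ 2 by ring.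
    by rewrite ler_piMr// (le_trans H)// (le_trans sq).
  rewrite (partialE (is_derive_level_fun i Ux)) /dlevel_fun dtrunc4E// trunc4E// level_funE w3.
  exact: truncated_gradient_bound.
apply: (le_trans (ler_sum _ (fun i _ => di i))).
rewrite big_split /= sumr_const card_ord -mulr_sumr big_split /= sumr_const card_ord -mulr_sumr -mulr_sumr.
set D := \sum_i dgrad_sq i x ^+ 2 in WH *.
set W := s `^ (g - 2) * _ in WH *.
have F0 : 0 <= f x ^+ 2 * s `^ (g + 1 - p) by rewrite mulr_ge0 ?sqr_ge0 ?powR_ge0.
have B1 : s `^ g * (4 * dist2 x0 x) + s `^ (g + 1 - p) * f x ^+ 2 * eta ^+ 2 <= 4 * level_rhs x.
  rewrite level_rhsE mulrDr lerD//.
    rewrite mulrC ler_wpM2r// ler_piMr// (le_trans sq)//.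
  have eta21 : eta ^+ 2 <= 1 by exact: exprn_ile1.
  have -> : s `^ (g + 1 - p) * f x ^+ 2 * eta ^+ 2 = f x ^+ 2 * s `^ (g + 1 - p) * eta ^+ 2 by ring.
  have := ler_wpM2l F0 eta21; move: F0; set F := f x ^+ 2 * _; lra.
have C1' : 0 <= (4 + g) ^+ 2 / 2 by rewrite divr_ge0// sqr_ge0.
have C2' : 0 <= 8 / c0 * KK by rewrite mulr_ge0// divr_ge0// ltW.
have WH2 : W * D <= 8 / c0 * test_div x + 8 / c0 * KK * (4 * level_rhs x).
  by apply: (le_trans WH); rewrite lerD2l ler_wpM2l.
have H1 := ler_wpM2l C1' WH2.
rewrite -(mulr_natl (lam * level_fun x)) -(mulr_natl (8 * s `^ g)) mulrA lerD2l.
apply: ler_wpM2l; first by rewrite invr_ge0 ltW.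
apply: (le_trans (lerD (lexx _) H1)).
have E : level_const * level_rhs x + hess_const * test_div x = 8 * n%:R * level_rhs x +
    (4 + g) ^+ 2 / 2 * (8 / c0 * test_div x + 8 / c0 * KK * (4 * level_rhs x)).
  by rewrite /level_const /hess_const; field; rewrite gt_eqF.
rewrite E lerD2r mulrA [n%:R * 8]mulrC; apply: ler_wpM2l; first by rewrite mulr_ge0.
by rewrite level_rhsE lerDl.
Qed.

Variables (a ell : R).
Hypotheses (n0 : (0 < n)%N) (ell0 : 0 < ell) (al : 2 * a <= ell ^+ n).

Lemma measurable_level_set : measurable (@vect R n @^-1` level_set).
Proof.
have oV := @open_superlevel kap.
rewrite /level_set preimage_setI; apply: measurableI; last exact: (open_vect_measurable oV).
exact: measurable_dist2_ball.
Qed.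

Lemma Rn_measurable_level_rhs : Rn_measurable level_rhs.
Proof.
have oV := @open_superlevel kap.
apply: (Rn_measurable_indic oV _ _ measurable_level_set); last by move=> x [].
move=> x [Ux ks].
have s0 : 0 < grad_sq x by exact: lt_trans ks.
have cp d : {for x, continuous (fun y => grad_sq y `^ d)}.
  apply: (@continuous_comp _ _ _ grad_sq (fun y => y `^ d) x (C1_cont C1_grad_sq Ux)).
  exact: is_derive1_cont (is_derive1_powR d s0).
apply: continuousD; first exact: cp.
apply: continuousM; last exact: cp.
by apply: continuousM; exact: (C1_cont Cf Ux).
Qed.

Hypothesis Aa : (leb (@vect R n @^-1` level_set) <= a%:E)%E.

(** For lam = 1 / (4 ell n), [faber_krahn] and [sum_grad_level_fun] bound the
    integral of [level_fun] by half of itself plus the right-hand side. One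
    factor ell comes from [faber_krahn], the other one from lam^-1. *)
Lemma energy_estimate : (Rn_integral level_fun <= (16 * n%:R * level_const * ell ^+ 2)%:E * Rn_integral level_rhs)%E.
Proof.
have cG : continuous level_fun by move=> x; exact: (C1_cont C1_level_fun (I : setT x)).
have cdG i : continuous (partial i level_fun).
  by move=> x; exact: (C1_partial_cont i C1_level_fun (I : setT x)).
have iG : Rn_integrable level_fun by apply: (Rn_integrable_cont r0) => // x /box_out; exact: level_fun_far.
have iadG i : Rn_integrable (fun x => `|partial i level_fun x|).
  apply: (Rn_integrable_cont r0) => [x|x /box_out fx].
    by apply: continuous_comp; [exact: cdG|exact: norm_continuous].
  have [_ ->//] := C1_zero (@open_far R n x0 (r ^+ 2)) (@level_fun_far); exact: normr0.
have [iQ IQ] := test_div_integral.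
have FK := faber_krahn cG (fun i x => ((C1_level_fun I).2 i).1) cdG level_fun_ge0 iG measurable_level_set level_fun_out Aa ell0 al.
have [isum Isum] := Rn_integrable_sum (index_enum 'I_n) iadG.
rewrite -Isum in FK.
have [I Ie] : exists I : R, Rn_integral level_fun = I%:E.
  by exists (fine (Rn_integral level_fun)); rewrite fineK//; exact: integrable_fin_num iG.
have n1 : 1 <= n%:R :> R by rewrite ler1n.
have n0' : 0 < n%:R :> R by rewrite ltr0n.
have level_const_gt0 : 0 < level_const.
  by rewrite /level_const ltr_pwDl// ?mulr_gt0// mulr_ge0// mulr_ge0.
have C0 : 0 < 16 * n%:R * level_const * ell ^+ 2 by rewrite !mulr_gt0// exprn_gt0.
have [Ibfin|Ibinf] := boolP (Rn_integral level_rhs < +oo)%E; last first.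
  have -> : Rn_integral level_rhs = +oo%E by apply/eqP; rewrite -leye_eq leNgt.
  by rewrite gt0_muley ?lte_fin// leey.
have ib : Rn_integrable level_rhs := Rn_integrable_ge0 Rn_measurable_level_rhs level_rhs_ge0 Ibfin.
have [B Be] : exists B : R, Rn_integral level_rhs = B%:E.
  by exists (fine (Rn_integral level_rhs)); rewrite fineK//; exact: integrable_fin_num ib.
pose lam := (4 * ell * n%:R)^-1.
have lam0 : 0 < lam by rewrite invr_gt0 !mulr_gt0.
have i2 : Rn_integrable (fun x => level_const * level_rhs x + hess_const * test_div x) by apply: Rn_integrableD; exact: Rn_integrableZ.
have i1 : Rn_integrable (fun x => n%:R * lam * level_fun x + lam^-1 * (level_const * level_rhs x + hess_const * test_div x)).
  by apply: Rn_integrableD; exact: Rn_integrableZ.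
have := le_Rn_integral isum i1 (fun x => sum_grad_level_fun x lam0).
rewrite (Rn_integralD (Rn_integrableZ _ iG) (Rn_integrableZ _ i2)) (Rn_integralZ _ iG) (Rn_integralZ _ i2).
rewrite (Rn_integralD (Rn_integrableZ _ ib) (Rn_integrableZ _ iQ)) (Rn_integralZ _ ib) (Rn_integralZ _ iQ) IQ mule0 adde0.
rewrite Ie Be -!EFinM -EFinD => H.
have L0 : (0 <= (2 * ell)%:E)%E by rewrite lee_fin mulr_ge0// ltW.
have := le_trans FK (lee_wpmul2l L0 H).
rewrite Ie -!EFinM !lee_fin.
have -> : 2 * ell * (n%:R * lam * I + lam^-1 * (level_const * B)) = I / 2 + (8 * n%:R * level_const * ell ^+ 2) * B.
  by rewrite /lam; field; rewrite !gt_eqF.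
move=> /half_absorb; rewrite (_ : 2 * _ = 16 * n%:R * level_const * ell ^+ 2 * B)//; ring.
Qed.

End Equation.

(** * Fast geometric decay *)

Lemma dg_exponent_bounds (R : realType) (n : nat) (qi : R) : (2 <= n)%N -> 0 <= qi ->
  n%:R * qi < 1 -> 0 < 2 / n%:R - 2 * qi /\ 2 / n%:R - 2 * qi <= 1.
Proof.
move=> n2 qi0 nqi; have nR0 : 0 < n%:R :> R by rewrite ltr0n (ltn_trans _ n2).
split.
  have -> : 2 / n%:R - 2 * qi = 2 / n%:R * (1 - n%:R * qi) by field; rewrite gt_eqF.
  by rewrite mulr_gt0 ?divr_gt0// subr_gt0.
rewrite (@le_trans _ _ (2 / n%:R))// ?gerBl ?mulr_ge0//.
by rewrite ler_pdivrMr// mul1r (ler_nat R 2).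
Qed.

Section FastDecay.
Context (R : realType).
Let four0 : 0 < 4 :> R. Proof. by rewrite ltr0n. Qed.
Let four1 : 1 <= 4 :> R. Proof. by rewrite (ler_nat R 1). Qed.
Let p4 k : 0 < 4 ^+ k :> R. Proof. by rewrite exprn_gt0. Qed.
Let p41 k : 1 <= 4 ^+ k :> R. Proof. by rewrite exprn_ege1. Qed.
Implicit Types (D aa : R) (j : nat).

(** A geometric solution of beta_(j+1) = D (4^5)^j beta_j^(1+aa): its ratio q is
    determined by q^aa = 4^-5 and its first term by D beta_0^aa = q. *)
Definition dg_ratio aa : R := (4 ^+ 5) `^ (- aa^-1).
Definition dg_seq D aa j : R := (dg_ratio aa / D) `^ aa^-1 * dg_ratio aa ^+ j.

Section Props.
Variables (D aa : R).
Hypotheses (D1 : 1 <= D) (aa0 : 0 < aa) (aa1 : aa <= 1).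

Let D0 : 0 < D. Proof. exact: lt_le_trans D1. Qed.
Let aan0 : aa != 0. Proof. by rewrite gt_eqF. Qed.

Lemma dg_ratio_gt0 : 0 < dg_ratio aa. Proof. by rewrite powR_gt0// p4. Qed.

Lemma dg_ratio_le : dg_ratio aa <= (4 ^+ 5)^-1.
Proof.
rewrite -(powRr1 (ltW (p4 5))) -powRN; apply: ler_powR; first exact: p41.
by rewrite lerN2 invr_ge1 ?unitfE.
Qed.

Lemma dg_seq_gt0 j : 0 < dg_seq D aa j.
Proof. by rewrite mulr_gt0 ?exprn_gt0 ?dg_ratio_gt0// powR_gt0// divr_gt0// dg_ratio_gt0. Qed.

Lemma dg_seq0_le : dg_seq D aa 0 <= (4 ^+ 5)^-1.
Proof.
have q0 := dg_ratio_gt0; have q1 := dg_ratio_le.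
have qD0 : 0 < dg_ratio aa / D by rewrite divr_gt0.
have qD : dg_ratio aa / D <= (4 ^+ 5)^-1.
  by rewrite ler_pdivrMr// (le_trans q1)// ler_peMr.
rewrite /dg_seq expr0 mulr1; apply: le_trans qD.
rewrite -[leRHS](powRr1 (ltW qD0)); apply: ger_powR; last by rewrite invr_ge1 ?unitfE.
rewrite qD0 /= ler_pdivrMr// mul1r (le_trans _ D1)// (le_trans q1)//.
by rewrite invf_le1 ?p4// p41.
Qed.

Lemma dg_seqS j : D * (4 ^+ 5) ^+ j * dg_seq D aa j `^ (1 + aa) = dg_seq D aa j.+1.
Proof.
have q0 := dg_ratio_gt0.
have qD0 : 0 < dg_ratio aa / D by rewrite divr_gt0.
rewrite powRD ?(gt_eqF (dg_seq_gt0 j)) ?implybT// powRr1 ?(ltW (dg_seq_gt0 j))//.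
have -> : dg_seq D aa j `^ aa = dg_ratio aa / D * (4 ^+ 5) ^- j.
  rewrite /dg_seq powRM ?powR_ge0 ?exprn_ge0 ?(ltW q0)//.
  rewrite -powRrM mulVf// powRr1 ?(ltW qD0)//; congr (_ * _).
  have qa : dg_ratio aa `^ aa = 4 ^- 5.
    by rewrite /dg_ratio -powRrM mulNr mulVf// powRN powRr1 ?(ltW (p4 5)).
  rewrite -powR_mulrn ?(ltW q0)// -powRrM [j%:R * _]mulrC powRrM qa.
  by rewrite powR_mulrn ?exprVn// invr_ge0 ltW ?p4.
have tn0 : (4 ^+ 5) ^+ j != 0 :> R by rewrite gt_eqF// exprn_gt0.
rewrite /dg_seq [dg_ratio aa ^+ _.+1]exprS; move: tn0; set t := (4 ^+ 5) ^+ j => tn0.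
by field; rewrite tn0 gt_eqF.
Qed.

(** The factor 4^4 (4^2)^j is delta^-4 for the relative gap delta = 2^-j / 4
    between consecutive levels; the product bounds the measure of a level set. *)
Lemma dg_seq_small j : 4 ^+ 4 * (4 ^+ 2) ^+ j * dg_seq D aa j <= 1.
Proof.
have q0 := dg_ratio_gt0; have q1 := dg_ratio_le; have s0 := dg_seq0_le.
rewrite /dg_seq in s0 *; rewrite expr0 mulr1 in s0.
set b0 := (_ / _) `^ _ in s0 *.
have b00 : 0 <= b0 by exact: powR_ge0.
have Q : (4 ^+ 2 * dg_ratio aa) ^+ j <= 1.
  apply: exprn_ile1; first by rewrite mulr_ge0 ?ltW ?p4.
  by rewrite -ler_pdivlMl ?p4// mulr1 (le_trans q1)// lef_pV2 ?posrE ?p4// ler_eXn2l// (ltr_nat R 1).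
have -> : 4 ^+ 4 * (4 ^+ 2) ^+ j * (b0 * dg_ratio aa ^+ j) = (4 ^+ 4 * b0) * (4 ^+ 2 * dg_ratio aa) ^+ j.
  by rewrite [(4 ^+ 2 * dg_ratio aa) ^+ j]exprMn; move: ((4 ^+ 2) ^+ j) => t; ring.
rewrite mulr_ile1//; [by rewrite mulr_ge0// ltW ?p4|by rewrite exprn_ge0// mulr_ge0 ?ltW ?p4|].
by rewrite -ler_pdivlMl ?p4// mulr1 (le_trans s0)// lef_pV2 ?posrE ?p4// ler_eXn2l// (ltr_nat R 1).
Qed.

Lemma dg_seq_lim (c k : R) : (forall j, c <= k * dg_seq D aa j) -> c <= 0.
Proof.
move=> H; rewrite leNgt; apply/negP => c0.
have q0 := dg_ratio_gt0; have q1 := dg_ratio_le.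
have C : (k * (dg_ratio aa / D) `^ aa^-1) *: dg_ratio aa ^+ j @[j --> \oo] --> (0 : R).
  rewrite -(scaler0 _ (k * (dg_ratio aa / D) `^ aa^-1)); apply: cvgZr.
  apply: cvg_expr; rewrite ger0_norm ?(ltW q0)// (le_lt_trans q1)//.
  by rewrite invf_lt1 ?p4// exprn_egt1// (ltr_nat R 1).
suff : c <= 0 by rewrite leNgt c0.
rewrite -(cvg_lim _ C)//; apply: limr_ge; first by apply/cvg_ex; exists 0.
by near=> j; rewrite (le_trans (H j))// /dg_seq /GRing.scale /= mulrA.
Unshelve. all: by end_near.
Qed.

End Props.

(** With h = 2^-j, the squares of the radii rho (1 + h) / 2 and
    rho (1 + h / 2) / 2 differ by at least rho^2 h / 4, and h / 4
    is the relative gap between consecutive levels; the factors h^-2 and h^-8 combine to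
    (4^5)^j. *)
Lemma dg_step_const (rho N D1 aa beta : R) j :
  0 < rho -> rho <= 1 -> 0 <= N -> 0 < aa -> aa <= 1 -> 0 < beta ->
  D1 = 4 ^+ 10 * (N + 1) ->
  let h : R := 2^-1 ^+ j in
  ((rho * ((1 + h) / 2)) ^+ 2 - (rho * ((1 + h / 2) / 2)) ^+ 2) ^- 2 * N *
    ((h / 4) ^- 4 * beta) `^ (1 + aa) <= rho ^- 4 * D1 * (4 ^+ 5) ^+ j * beta `^ (1 + aa).
Proof.
move=> rho0 rho1 N0 aa0 aa1 b0 ->; set h := 2^-1 ^+ j => /=.
have h0 : 0 < h by rewrite exprn_gt0.
have hn : h != 0 by rewrite gt_eqF.
have h1 : h <= 1 by rewrite exprn_ile1// invf_le1// (ler_nat R 1).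
have rn : rho != 0 by rewrite gt_eqF.
set e := _ ^+ 2 - _ ^+ 2.
have eE : rho ^+ 2 * (h / 4) <= e.
  have -> : e = rho ^+ 2 * (h / 4) * (1 + 3 / 4 * h) by rewrite /e; field.
  rewrite ler_peMr//; first by rewrite mulr_ge0 ?sqr_ge0// divr_ge0// ltW.
  by rewrite lerDl mulr_ge0// ltW.
have e0 : 0 < rho ^+ 2 * (h / 4) by rewrite mulr_gt0 ?exprn_gt0// divr_gt0.
have e0' : 0 < e by exact: lt_le_trans eE.
have E k : (4 ^+ k) ^+ j = (4 ^+ j) ^+ k :> R by rewrite -!exprM mulnC.
have hV : 4 ^+ j = h ^- 2 :> R.
  have -> : 4 = 2 ^+ 2 :> R by rewrite expr2 -natrM.
  by rewrite /h -exprVn -exprVn invrK -!exprM mulnC.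
have A1 : e ^- 2 <= rho ^- 4 * 4 ^+ 2 * 4 ^+ j.
  have -> : rho ^- 4 * 4 ^+ 2 * 4 ^+ j = (rho ^+ 2 * (h / 4)) ^- 2.
    by rewrite hV; field; rewrite rn hn.
  by rewrite lef_pV2 ?posrE ?exprn_gt0// lerXn2r// ?nnegrE ltW.
have h4 : (h / 4) ^- 4 = 4 ^+ 4 * (4 ^+ 2) ^+ j.
  by rewrite E hV; field.
have P0 : 0 <= 4 ^+ 4 * (4 ^+ 2) ^+ j :> R by rewrite ltW// mulr_gt0// ?exprn_gt0.
have P1 : 1 <= 4 ^+ 4 * (4 ^+ 2) ^+ j :> R.
  by exact: mulr_ege1 (p41 4) (exprn_ege1 _ (p41 2)).
have A2 : ((h / 4) ^- 4 * beta) `^ (1 + aa) <= 4 ^+ 8 * (4 ^+ 4) ^+ j * beta `^ (1 + aa).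
  rewrite h4 powRM ?(ltW b0)// ler_wpM2r ?powR_ge0//.
  have -> : 4 ^+ 8 * (4 ^+ 4) ^+ j = (4 ^+ 4 * (4 ^+ 2) ^+ j) `^ 2 :> R.
    by rewrite powR_mulrn// !E; ring.
  by apply: ler_powR => //; rewrite -lerBrDl (le_trans aa1)// lerBrDl -natr1.
apply: (@le_trans _ _ ((rho ^- 4 * 4 ^+ 2 * 4 ^+ j) * (N + 1) * (4 ^+ 8 * (4 ^+ 4) ^+ j * beta `^ (1 + aa)))).
  apply: ler_pM => //; first by rewrite mulr_ge0// invr_ge0 exprn_ge0// ltW.
    exact: powR_ge0.
  apply: ler_pM => //; first by rewrite invr_ge0 exprn_ge0// ltW.
  by rewrite lerDl.
have -> : (4 ^+ 5) ^+ j = 4 ^+ j * (4 ^+ 4) ^+ j :> R by rewrite !E; ring.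
rewrite le_eqVlt; apply/orP; left; apply/eqP; ring.
Qed.

End FastDecay.

(** * De Giorgi iteration *)

(** What membership of f in L^q provides, with qi = 1 / q: this form treats finite
    q and q = +oo alike. The constant 2 leaves room for Young's inequality. *)
Definition square_integral_growth (R : realType) (n : nat) (f : 'rV[R]_n -> R)
    (B : set 'rV[R]_n) (F qi : R) : Prop :=
  forall (A : set 'rV[R]_n) (al : R), A `<=` B -> measurable (@vect R n @^-1` A) ->
  0 < al -> (leb (@vect R n @^-1` A) <= al%:E)%E ->
  (Rn_integral (fun x => \1_A x * f x ^+ 2)%R <= (2 * F ^+ 2 * al `^ (1 - 2 * qi))%:E)%E.

Section DeGiorgi.
Context (R : realType) (n : nat).
Local Notation X := 'rV[R]_n.
Variables (U : set X) (E0 u f : X -> R).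
Hypotheses (oU : open U) (sE : smooth_on setT E0) (su : smooth_on U u) (sf : smooth_on U f).
Hypothesis pde : forall x, U x ->
  - divergence (fun y => gradient E0 (gradient u y)) x = f x.
Variables (x0 : X) (rho p c1 c2 g b : R).
Hypotheses (rho0 : 0 < rho) (rho1 : rho <= 1) (HU : forall x, dist2 x0 x <= rho ^+ 2 -> U x).
Hypotheses (bE : b = p / 2 - g) (b_ge0 : 0 <= b) (b_lt : b * 2 < 1) (c1_gt0 : 0 < c1)
  (c2_ge0 : 0 <= c2) (g0 : 0 < g) (gp : g + 1 - p <= 0).
Hypothesis HE : elliptic_growth p c1 c2 E0.
Hypothesis n2 : (2 <= n)%N.

Let ss := grad_sq u.
Let bal (r : R) : set X := [set x | dist2 x0 x <= r ^+ 2].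
Definition level_mass (kap r : R) := Rn_integral (fun x => \1_(bal r) x * trunc4 kap (g - 4) (ss x)).

Variables (M qi K : R).
Hypotheses (qi0 : 0 <= qi) (nqi : n%:R * qi < 1) (K_ge1 : 1 <= K)
  (KM : K `^ (1 - p) * (M `^ (p - 1)) ^+ 2 <= 1).
Hypothesis HF : square_integral_growth f (bal rho) (M `^ (p - 1)) qi.

Let aa := 2 / n%:R - 2 * qi.
Let lc := level_const n b c1 c2 g.

Let K0 : 0 < K. Proof. exact: lt_le_trans K_ge1. Qed.
Let n0 : (0 < n)%N. Proof. exact: ltn_trans n2. Qed.
Let nR0 : 0 < n%:R :> R. Proof. by rewrite ltr0n. Qed.

Let cont_ss x : U x -> {for x, continuous ss}.
Proof. move=> Ux; exact: (C1_cont (C1_grad_sq oU su) Ux). Qed.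

Let measurable_level_mass kap r : 0 < kap -> 0 < r -> r <= rho ->
  Rn_measurable (fun x => \1_(bal r) x * trunc4 kap (g - 4) (ss x)).
Proof.
move=> k0 r0 rr.
have BU : bal r `<=` U.
  by move=> x Bx; apply: HU; rewrite (le_trans Bx)// lerXn2r// ?nnegrE ltW.
apply: (Rn_measurable_indic oU _ BU (@measurable_dist2_ball R n x0 (r ^+ 2))).
move=> x Ux; apply: (@continuous_comp _ _ _ ss (trunc4 kap (g - 4)) x (cont_ss Ux)).
exact: is_derive1_cont (is_derive_trunc4 _ _ k0).
Qed.

(** On the level set at the higher level, tau at the lower level is at least
    delta. Hence its measure is at most al = delta^-4 beta, and the integral of
    s^g over it at most K^g al. In [energy_estimate] with ell^n = 2 al, the factor
    ell^2 gains al^(2/n), while the source loses only al^(-2 qi). *)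
Lemma degiorgi_step (kap kap' r r' beta delta : R) :
  0 < r' -> r' < r -> r <= rho -> K <= kap -> 0 < delta -> delta <= 1 -> kap <= (1 - delta) * kap' ->
  0 < beta -> delta ^- 4 * beta <= 1 ->
  (level_mass kap r <= (K `^ g * beta)%:E)%E ->
  (level_mass kap' r' <= (K `^ g * ((r ^+ 2 - r' ^+ 2) ^- 2 * (96 * n%:R * lc) *
      (delta ^- 4 * beta) `^ (1 + aa)))%:E)%E.
Proof.
move=> r'0 r'r rrho Kk d0 d1 kk beta0 al1 HY.
set al := delta ^- 4 * beta in al1 *.
have d4 : 0 < delta ^- 4 by rewrite invr_gt0 exprn_gt0.
have al0 : 0 < al by rewrite mulr_gt0.
have r0 : 0 < r by exact: lt_trans r'r.
have r1 : r <= 1 by exact: le_trans rho1.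
have Bsub : bal r `<=` bal rho.
  by move=> x Bx; rewrite /bal /= (le_trans Bx)// lerXn2r// ?nnegrE ltW.
have HUr x : dist2 x0 x <= r ^+ 2 -> U x by move=> /Bsub; exact: HU.
have kap_gt0 : 0 < kap by exact: lt_le_trans Kk.
have kap'_gt : kap < kap'.
  have P0 : 0 < (1 - delta) * kap' by exact: lt_le_trans kk.
  have [k'0|k'0] := ltP 0 kap'.
    by apply: (le_lt_trans kk); rewrite gtr_pMl// gtrBl.
  by move: P0; rewrite ltNge mulr_ge0_le0// subr_ge0.
have kap'1 : 1 <= kap' by rewrite (le_trans K_ge1)// (le_trans Kk)// ltW.
pose A := level_set U u x0 r kap'.
have mA : measurable (@vect R n @^-1` A) by exact: measurable_level_set.
have AB : A `<=` bal r by move=> x [].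
have As x : A x -> [/\ U x, kap' < ss x & 0 < ss x].
  move=> [_ [Ux ks]]; split => //; apply: lt_trans ks; exact: lt_trans kap'_gt.
have mAf (h : X -> R) : cont_on [set x | U x /\ kap' < ss x] h -> Rn_measurable (fun x => \1_A x * h x).
  move=> ch; apply: (Rn_measurable_indic (open_superlevel oU su (c := kap')) ch _ mA).
  by move=> x [_].
have Kg0 : 0 < K `^ g by rewrite powR_gt0.
have cpow d : cont_on [set x | U x /\ kap' < ss x] (fun x => ss x `^ d).
  move=> x [Ux ks].
  apply: (@continuous_comp _ _ _ ss (fun y => y `^ d) x (cont_ss Ux)).
  by apply: is_derive1_cont (is_derive1_powR d _); apply: lt_trans ks; exact: lt_trans kap'_gt.
have m1 : Rn_measurable (fun x => \1_A x * ss x `^ g) by apply: mAf; exact: cpow.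
have I1 : (Rn_integral (fun x => \1_A x * ss x `^ g)%R <= (K `^ g * al)%:E)%E.
  apply: (@le_trans _ _ ((delta ^- 4)%:E * level_mass kap r)%E).
    rewrite /level_mass -Rn_integralZ_ge0; [|exact: measurable_level_mass| |exact: ltW]; last first.
      move=> x; apply: mulr_ge0; first by rewrite indicE.
      exact: trunc4_ge0.
    apply: le_Rn_integral_ge0 => //.
    - by apply: measurable_funM => //; exact: measurable_level_mass.
    - by move=> x; rewrite mulr_ge0 ?powR_ge0// indicE.
    - move=> x; have [Ax|nAx] := pselect (A x); last first.
        rewrite indicE (memNset nAx) mul0r mulr_ge0 ?(ltW d4)// mulr_ge0 ?indicE//.
        exact: trunc4_ge0.
      have [Ux ks s0] := As x Ax.
      rewrite !indicE (mem_set Ax) (mem_set (AB x Ax)) !mul1r trunc4E//.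
      have td : delta <= tau kap (ss x).
        have kd : kap <= (1 - delta) * ss x.
          by apply: (le_trans kk); rewrite ler_wpM2l ?subr_ge0// ltW.
        rewrite /tau ler_pdivlMr// pos_part_id.
          move: kd; rewrite mulrBl mul1r; lra.
        by rewrite subr_ge0 (le_trans kd)// ler_piMl ?(ltW s0)// gerBl ltW.
      rewrite mulrCA ler_peMr ?powR_ge0// mulrC ler_pdivlMr ?exprn_gt0// mul1r.
      by rewrite lerXn2r// ?nnegrE ?(ltW d0)// tau_ge0// ltW.
  apply: (le_trans (lee_wpmul2l _ HY)); first by rewrite lee_fin ltW.
  by rewrite -EFinM lee_fin /al le_eqVlt; apply/orP; left; apply/eqP; ring.
have LA : (leb (@vect R n @^-1` A) <= al%:E)%E.
  rewrite -(@lee_pmul2l _ (K `^ g)%:E)// -EFinM.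
  apply: (le_trans _ I1).
  have mi := Rn_measurable_set mA.
  have -> : ((K `^ g)%:E * leb (@vect R n @^-1` A))%E = Rn_integral (fun x => K `^ g * \1_A x).
    rewrite Rn_integralZ_ge0//; last exact: ltW.
    by rewrite Rn_integral_set.
  apply: le_Rn_integral_ge0 => //.
  - by apply: measurable_funM.
  - by move=> x; rewrite mulr_ge0// ?indicE// ltW.
  - move=> x; rewrite indicE; have [Ax|nAx] := pselect (A x); last by rewrite (memNset nAx) mulr0 mul0r.
    rewrite (mem_set Ax) mulr1 mul1r; have [Ux ks s0] := As x Ax.
    apply: (@ge0_ler_powR _ g (ltW g0)); rewrite ?nnegrE; [exact: ltW|exact: ltW|].
    exact: (le_trans Kk (ltW (lt_trans kap'_gt ks))).
have I3 : (Rn_integral (fun x => \1_A x * (f x ^+ 2 * ss x `^ (g + 1 - p)))%R <= (K `^ g * (2 * al `^ (1 - 2 * qi)))%:E)%E.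
  have mf2 : Rn_measurable (fun x => \1_A x * f x ^+ 2).
    apply: mAf => x [Ux _].
    by apply: continuousM; exact: (C1_cont (smooth_C1 [::] sf) Ux).
  apply: (@le_trans _ _ ((K `^ (g + 1 - p))%:E * Rn_integral (fun x => \1_A x * f x ^+ 2)%R)%E).
    rewrite -Rn_integralZ_ge0//; [|by move=> x; rewrite mulr_ge0 ?sqr_ge0// indicE|exact: powR_ge0].
    apply: le_Rn_integral_ge0 => //.
    - apply: mAf => x xV; apply: continuousM; last exact: cpow.
      by have [Ux _] := xV; apply: continuousM; exact: (C1_cont (smooth_C1 [::] sf) Ux).
    - by apply: measurable_funM.
    - by move=> x; rewrite mulr_ge0 ?indicE// mulr_ge0 ?sqr_ge0 ?powR_ge0.
    - move=> x; rewrite indicE; have [Ax|nAx] := pselect (A x); last by rewrite (memNset nAx) !mul0r mulr0.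
      rewrite (mem_set Ax) !mul1r; have [Ux ks s0] := As x Ax.
      rewrite mulrC ler_wpM2r ?sqr_ge0//.
      rewrite -[g + 1 - p]opprK !(powRN _ (- _)) lef_pV2 ?posrE ?powR_gt0//.
      apply: ge0_ler_powR; rewrite ?nnegrE ?oppr_ge0 ?(ltW K0) ?(ltW s0)//.
      exact: (le_trans Kk (ltW (lt_trans kap'_gt ks))).
  apply: (le_trans (lee_wpmul2l _ (HF (subset_trans AB Bsub) mA al0 LA))).
    by rewrite lee_fin powR_ge0.
  rewrite -EFinM lee_fin.
  have -> : K `^ (g + 1 - p) = K `^ g * K `^ (1 - p).
    have Kn0 : K != 0 by rewrite gt_eqF.
    by rewrite -powRD ?Kn0 ?implybT// addrA.
  have W0 : 0 <= K `^ g * (2 * al `^ (1 - 2 * qi)).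
    by rewrite mulr_ge0 ?powR_ge0// mulr_ge0// powR_ge0.
  have := ler_wpM2l W0 KM; rewrite mulr1.
  by apply: le_trans; rewrite le_eqVlt; apply/orP; left; apply/eqP; ring.
have Ibad : (Rn_integral (level_rhs U u f x0 r kap' p g) <= (K `^ g * (al + 2 * al `^ (1 - 2 * qi)))%:E)%E.
  have -> : level_rhs U u f x0 r kap' p g =
    (fun x => \1_A x * ss x `^ g + \1_A x * (f x ^+ 2 * ss x `^ (g + 1 - p))).
    by apply/funext => x; rewrite /level_rhs mulrDr.
  rewrite Rn_integralD_ge0//.
  - by rewrite mulrDr EFinD leeD.
  - apply: mAf => x xV; apply: continuousM; last exact: cpow.
    by have [Ux _] := xV; apply: continuousM; exact: (C1_cont (smooth_C1 [::] sf) Ux).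
  - by move=> x; rewrite mulr_ge0 ?powR_ge0// indicE.
  - by move=> x; rewrite mulr_ge0 ?indicE// mulr_ge0 ?sqr_ge0 ?powR_ge0.
pose ell := (2 * al) `^ n%:R^-1.
have ell0 : 0 < ell by rewrite powR_gt0// mulr_gt0.
have elln : 2 * al <= ell ^+ n.
  rewrite -powR_mulrn ?powR_ge0// /ell -powRrM mulVf ?gt_eqF// powRr1//.
  by rewrite mulr_ge0// ltW.
have EN := energy_estimate oU sE su sf pde r0 HUr kap'1 bE b_ge0 b_lt c1_gt0 c2_ge0 (ltW g0) r1 HE n0 ell0 elln LA.
have kap'0 : 0 < kap' by exact: lt_trans kap'_gt.
pose eta0 := r ^+ 2 - r' ^+ 2.
have eta00 : 0 < eta0 by rewrite subr_gt0 ltrXn2r// ?nnegrE ltW.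
have e20 : 0 < eta0 ^+ 2 by rewrite exprn_gt0.
have mG : Rn_measurable (level_fun u x0 r kap' g).
  by apply: continuous_Rn_measurable => x; exact: (C1_cont (C1_level_fun oU su HUr kap'1 g) (I : setT x)).
have Ple : (level_mass kap' r' <= (eta0 ^- 2)%:E * Rn_integral (level_fun u x0 r kap' g))%E.
  rewrite -Rn_integralZ_ge0//; [|by move=> x; exact: level_fun_ge0|by rewrite invr_ge0 ltW].
  apply: le_Rn_integral_ge0 => //.
  - apply: measurable_level_mass => //; exact: le_trans (ltW r'r) rrho.
  - by apply: measurable_funM.
  - move=> x; apply: mulr_ge0; first by rewrite indicE.
    exact: trunc4_ge0.
  - move=> x; rewrite ler_pdivlMl// /level_fun indicE.
    have tr0 : 0 <= trunc4 kap' (g - 4) (ss x) by exact: trunc4_ge0.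
    have [Bx|nBx] := pselect (bal r' x); last first.
      by rewrite (memNset nBx) mul0r mulr0 mulr_ge0 ?sqr_ge0.
    rewrite (mem_set Bx) mul1r ler_wpM2r// lerXn2r// ?nnegrE ?cutoff_ge0 ?(ltW eta00)//.
    have H : eta0 <= r ^+ 2 - dist2 x0 x by rewrite lerB.
    by rewrite /cutoff pos_part_id// (le_trans _ H)// ltW.
have lc0 : 0 <= lc by exact: (level_const_ge0 n c2 g b_lt c1_gt0).
apply: (le_trans Ple).
have C0 : 0 <= 16 * n%:R * lc * ell ^+ 2.
  by rewrite mulr_ge0 ?sqr_ge0// mulr_ge0.
apply: (le_trans (lee_wpmul2l _ (le_trans EN (lee_wpmul2l _ Ibad)))).
- by rewrite lee_fin invr_ge0 ltW.
- by rewrite lee_fin.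
rewrite -!EFinM lee_fin.
have al2 : al <= al `^ (1 - 2 * qi).
  have q1 : 1 - 2 * qi <= 1 by rewrite gerBl mulr_ge0.
  by rewrite -[leLHS](powRr1 (ltW al0)); apply: ger_powR => //; rewrite al0.
have ell2 : ell ^+ 2 <= 2 * al `^ (2 / n%:R).
  have nn1 : 2 / n%:R <= 1 :> R by rewrite ler_pdivrMr// mul1r (ler_nat R 2).
  rewrite /ell -powR_mulrn ?powR_ge0// -powRrM [n%:R^-1 * _]mulrC powRM ?(ltW al0)//.
  rewrite ler_wpM2r ?powR_ge0// -[leRHS](powRr1 (ler0n R 2)).
  by apply: ler_powR => //; rewrite (ler_nat R 1).
have alE : al `^ (2 / n%:R) * al `^ (1 - 2 * qi) = al `^ (1 + aa).
  rewrite -powRD; last by rewrite (gt_eqF al0) implybT.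
  by congr (_ `^ _); rewrite /aa; ring.
rewrite -alE.
set P1 := al `^ (2 / n%:R) in ell2 *; set P2 := al `^ (1 - 2 * qi) in al2 *.
have P20 : 0 <= P2 by exact: powR_ge0.
have P10 : 0 <= P1 by exact: powR_ge0.
have F1 : ell ^+ 2 * (al + 2 * P2) <= 2 * P1 * (3 * P2).
  by apply: ler_pM => //; [exact: sqr_ge0|rewrite addr_ge0 ?mulr_ge0// ltW|lra].
have W0 : 0 <= eta0 ^- 2 * (16 * n%:R * lc) * K `^ g.
  by rewrite mulr_ge0 ?powR_ge0// mulr_ge0 ?invr_ge0 ?(ltW e20)// mulr_ge0.
have := ler_wpM2l W0 F1; rewrite -/eta0.
have -> : eta0 ^- 2 * (16 * n%:R * lc * ell ^+ 2 * (K `^ g * (al + 2 * P2))) =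
  eta0 ^- 2 * (16 * n%:R * lc) * K `^ g * (ell ^+ 2 * (al + 2 * P2)) by ring.
move=> F2; apply: (le_trans F2); rewrite le_eqVlt; apply/orP; left; apply/eqP; ring.
Qed.
Let aa_gt0 : 0 < aa.
Proof. by case: (dg_exponent_bounds n2 qi0 nqi). Qed.

Let aa_le1 : aa <= 1.
Proof. by case: (dg_exponent_bounds n2 qi0 nqi). Qed.

Definition dg_const : R := 4 ^+ 10 * (96 * n%:R * lc + 1).
Let D := rho ^- 4 * dg_const.

Let lc0 : 0 <= lc. Proof. exact: (level_const_ge0 n c2 g b_lt c1_gt0). Qed.
Let N0 : 0 <= 96 * n%:R * lc. Proof. by rewrite mulr_ge0// mulr_ge0. Qed.

Let D_ge1 : 1 <= D.
Proof.
apply: mulr_ege1; first by rewrite invf_ge1 ?exprn_gt0// exprn_ile1// ltW.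
apply: mulr_ege1; last by rewrite lerDr.
by apply: exprn_ege1; rewrite (ler_nat R 1).
Qed.

Let bt j := dg_seq D aa j.
Let h j : R := 2^-1 ^+ j.

Lemma degiorgi_iteration : (level_mass K rho <= (K `^ g * bt 0)%:E)%E ->
  forall j, (level_mass (K * (2 - h j)) (rho * ((1 + h j) / 2)) <= (K `^ g * bt j)%:E)%E.
Proof.
move=> H0; elim=> [|j IH].
  have -> : K * (2 - h 0) = K by rewrite [h 0]expr0; ring.
  have -> : rho * ((1 + h 0) / 2) = rho by rewrite [h 0]expr0; field.
  exact: H0.
have hj0 : 0 < h j by rewrite exprn_gt0.
have hj1 : h j <= 1 by rewrite exprn_ile1// invf_le1// (ler_nat R 1).
have hS : h j.+1 = h j / 2 by rewrite /h exprSr.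
have b0 : 0 < bt j by exact: dg_seq_gt0.
have -> : K * (2 - h j.+1) = K * (2 - h j / 2) by rewrite hS.
have -> : rho * ((1 + h j.+1) / 2) = rho * ((1 + h j / 2) / 2) by rewrite hS.
apply: (le_trans (degiorgi_step (beta := bt j) (delta := h j / 4) _ _ _ _ _ _ _ _ _ IH)).
- by rewrite mulr_gt0// divr_gt0// addr_gt0// divr_gt0.
- by rewrite ltr_pM2l// ltr_pM2r// ltrD2l ltr_pdivrMr// ltr_pMr// (ltr_nat R 1).
- by rewrite ler_piMr ?(ltW rho0)// ler_pdivrMr// mul1r; lra.
- by rewrite ler_peMr ?(ltW K0)//; lra.
- by rewrite divr_gt0.
- lra.
- rewrite mulrCA ler_wpM2l ?(ltW K0)//.
  rewrite -subr_ge0 (_ : _ - _ = (h j) ^+ 2 / 8); first by rewrite divr_ge0// sqr_ge0.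
  by field.
- exact: b0.
- rewrite (_ : (h j / 4) ^- 4 = 4 ^+ 4 * (4 ^+ 2) ^+ j); first exact: dg_seq_small.
  have -> : (4 ^+ 2) ^+ j = h j ^- 4 :> R.
    have -> : 4 = 2 ^+ 2 :> R by ring.
    by rewrite /h -exprVn -exprVn invrK -!exprM [(j * 4)%N]mulnC ?mulnA.
  by field; rewrite gt_eqF.
- rewrite lee_fin ler_wpM2l ?powR_ge0// /bt -(dg_seqS D_ge1 aa_gt0).
  exact: (dg_step_const j rho0 rho1 N0 aa_gt0 aa_le1 b0).
Qed.

(** Otherwise the gradient would exceed the final level on a small box inside
    all the balls, and every [level_mass] would be bounded below by a fixed
    positive number, although these masses tend to zero. *)
Lemma degiorgi_center : (level_mass K rho <= (K `^ g * bt 0)%:E)%E -> ss x0 <= 2 * K.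
Proof.
move=> /degiorgi_iteration H; rewrite leNgt; apply/negP => Ks.
have s00 : dist2 x0 x0 = 0.
  by rewrite dist2E big1// => j _; rewrite subrr mulr0.
have Ux0 : U x0 by apply: HU; rewrite s00 sqr_ge0.
have k20 : 0 < 2 * K by rewrite mulr_gt0.
pose P x := trunc4 (2 * K) (g - 4) (ss x).
have P0 : 0 < P x0.
  apply: mulr_gt0; last exact: powR_gt0 (lt_trans k20 Ks).
  by apply: exprn_gt0; rewrite pos_part_id ?subr_gt0// subr_ge0 ltW.
have cP : {for x0, continuous P}.
  apply: (@continuous_comp _ _ _ ss (trunc4 (2 * K) (g - 4)) x0 (cont_ss Ux0)).
  exact: is_derive1_cont (is_derive_trunc4 _ _ k20).
have csq : {for x0, continuous (dist2 x0)} by exact: (C1_cont (@C1_dist2 R n x0) (I : setT x0)).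
have r2 : 0 < (rho / 2) ^+ 2 by rewrite exprn_gt0// divr_gt0.
have : nbhs x0 [set x | P x0 / 2 < P x /\ dist2 x0 x < (rho / 2) ^+ 2].
  apply: (@filterI _ _ (nbhs_filter x0)).
    by apply: (cP [set y | P x0 / 2 < y]); apply: lt_nbhsr; rewrite ltr_pdivrMr// ltr_pMr// (ltr_nat R 1).
  apply: (csq [set y | y < (rho / 2) ^+ 2]); apply: lt_nbhsl; by rewrite s00.
move=> /nbhs_ballP[e /= e0 He].
have e20 : 0 < e / 2 by rewrite divr_gt0.
have HK x : box x0 (e / 2) x -> P x0 / 2 < P x /\ dist2 x0 x < (rho / 2) ^+ 2.
  move=> Kx; apply: He; split => // i j; rewrite ord1 -ball_normE /= distrC.
  have := Kx j; rewrite /= in_itv/= -ler_distl => Hj; apply: (le_lt_trans Hj).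
  by rewrite ltr_pdivrMr// ltr_pMr// (ltr_nat R 1).
suff : P x0 / 2 * (e / 2 + e / 2) ^+ n <= 0.
  by rewrite leNgt mulr_gt0// ?divr_gt0// exprn_gt0// addr_gt0.
apply: (dg_seq_lim (D := D) (aa := aa) aa_gt0 aa_le1 (k := K `^ g)) => j.
rewrite -lee_fin; apply: le_trans (H j).
have hj0 : 0 < h j by rewrite exprn_gt0.
have hj1 : h j <= 1 by rewrite exprn_ile1// invf_le1// (ler_nat R 1).
have mK : measurable (@vect R n @^-1` (box x0 (e / 2))) by rewrite box_cube; exact: measurable_cube.
have mi := Rn_measurable_set mK.
have -> : (P x0 / 2 * (e / 2 + e / 2) ^+ n)%:E = Rn_integral (fun x => P x0 / 2 * \1_(box x0 (e / 2)) x).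
  rewrite Rn_integralZ_ge0//; last by rewrite divr_ge0// ltW.
  rewrite EFinM (Rn_integral_set mK); congr (_ * _)%E.
  by rewrite -(leb_cube (fun i => x0 0 i - e / 2) (addr_gt0 e20 e20)) -box_cube.
apply: le_Rn_integral_ge0 => //.
- by apply: measurable_funM.
- apply: measurable_level_mass.
  + by rewrite mulr_gt0//; lra.
  + by rewrite mulr_gt0// divr_gt0// addr_gt0.
  + by rewrite ler_piMr ?(ltW rho0)// ler_pdivrMr// mul1r; lra.
- by move=> x; rewrite mulr_ge0 ?indicE// divr_ge0// ltW.
move=> x; rewrite indicE; have [Kx|nKx] := pselect (box x0 (e / 2) x); last first.
  rewrite (memNset nKx) mulr0; apply: mulr_ge0; last exact: trunc4_ge0.
  by rewrite indicE ler0n.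
have [HP Hs] := HK x Kx.
have Bx : bal (rho * ((1 + h j) / 2)) x.
  have rr : rho / 2 <= rho * ((1 + h j) / 2).
    by rewrite ler_pM2l// -[X in X <= _]mul1r ler_pM2r// lerDl ltW.
  have r20 : 0 <= rho / 2 by rewrite divr_ge0// ltW.
  apply: (le_trans (ltW Hs)); apply: lerXn2r => //; rewrite nnegrE//.
  exact: le_trans rr.
rewrite (mem_set Kx) mulr1 indicE (mem_set Bx) mul1r; apply: (le_trans (ltW HP)).
apply: ler_wpM2r; first exact: powR_ge0.
apply: lerXn2r; rewrite ?nnegrE ?pos_part_ge0//.
rewrite /pos_part ge_max !le_max lexx /=; apply/orP; right.
by apply: lerB => //; rewrite [2 * K]mulrC; apply: ler_wpM2l; [exact: ltW|rewrite gerBl ltW].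
Qed.
End DeGiorgi.

(** The level is K = M^2 Lambda. The factor M^2 neutralizes the source, since
    K^(1-p) M^(2(p-1)) <= 1. The factor Lambda = beta_0^(-2/p) makes the initial
    mass small enough for the iteration, because s > K forces
    s^g <= K^(g - p/2) s^(p/2). *)
Lemma interior_gradient_bound (R : realType) (n : nat) (U : set 'rV[R]_n) (E0 u f : 'rV[R]_n -> R)
  (oU : open U) (sE : smooth_on setT E0) (su : smooth_on U u) (sf : smooth_on U f)
  (pde : forall x, U x -> - divergence (fun y => gradient E0 (gradient u y)) x = f x)
  (x0 : 'rV[R]_n) (rho p c1 c2 g b : R)
  (rho0 : 0 < rho) (rho1 : rho <= 1) (HU : forall x, dist2 x0 x <= rho ^+ 2 -> U x)
  (p1 : 1 < p) (bE : b = p / 2 - g) (b_ge0 : 0 <= b) (b_lt : b * 2 < 1) (c1_gt0 : 0 < c1)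
  (c2_ge0 : 0 <= c2) (g0 : 0 < g) (gp : g + 1 - p <= 0)
  (HE : elliptic_growth p c1 c2 E0)
  (n2 : (2 <= n)%N) (M qi : R) (M1 : 1 <= M) (qi0 : 0 <= qi) (nqi : n%:R * qi < 1)
  (HF : square_integral_growth f [set x | dist2 x0 x <= rho ^+ 2] (M `^ (p - 1)) qi)
  (HN : (Rn_integral (fun x => \1_[set x | dist2 x0 x <= rho ^+ 2] x * grad_sq u x `^ (p / 2))%R
           <= (M `^ p)%:E)%E)
  (aa : R) (aaE : aa = 2 / n%:R - 2 * qi) :
  enorm (gradient u x0) <= 2 * M * (dg_const n c1 c2 g b / dg_ratio aa) `^ (aa * p)^-1
     * rho `^ (- (4 / (aa * p))).
Proof.
have [aa0 aa1] : 0 < aa /\ aa <= 1 by rewrite aaE; exact: dg_exponent_bounds.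
have p0 : 0 < p by rewrite (lt_trans _ p1).
have M0 : 0 < M by rewrite (lt_le_trans _ M1).
set Dc := dg_const n c1 c2 g b.
have Dc1 : 1 <= Dc.
  apply: mulr_ege1; last first.
    by rewrite lerDr mulr_ge0 ?mulr_ge0//; exact: level_const_ge0.
  by apply: exprn_ege1; rewrite (ler_nat R 1).
have Dc0 : 0 < Dc by rewrite (lt_le_trans _ Dc1).
set D := rho ^- 4 * Dc.
have r4 : 0 < rho ^- 4 by rewrite invr_gt0 exprn_gt0.
have D1 : 1 <= D.
  by apply: mulr_ege1 => //; rewrite invf_ge1 ?exprn_gt0// exprn_ile1// ltW.
set b0 := dg_seq D aa 0.
have b00 : 0 < b0 by exact: dg_seq_gt0.
have b01 : b0 <= 1.
  apply: (le_trans (dg_seq0_le D1 aa0 aa1)); rewrite invf_le1 ?exprn_gt0//.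
  by apply: exprn_ege1; rewrite (ler_nat R 1).
set La := b0 `^ (- (2 / p)).
have La1 : 1 <= La.
  rewrite /La powRN invf_ge1 ?powR_gt0// -[leRHS](powRr0 b0); apply: ger_powR; first by rewrite b00.
  by rewrite divr_ge0// ltW.
have La0 : 0 < La by rewrite (lt_le_trans _ La1).
set K := M ^+ 2 * La.
have K_ge1 : 1 <= K by apply: mulr_ege1 => //; exact: exprn_ege1.
have K0 : 0 < K by rewrite (lt_le_trans _ K_ge1).
have powM a : (M ^+ 2) `^ a = (M `^ a) ^+ 2.
  rewrite -(powR_mulrn 2 (ltW M0)) -(powR_mulrn 2 (powR_ge0 M a)) powRAC //.
have KM : K `^ (1 - p) * (M `^ (p - 1)) ^+ 2 <= 1.
  have -> : K `^ (1 - p) = (M `^ (p - 1)) ^- 2 * La `^ (1 - p).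
    rewrite /K powRM ?sqr_ge0 ?(ltW La0)// powM; congr (_ * _).
    by rewrite -[1 - p]opprB powRN exprVn.
  rewrite mulrAC mulVf ?mul1r; last by rewrite gt_eqF// exprn_gt0// powR_gt0.
  by rewrite -[leRHS](powRr0 La); apply: ler_powR => //; rewrite subr_le0 ltW.
have KP : K `^ (g - p / 2) * M `^ p = K `^ g * b0.
  have sK : K != 0 by rewrite gt_eqF.
  rewrite powRD ?sK ?implybT// -mulrA; congr (_ * _).
  rewrite powRN /K powRM ?sqr_ge0 ?(ltW La0)// powM.
  have -> : (M `^ (p / 2)) ^+ 2 = M `^ p.
    by rewrite -powR_mulrn ?powR_ge0// -powRrM divfK.
  have -> : La `^ (p / 2) = b0^-1.
    rewrite /La -powRrM (_ : - (2 / p) * (p / 2) = - 1); last by field; rewrite gt_eqF.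
    by rewrite powRN powRr1// ltW.
  field; rewrite !gt_eqF ?powR_gt0//.
have m1 : Rn_measurable (fun x => \1_[set x | dist2 x0 x <= rho ^+ 2] x * grad_sq u x `^ (p / 2)).
  apply: Rn_measurable_indic_powR; first by rewrite divr_gt0.
  apply: (Rn_measurable_indic oU _ HU (@measurable_dist2_ball R n x0 (rho ^+ 2))) => x Ux.
  exact: (C1_cont (C1_grad_sq oU su) Ux).
have HY : (level_mass u x0 g K rho <= (K `^ g * b0)%:E)%E.
  rewrite -KP EFinM; apply: le_trans (lee_wpmul2l _ HN); last by rewrite lee_fin powR_ge0.
  rewrite -(Rn_integralZ_ge0 m1); [|by move=> x; apply: mulr_ge0; [rewrite indicE|exact: powR_ge0]|exact: powR_ge0].
  have ss0 x : 0 <= grad_sq u x by apply: sumr_ge0 => k _; exact: sqr_ge0.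
  apply: le_Rn_integral_ge0 => //.
  - apply: (Rn_measurable_indic oU _ HU (@measurable_dist2_ball R n x0 (rho ^+ 2))).
    move=> x Ux; apply: (@continuous_comp _ _ _ (grad_sq u) (trunc4 K (g - 4)) x (C1_cont (C1_grad_sq oU su) Ux)).
    exact: is_derive1_cont (is_derive_trunc4 _ _ K0).
  - by apply: measurable_funM.
  - move=> x; apply: mulr_ge0; first by rewrite indicE.
    exact: trunc4_ge0.
  - move=> x; rewrite [leRHS]mulrCA; apply: ler_wpM2l; first by rewrite indicE.
    have [sK|Ks] := leP (grad_sq u x) K.
      rewrite /trunc4 pos_part_le0 ?subr_le0// expr0n mul0r; apply: mulr_ge0; exact: powR_ge0.
    have s0 : 0 < grad_sq u x by exact: lt_trans Ks.
    rewrite trunc4E//; apply: (@le_trans _ _ (grad_sq u x `^ g)).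
      rewrite ler_piMr ?powR_ge0// exprn_ile1 ?tau_ge0 ?tau_le1 ?(ltW K0) ?(ltW s0)//.
    have sn0 : grad_sq u x != 0 by rewrite gt_eqF.
    have -> : grad_sq u x `^ g = grad_sq u x `^ (- b) * grad_sq u x `^ (p / 2).
      by rewrite -powRD ?sn0 ?implybT//; congr (_ `^ _); rewrite bE; ring.
    have -> : g - p / 2 = - b by rewrite bE; ring.
    apply: ler_wpM2r; first exact: powR_ge0.
    rewrite !(powRN _ b) lef_pV2 ?posrE ?powR_gt0//.
    by apply: ge0_ler_powR; rewrite ?nnegrE ?(ltW K0) ?(ltW s0) ?(ltW Ks).
have HC : grad_sq u x0 <= 2 * K.
  apply: (degiorgi_center oU sE su sf pde rho0 rho1 HU bE b_ge0 b_lt c1_gt0 c2_ge0 g0 gp HE n2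
    qi0 nqi K_ge1 KM HF).
  by rewrite -aaE.
set W := (Dc / dg_ratio aa) `^ (aa * p)^-1; set V := rho `^ _.
have W0 : 0 <= W by exact: powR_ge0.
have V0 : 0 <= V by exact: powR_ge0.
have q0 := @dg_ratio_gt0 R aa.
have LaE : La = (W * V) ^+ 2.
  have pn : p != 0 by rewrite gt_eqF.
  have an : aa != 0 by rewrite gt_eqF.
  rewrite /La /b0 /dg_seq expr0 mulr1 /D.
  rewrite -powRrM mulrN powRN.
  have -> : dg_ratio aa / (rho ^- 4 * Dc) = (Dc / dg_ratio aa * rho ^- 4)^-1.
    by field; rewrite !gt_eqF// exprn_gt0.
  have P0 : 0 <= Dc / dg_ratio aa by rewrite divr_ge0// ltW.
  have P1 : 0 <= Dc / dg_ratio aa * rho ^- 4 by rewrite mulr_ge0// ltW.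
  have pinv x e : 0 <= x -> x^-1 `^ e = (x `^ e)^-1 :> R.
    by move=> x0'; rewrite -(powR_inv1 x0') -powRrM mulN1r powRN.
  have rE : rho ^- 4 = rho `^ (- 4) by rewrite powRN (powR_mulrn 4 (ltW rho0)).
  rewrite (pinv _ _ P1) invrK powRM ?(ltW r4)// exprMn /W /V rE.
  rewrite -powRrM.
  have sqP x e : (x `^ e) ^+ 2 = x `^ (e * 2) :> R.
    by rewrite -powR_mulrn ?powR_ge0// -powRrM.
  rewrite !sqP; congr (_ `^ _ * _).
    by field; rewrite an pn.
  congr (_ `^ _).
  by field; rewrite an pn.
have WV : 0 <= 2 * M * W * V by rewrite !mulr_ge0// ltW.
rewrite /enorm -(ler_pXn2r (n := 2)) ?nnegrE ?sqrtr_ge0// sqr_sqrtr ?dot_ge0//.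
have -> : dot (gradient u x0) (gradient u x0) = grad_sq u x0.
  by apply: eq_bigr => k _; rewrite mxE.
apply: (le_trans HC); rewrite /K LaE.
have -> : (2 * M * W * V) ^+ 2 = 4 * (M ^+ 2 * (W * V) ^+ 2) by ring.
apply: ler_wpM2r; first by rewrite mulr_ge0 ?sqr_ge0.
by rewrite (ler_nat R 2 4).
Qed.

(** * Lebesgue norms *)

Section LebesgueNorms.
Context (R : realType) (n : nat).
Local Notation X := 'rV[R]_n.
Implicit Types (A B : set X) (h f : X -> R).

Lemma Lnorm_on_powR (s F : R) B h : 0 < s -> Lnorm_on s%:E B h = F%:E ->
  Rn_integral (fun x => \1_B x * `|h x| `^ s) = (F `^ s)%:E.
Proof.
move=> s0 HF.
have s0' : s != 0 by rewrite gt_eqF.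
have := powR_Lnorm (lebesgue_Rn R n) (fun t => ((h \_ B) (\row_(i < n) tnth t i))%:E) s0'.
rewrite -/(Lnorm_on s%:E B h) HF => E.
rewrite /Rn_integral -(_ : (F%:E `^ s = (F `^ s)%:E)%E)// E.
apply: eq_integral => t _.
rewrite /= /patch indicE -/(vect t); case: ifPn => _; rewrite ?mul1r//.
by rewrite mul0r normr0 powR0.
Qed.

(** Hoelder's inequality at the cost of a factor 2: integrate
    f^2 <= la^2 ((|f| / la)^s + 1) over A, where la = F' al^(-1/s) balances the
    two terms. *)
Lemma square_bound_powR (s F F' al : R) A B f : 2 <= s -> 0 <= F -> F <= F' -> 0 < F' -> 0 < al ->
  A `<=` B -> measurable (@vect R n @^-1` A) -> Rn_measurable (fun x => \1_A x * f x) ->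
  Rn_measurable (fun x => \1_B x * f x) ->
  (leb (@vect R n @^-1` A) <= al%:E)%E ->
  Rn_integral (fun x => \1_B x * `|f x| `^ s) = (F `^ s)%:E ->
  (Rn_integral (fun x => \1_A x * f x ^+ 2)%R <= (2 * F' ^+ 2 * al `^ (1 - 2 * s^-1))%:E)%E.
Proof.
move=> s2 F0 FF' F'0 al0 AB mA mAf mBf lA IB.
have s0 : 0 < s by rewrite (lt_le_trans _ s2).
have sn : s != 0 by rewrite gt_eqF.
pose la := F' * al `^ (- s^-1).
have la0 : 0 < la by rewrite mulr_gt0// powR_gt0.
have mi := Rn_measurable_set mA.
have IA := Rn_integral_set mA.
have mp C : Rn_measurable (fun x => \1_C x * f x) -> Rn_measurable (fun x => \1_C x * `|f x| `^ s).
  move=> mC; have := measurableT_comp (measurable_powR s) (measurableT_comp (@normr_measurable R setT) mC).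
  apply: eq_measurable_fun => t _ /=; rewrite indicE; case: (_ \in _).
    by rewrite !mul1r.
  by rewrite !mul0r normr0 powR0.
have pt y : y ^+ 2 <= la ^+ 2 * la `^ (- s) * `|y| `^ s + la ^+ 2.
  pose z := `|y| / la.
  have z0 : 0 <= z by rewrite divr_ge0// ltW.
  have -> : y ^+ 2 = la ^+ 2 * z ^+ 2.
    by rewrite -exprMn /z mulrC divfK ?gt_eqF// real_normK ?num_real.
  have -> : la ^+ 2 * la `^ (- s) * `|y| `^ s + la ^+ 2 = la ^+ 2 * (z `^ s + 1).
    rewrite /z [(`|y| / la) `^ s]powRM ?invr_ge0 ?(ltW la0)//.
    have -> : la^-1 `^ s = la `^ (- s).
      by rewrite -(powR_inv1 (ltW la0)) -powRrM mulN1r.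
    ring.
  rewrite ler_wpM2l ?sqr_ge0//; have [z1|z1] := leP z 1.
    by rewrite (le_trans (exprn_ile1 _ z0 z1))// lerDr powR_ge0.
  rewrite -powR_mulrn// (@le_trans _ _ (z `^ s)) ?lerDl//.
  by apply: ler_powR => //; exact: ltW.
have c0 : 0 <= la ^+ 2 * la `^ (- s) by rewrite mulr_ge0 ?sqr_ge0 ?powR_ge0.
apply: (@le_trans _ _ (Rn_integral (fun x => la ^+ 2 * la `^ (- s) * (\1_B x * `|f x| `^ s) + la ^+ 2 * \1_A x))).
  apply: le_Rn_integral_ge0.
  - have := measurable_funM mAf mAf; apply: eq_measurable_fun => t _ /=.
    by rewrite indicE; case: (_ \in _); rewrite ?mul1r ?mul0r ?expr2.
  - by apply: measurable_funD; apply: measurable_funM => //; exact: mp.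
  - by move=> x; rewrite mulr_ge0 ?sqr_ge0// indicE.
  - move=> x; rewrite !indicE; have [Ax|nAx] := pselect (A x).
      by rewrite (mem_set Ax) (mem_set (AB x Ax)) !mul1r mulr1.
    by rewrite (memNset nAx) mul0r mulr0 addr0 mulr_ge0// mulr_ge0 ?powR_ge0.
have B0 x : 0 <= \1_B x * `|f x| `^ s by rewrite mulr_ge0 ?powR_ge0// indicE.
rewrite Rn_integralD_ge0.
- rewrite (Rn_integralZ_ge0 (mp B mBf) B0 c0) (Rn_integralZ_ge0 mi) ?sqr_ge0// IB IA.
  apply: (@le_trans _ _ ((la ^+ 2 * la `^ (- s) * F `^ s)%:E + (la ^+ 2)%:E * al%:E)%E).
    by rewrite EFinM leeD2l// lee_wpmul2l// lee_fin sqr_ge0.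
  rewrite -EFinM -EFinD lee_fin.
  have E1 : la `^ (- s) = F' `^ (- s) * al.
    by rewrite /la powRM ?powR_ge0 ?(ltW F'0)// -powRrM mulrNN mulVf// powRr1// ltW.
  have E2 : la ^+ 2 * al = F' ^+ 2 * al `^ (1 - 2 * s^-1).
    rewrite /la exprMn -mulrA; congr (_ * _).
    rewrite -(powR_mulrn 2 (powR_ge0 _ _)) -powRrM -[X in _ * X](powRr1 (ltW al0)) -powRD.
      by congr (_ `^ _); ring.
    by rewrite (gt_eqF al0) implybT.
  have E3 : F' `^ (- s) * F `^ s <= 1.
    rewrite powRN mulrC ler_pdivrMr ?powR_gt0// mul1r.
    by apply: ge0_ler_powR; rewrite ?nnegrE// ?(ltW s0)// ltW.
  rewrite E1 (_ : la ^+ 2 * (F' `^ (- s) * al) * F `^ s = la ^+ 2 * al * (F' `^ (- s) * F `^ s)); last by ring.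
  rewrite E2 (_ : 2 * _ * _ = F' ^+ 2 * al `^ (1 - 2 / s) + F' ^+ 2 * al `^ (1 - 2 / s)); last by ring.
  rewrite lerD2r ler_piMr//.
  by rewrite mulr_ge0 ?sqr_ge0 ?powR_ge0.
- by apply: measurable_funM => //; exact: mp.
- by apply: measurable_funM.
- by move=> x; rewrite mulr_ge0.
- by move=> x; rewrite mulr_ge0 ?sqr_ge0// indicE.
Qed.

Lemma leb_setT_gt0 : (0 < @leb R n setT)%E.
Proof.
apply: (@lt_le_trans _ _ (leb (@cube R n (fun=> 0) 1))).
  by rewrite leb_cube// expr1n.
by apply: le_measure; rewrite ?inE//; exact: measurable_cube.
Qed.

Lemma square_bound_sup (F al : R) A B f : 0 <= F -> A `<=` B -> 
  measurable (@vect R n @^-1` A) -> Rn_measurable (fun x => \1_A x * f x) ->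
  (leb (@vect R n @^-1` A) <= al%:E)%E -> Lnorm_on +oo%E B f = F%:E ->
  (Rn_integral (fun x => \1_A x * f x ^+ 2)%R <= (F ^+ 2 * al)%:E)%E.
Proof.
move=> F0 AB mA mf lA HF.
have mi := Rn_measurable_set mA.
have IA := Rn_integral_set mA.
apply: (@le_trans _ _ (Rn_integral (fun x => F ^+ 2 * \1_A x))); last first.
  by rewrite Rn_integralZ_ge0 ?sqr_ge0// IA [leRHS]EFinM lee_wpmul2l// lee_fin sqr_ge0.
have ae : \forall t \ae @leb R n, (`|((f \_ B) (vect t))%:E| <= F%:E)%E.
  have H := ess_sup_ge (lebesgue_Rn R n)
    (abse \o (fun t => ((f \_ B) (\row_(i < n) tnth t i))%:E)).
  move: HF; rewrite /Lnorm_on unlock ifT; last exact: leb_setT_gt0.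
  by move=> HF; rewrite HF in H.
apply: ae_ge0_le_integral => //.
- by move=> t _; rewrite lee_fin mulr_ge0 ?sqr_ge0// indicE.
- apply/measurable_EFinP.
  have := measurable_funM mf mf; apply: eq_measurable_fun => t _ /=.
  by rewrite indicE; case: (_ \in _); rewrite ?mul1r ?mul0r ?expr2.
- by move=> t _; rewrite lee_fin mulr_ge0 ?sqr_ge0// indicE.
- by apply/measurable_EFinP; apply: measurable_funM.
apply: filterS ae => t Ht _; rewrite lee_fin indicE.
have [At|nAt] := pselect (A (vect t)); last by rewrite (memNset nAt) mul0r mulr0.
rewrite (mem_set At) mul1r mulr1; move: Ht.
rewrite /patch (mem_set (AB _ At)) /= lee_fin => Ht.
by rewrite -[f _ ^+ 2]real_normK ?num_real// lerXn2r ?nnegrE.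
Qed.

End LebesgueNorms.

(** * The gradient bound *)

Lemma enorm_triangle (R : realType) (n : nat) (x y : 'rV[R]_n) : enorm (x + y) <= enorm x + enorm y.
Proof.
rewrite -(ler_pXn2r (n := 2)) ?nnegrE ?addr_ge0 ?enorm_ge0//.
rewrite enorm2 dotDl !dotDr (dotC y x) sqrrD !enorm2.
have := le_trans (ler_norm _) (cauchy_schwarz x y).
rewrite mulr2n; lra.
Qed.

Lemma eball_dist2 (R : realType) (n : nat) (x : 'rV[R]_n) (r : R) : 0 <= r ->
  eball x r = [set y | dist2 x y <= r ^+ 2].
Proof.
move=> r0; apply/seteqP; split => y; rewrite /eball /dist2 /=.
  by move=> H; rewrite -enorm2 lerXn2r// nnegrE// enorm_ge0.
by move=> H; rewrite -(ler_pXn2r (n := 2)) ?nnegrE ?enorm_ge0// enorm2.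
Qed.

Lemma eball_sub (R : realType) (n : nat) (x y : 'rV[R]_n) (a b : R) : eball x a y ->
  eball y b `<=` eball x (a + b).
Proof.
rewrite /eball /= => H z /= Hz.
rewrite (_ : z - x = (y - x) + (z - y)); last by rewrite [RHS]addrC addrA subrK.
by apply: (le_trans (enorm_triangle _ _)); exact: lerD.
Qed.

Lemma powR_comparable (R : realType) (t y e : R) : 0 < t -> t <= y -> y <= 2 * t ->
  (2 `^ `|e|)^-1 * t `^ e <= y `^ e /\ y `^ e <= 2 `^ `|e| * t `^ e.
Proof.
move=> t0 ty yt.
have k1 : 1 <= y / t by rewrite ler_pdivlMr// mul1r.
have k2 : y / t <= 2 by rewrite ler_pdivrMr.
have k0 : 0 <= y / t by rewrite (le_trans _ k1).
have -> : y `^ e = (y / t) `^ e * t `^ e.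
  by rewrite -powRM ?(ltW t0)// divfK// gt_eqF.
have K : (y / t) `^ `|e| <= 2 `^ `|e| by apply: ge0_ler_powR; rewrite ?nnegrE.
split; apply: ler_wpM2r; try exact: powR_ge0.
  apply: (@le_trans _ _ ((y / t) `^ (- `|e|))).
    by rewrite powRN lef_pV2 ?posrE ?powR_gt0// (lt_le_trans _ k1).
  by apply: ler_powR => //; rewrite lerNl -normrN ler_norm.
by apply: le_trans K; apply: ler_powR => //; exact: ler_norm.
Qed.

Definition inv_exponent (R : realType) (q : \bar R) : R := if q is s%:E then s^-1 else 0.

Lemma inv_exponent_lt (R : realType) (n : nat) (q : \bar R) : (0 < n)%N -> (n%:R%:E < q)%E ->
  0 <= inv_exponent q /\ n%:R * inv_exponent q < 1.
Proof.
move=> n0; case: q => [s|_|]; [|by rewrite /= mulr0 lexx ltr01|by rewrite ltNge leNye].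
rewrite lte_fin /= => ns; have s0 : 0 < s by rewrite (le_lt_trans _ ns).
by rewrite invr_ge0 (ltW s0) ltr_pdivrMr// mul1r.
Qed.

(** The number M = 1 + F^(1/(p-1)) + N dominates the gradient norm, and M^(p-1)
    dominates the norm of the source. *)
Lemma gradient_bound_Lnorm (R : realType) (n : nat) (U : set 'rV[R]_n) (E0 u f : 'rV[R]_n -> R)
  (oU : open U) (sE : smooth_on setT E0) (su : smooth_on U u) (sf : smooth_on U f)
  (pde : forall x, U x -> - divergence (fun y => gradient E0 (gradient u y)) x = f x)
  (p c1 c2 g b : R)
  (p1 : 1 < p) (bE : b = p / 2 - g) (b_ge0 : 0 <= b) (b_lt : b * 2 < 1) (c1_gt0 : 0 < c1)
  (c2_ge0 : 0 <= c2) (g0 : 0 < g) (gp : g + 1 - p <= 0)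
  (HE : elliptic_growth p c1 c2 E0)
  (n2 : (2 <= n)%N) (q : \bar R) (hq : (n%:R%:E < q)%E)
  (x0 y : 'rV[R]_n) (r rho F N : R) (r0 : 0 < r) (rho0 : 0 < rho) (rho1 : rho <= 1)
  (BU : eball x0 r `<=` U) (yB : eball y rho `<=` eball x0 r) (F0 : 0 <= F) (N0 : 0 <= N)
  (HF : Lnorm_on q (eball x0 r) f = F%:E)
  (HN : Lnorm_on p%:E (eball x0 r) (fun x => enorm (gradient u x)) = N%:E)
  (aa : R) (aaE : aa = 2 / n%:R - 2 * inv_exponent q) :
  enorm (gradient u y) <= 2 * (1 + F `^ (p - 1)^-1 + N) *
     (dg_const n c1 c2 g b / dg_ratio aa) `^ (aa * p)^-1 * rho `^ (- (4 / (aa * p))).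
Proof.
have [qi0 nqi] := inv_exponent_lt (ltnW n2) hq.
have p0 : 0 < p by rewrite (lt_trans _ p1).
have pm0 : 0 < p - 1 by rewrite subr_gt0.
have M1 : 1 <= 1 + F `^ (p - 1)^-1 + N by rewrite -addrA lerDl addr_ge0// powR_ge0.
set M := _ + _ + N in M1 *.
have M0 : 0 < M by rewrite (lt_le_trans _ M1).
have NM : N <= M by rewrite /M lerDr addr_ge0// powR_ge0.
have FM : F <= M `^ (p - 1).
  have -> : F = (F `^ (p - 1)^-1) `^ (p - 1) by rewrite -powRrM mulVf ?gt_eqF// powRr1.
  apply: ge0_ler_powR; rewrite ?nnegrE ?powR_ge0 ?(ltW pm0) ?(ltW M0)//.
  by rewrite /M addrAC lerDr addr_ge0.
have Mp0 : 0 < M `^ (p - 1) by exact: powR_gt0.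
have cf : cont_on U f by move=> x Ux; exact: (C1_cont (smooth_C1 [::] sf) Ux).
have HU x : dist2 y x <= rho ^+ 2 -> U x.
  by move=> H; apply/BU/yB; rewrite eball_dist2// ltW.
have yB' : [set x | dist2 y x <= rho ^+ 2] `<=` eball x0 r by rewrite -eball_dist2 ?ltW.
have mBx : measurable (@vect R n @^-1` eball x0 r).
  by rewrite eball_dist2 ?ltW//; exact: measurable_dist2_ball.
have mf A : A `<=` U -> measurable (@vect R n @^-1` A) -> Rn_measurable (fun x => \1_A x * f x).
  by move=> AU mA; exact: (Rn_measurable_indic oU cf AU mA).
apply: (interior_gradient_bound oU sE su sf pde rho0 rho1 HU p1 bE b_ge0 b_lt c1_gt0 c2_ge0 g0 gp HE n2
  M1 qi0 nqi _ _ aaE).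
- move=> A al Ay mA al0 lA.
  have AB : A `<=` eball x0 r by exact: subset_trans Ay yB'.
  have mAf := mf A (subset_trans AB BU) mA.
  case: q hq HF {qi0 nqi aaE} => [s|_|] //=.
    rewrite lte_fin => ns HF.
    have s2 : 2 <= s by rewrite (le_trans _ (ltW ns))// (ler_nat R 2).
    apply: (square_bound_powR s2 F0 FM Mp0 al0 AB mA mAf (mf _ BU mBx) lA).
    by apply: Lnorm_on_powR => //; rewrite (lt_le_trans _ s2).
  move=> HF; apply: (le_trans (square_bound_sup F0 AB mA mAf lA HF)).
  rewrite mulr0 subr0 powRr1 ?(ltW al0)// lee_fin ler_wpM2r ?(ltW al0)//.
  apply: (@le_trans _ _ ((M `^ (p - 1)) ^+ 2)); first by rewrite lerXn2r ?nnegrE// ltW.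
  by rewrite ler_peMl ?sqr_ge0// (ler_nat R 1 2).
- have E := Lnorm_on_powR p0 HN.
  have ssE x : `|enorm (gradient u x)| `^ p = grad_sq u x `^ (p / 2).
    rewrite ger0_norm ?enorm_ge0// /enorm -powR12_sqrt ?dot_ge0// -powRrM mulrC.
    by congr (_ `^ _); apply: eq_bigr => k _; rewrite mxE.
  have mS A : A `<=` U -> measurable (@vect R n @^-1` A) -> Rn_measurable (fun x => \1_A x * grad_sq u x `^ (p / 2)).
    move=> AU mA; apply: Rn_measurable_indic_powR; first by rewrite divr_gt0.
    by apply: (Rn_measurable_indic oU _ AU mA) => x Ux; exact: (C1_cont (C1_grad_sq oU su) Ux).
  apply: (@le_trans _ _ (N `^ p)%:E); last first.
    by rewrite lee_fin; apply: ge0_ler_powR; rewrite ?nnegrE ?(ltW p0) ?(ltW M0).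
  rewrite -E; apply: le_Rn_integral_ge0.
  + by apply: mS; [move=> x; exact: HU|exact: measurable_dist2_ball].
  + have := mS _ BU mBx; apply: eq_measurable_fun => t _ /=; by rewrite ssE.
  + by move=> x; apply: mulr_ge0; [rewrite indicE|exact: powR_ge0].
  + move=> x; rewrite ssE; apply: ler_wpM2r; first exact: powR_ge0.
    rewrite !indicE; have [xB|xB] := pselect ([set x | dist2 y x <= rho ^+ 2] x).
      by rewrite (mem_set xB) (mem_set (yB' _ xB)).
    by rewrite (memNset xB).
Qed.

Theorem proposition3 (R : realType) (n : nat) (p : R) (q : \bar R)
    (hn : (2 <= n)%N) (hp : 1 < p) (hq : (n%:R%:E < q)%E) :
  exists2 g : R, n%:R / p <= g &
  forall C1 C2 : R, 0 < C1 -> C1 <= C2 ->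
  exists C : R,
  forall (Omega U : set 'rV[R]_n) (f : 'rV[R]_n -> R)
    (E : R -> 'rV[R]_n -> R),
  lipschitz_domain Omega -> bounded_set Omega ->
  lipschitz_domain U -> compactly_contained U Omega ->
  smooth_on Omega f ->
  (forall eps : R, 0 < eps <= 1 ->
     smooth_on setT (E eps) /\ strictly_convex (E eps)) ->
  (forall (eps : R) (z0 zeta omega : 'rV[R]_n), 0 < eps <= 1 -> 1 <= enorm z0 ->
     C1 * (eps ^+ 2 + enorm z0 ^+ 2) `^ (p / 2 - 1) * enorm zeta ^+ 2
       <= dot (zeta *m hessian (E eps) z0) zeta /\
     `|dot (zeta *m hessian (E eps) z0) omega|
       <= C2 * (eps ^+ 2 + enorm z0 ^+ 2) `^ (p / 2 - 1)
          * enorm zeta * enorm omega) ->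
  forall (eps : R) (u : 'rV[R]_n -> R),
  0 < eps <= 1 ->
  smooth_on U u ->
  (forall x, U x ->
     - divergence (fun y => gradient (E eps) (gradient u y)) x = f x) ->
  forall (x0 : 'rV[R]_n) (r theta : R),
  0 < r <= 1 -> 0 < theta < 1 -> eball x0 r `<=` U ->
  (ereal_sup [set (enorm (gradient u x))%:E | x in eball x0 (theta * r)]
    <= (C / ((1 - theta) * r) `^ g)%:E
       * ((r `^ (n%:R / p))%:E
            * (1 + Lnorm_on q (eball x0 r) f `^ (p - 1)^-1)
          + Lnorm_on p%:E (eball x0 r) (fun x => enorm (gradient u x))))%E.
Proof.
have p0 : 0 < p by rewrite (lt_trans _ hp).
have nR0 : 0 < n%:R :> R by rewrite ltr0n (ltn_trans _ hn).
have [qi0 nqi] := inv_exponent_lt (ltnW hn) hq.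
pose aa := 2 / n%:R - 2 * inv_exponent q.
have [aa0 _] : 0 < aa /\ aa <= 1 by exact: dg_exponent_bounds.
pose e := 4 / (aa * p).
have e0 : 0 <= e by rewrite divr_ge0// mulr_ge0// ltW.
(* The iteration loses rho^-e, where rho = (1 - theta) r; the further loss of
   rho^(-n/p) pays for the factor r^(n/p) in front of the source, as
   rho <= r <= 1. *)
exists (e + n%:R / p); first by rewrite lerDr.
move=> C1 C2 C10 C12.
have C20 : 0 < C2 by rewrite (lt_le_trans _ C12).
(* g + 1 - p <= 0 makes the source term decrease with the level, and
   b = p / 2 - g < 1 / 2 keeps the weighted quadratic form coercive. *)
pose g := Num.min (p - 1) (p / 2); pose b := p / 2 - g.
have g0 : 0 < g by rewrite lt_min subr_gt0 hp divr_gt0.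
have b_ge0 : 0 <= b by rewrite subr_ge0 ge_min lexx orbT.
have b_lt : b * 2 < 1 by rewrite /b /g; case: (leP (p - 1) (p / 2)) => H; lra.
have gp : g + 1 - p <= 0 by rewrite /g; case: (leP (p - 1) (p / 2)) => H; lra.
(* The cost of replacing eps^2 + |z|^2, which lies between |z|^2 and 2 |z|^2. *)
pose w : R := 2 `^ `|p / 2 - 1|.
have w0 : 0 < w by rewrite powR_gt0.
pose c1 := C1 / w; pose c2 := C2 * w.
have c10 : 0 < c1 by rewrite divr_gt0.
have c20 : 0 <= c2 by rewrite mulr_ge0// ltW.
pose W := (dg_const n c1 c2 g b / dg_ratio aa) `^ (aa * p)^-1.
have W0 : 0 < W.
  rewrite powR_gt0// divr_gt0 ?dg_ratio_gt0// mulr_gt0 ?exprn_gt0//.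
  by rewrite ltr_wpDl// mulr_ge0 ?mulr_ge0//; exact: level_const_ge0.
exists (2 * W) => Omega U f E _ _ [oU _ _ _] [_ UO] sf0 HE0 HE1 eps u eps01 su pde x0 r theta.
move=> /andP[r0 r1] /andP[t0 t1] BU.
have sf : smooth_on U f by move=> s x Ux; apply: sf0; apply: UO; exact: subset_closure.
have [sE _] := HE0 eps eps01.
have HE : elliptic_growth p c1 c2 (E eps).
  move=> z z1.
  have ez1 : 1 <= enorm z.
    by rewrite -(ler_pXn2r (n := 2)) ?nnegrE ?enorm_ge0// enorm2 expr1n.
  have e2 : 0 <= eps ^+ 2 <= 1.
    by move/andP: eps01 => [e_gt0 e_le1]; rewrite sqr_ge0 exprn_ile1// ltW.
  have zz0 : 0 < dot z z by rewrite (lt_le_trans _ z1).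
  have [L1 L2] : (2 `^ `|p / 2 - 1|)^-1 * dot z z `^ (p / 2 - 1) <= (eps ^+ 2 + dot z z) `^ (p / 2 - 1) /\
     (eps ^+ 2 + dot z z) `^ (p / 2 - 1) <= 2 `^ `|p / 2 - 1| * dot z z `^ (p / 2 - 1).
    by apply: powR_comparable => //; lra.
  have HEz x y := HE1 eps z x y eps01 ez1.
  split=> [x|x y]; have := HEz x; rewrite enorm2.
    move=> /(_ 0)[H _]; apply: le_trans H; apply: ler_wpM2r; first exact: sqr_ge0.
    by rewrite /c1 -mulrA; apply: ler_wpM2l => //; exact: ltW.
  move=> /(_ y)[_ H]; apply: (le_trans H).
  apply: ler_wpM2r; first exact: enorm_ge0.
  apply: ler_wpM2r; first exact: enorm_ge0.
  by rewrite /c2 -mulrA; apply: ler_wpM2l => //; exact: ltW.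
set B := eball x0 r in BU *.
set rho := (1 - theta) * r.
have rho0 : 0 < rho by rewrite mulr_gt0// subr_gt0.
have rhor : rho <= r by rewrite ler_piMl ?(ltW r0)// gerBl ltW.
have rho1 : rho <= 1 by exact: le_trans r1.
set FF := Lnorm_on q B f; set NN := Lnorm_on p%:E B _.
have FF0 : (0 <= FF)%E by exact: Lnorm_ge0.
have NN0 : (0 <= NN)%E by exact: Lnorm_ge0.
have pm0 : 0 < (p - 1)^-1 by rewrite invr_gt0 subr_gt0.
have K0 : 0 < 2 * W / rho `^ (e + n%:R / p) by rewrite divr_gt0 ?powR_gt0// mulr_gt0.
have rn0 : 0 < r `^ (n%:R / p) by exact: powR_gt0.
apply: ub_ereal_sup => _ [y yB <-].
have yB' : eball y rho `<=` B.
  by move=> z /(eball_sub yB); rewrite (_ : theta * r + rho = r)//; rewrite /rho; ring.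
have T0 : (0 <= (r `^ (n%:R / p))%:E * (1 + FF `^ (p - 1)^-1))%E.
  by rewrite mule_ge0 ?lee_fin ?(ltW rn0)// adde_ge0// poweR_ge0.
(* If one of the two norms is infinite, then so is the right-hand side. *)
have [NNy|NNfin] := eqVneq NN +oo%E.
  rewrite NNy addey ?gt0_muley ?leey ?lte_fin//.
  by rewrite -ltNye (lt_le_trans _ T0).
have [FFy|FFfin] := eqVneq FF +oo%E.
  rewrite FFy poweRyr ?gt_eqF// addey// (gt0_muley (x := (r `^ (n%:R / p))%:E)) ?lte_fin//.
  rewrite addye ?gt0_muley ?leey ?lte_fin//.
  by rewrite -ltNye (lt_le_trans _ NN0).
have [F HF] : exists F, FF = F%:E.
  by exists (fine FF); rewrite fineK// ge0_fin_numE// ltey.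
have [N HN] : exists N, NN = N%:E.
  by exists (fine NN); rewrite fineK// ge0_fin_numE// ltey.
have F0 : 0 <= F by rewrite -lee_fin -HF.
have N0 : 0 <= N by rewrite -lee_fin -HN.
have H := gradient_bound_Lnorm oU sE su sf pde hp (erefl b) b_ge0 b_lt c10 c20 g0 gp HE hn hq
  r0 rho0 rho1 BU yB' F0 N0 HF HN (erefl aa).
rewrite HF HN [leRHS](_ : _ = (2 * W / rho `^ (e + n%:R / p) *
  (r `^ (n%:R / p) * (1 + F `^ (p - 1)^-1) + N))%:E)// lee_fin.
apply: (le_trans H); rewrite -/W.
have -> : rho `^ (- (4 / (aa * p))) = rho `^ (n%:R / p) / rho `^ (e + n%:R / p).
  have rn : rho != 0 by rewrite gt_eqF.
  rewrite powRN powRD ?rn ?implybT//; field; rewrite !gt_eqF ?powR_gt0//.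
have Rr : rho `^ (n%:R / p) <= r `^ (n%:R / p).
  by apply: ge0_ler_powR; rewrite ?nnegrE ?(ltW rho0) ?(ltW r0)// divr_ge0// ltW.
have R1 : rho `^ (n%:R / p) <= 1.
  by rewrite -[leRHS](powRr0 rho); apply: ger_powR; rewrite ?rho0// divr_ge0// ltW.
have P0 := powR_ge0 F (p - 1)^-1.
set a := F `^ _ in P0 *; set s := rho `^ (n%:R / p) in Rr R1 *; set t := r `^ _ in Rr rn0 *.
have Q : s * (1 + a + N) <= t * (1 + a) + N.
  rewrite mulrDr lerD// ?ler_wpM2r ?addr_ge0// ler_piMl//.
have := ler_wpM2l (ltW K0) Q; apply: le_trans.
by rewrite le_eqVlt; apply/orP; left; apply/eqP; ring.
Qed.
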